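(* For every claw-free bridgeless cubic graph $G$ with $|V(G)| \geq 48$, $\nu_2(G) \geq \frac{140}{141}\cdot \frac{|V(G)| + 2\cdot \nu_3(G)}{4}$.
   Context: Graphs are finite, without loops, possibly with multiple edges; cubic means every vertex has degree $3$, bridgeless means no edge whose removal increases the number of connected components, claw-free means no induced subgraph isomorphic to $K_{1,3}$. For $k\geq 1$, $\nu_k(G)$ is the maximum number of edges of a $k$-edge-colorable subgraph of $G$. *)

(* Defs.v *)
(* A finite loopless multigraph is given by a finite vertex
   type V, a finite edge type E and an endpoint map ends : E -> V * V with
   the two endpoints distinct (no loops); parallel edges are allowed. *)
From mathcomp Require Import all_boot all_order all_algebra.
Set Implicit Arguments. Unset Strict Implicit. Unset Printing Implicit Defensive.

Section MultiGraph.
Variables (V E : finType) (ends : E -> V * V).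

Definition loopless : Prop := forall e : E, (ends e).1 != (ends e).2.

Definition incident (v : V) (e : E) : bool := (v == (ends e).1) || (v == (ends e).2).

Definition joins (u w : V) (e : E) : bool :=
  ((ends e == (u, w)) || (ends e == (w, u))).

Definition degree (v : V) : nat := #|[set e | incident v e]|.

Definition cubic : Prop := forall v : V, degree v = 3.

Definition adjF (F : {set E}) : rel V :=
  fun u w => [exists e in F, joins u w e].

Definition ncomp (F : {set E}) : nat :=
  #|[set [set y | connect (adjF F) x y] | x : V]|.

Definition bridge (e : E) : bool := ncomp [set: E] < ncomp (~: [set e]).

Definition bridgeless : Prop := forall e : E, ~~ bridge e.

Definition mult (u w : V) : nat := #|[set e | joins u w e]|.

Definition induced_claw (v a b c : V) : bool :=
  [&& uniq [:: v; a; b; c],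
      mult v a == 1, mult v b == 1, mult v c == 1,
      mult a b == 0, mult a c == 0 & mult b c == 0].

Definition claw_free : Prop := forall v a b c : V, ~~ induced_claw v a b c.

Definition k_edge_colorable (k : nat) (F : {set E}) : bool :=
  [exists col : {ffun E -> 'I_k},
    [forall e in F, forall f in F,
      ((e != f) && [exists v, incident v e && incident v f]) ==> (col e != col f)]].

Definition nu (k : nat) : nat :=
  \max_(F : {set E} | k_edge_colorable k F) #|F|.

End MultiGraph.

(* Main.v *)
(* Write r = |E| - nu_3 and d = |V| - nu_2; the claim is |V| + 70 r >= 141 d.
   Contracting a triangle, or a digon together with a neighbour, does not
   increase r nor decrease d.  Every vertex of a claw-free cubic graph lies in a
   triangle or a digon, so giving weight 3 to the contracted vertices it remains
   to show 3|V| + 70 r >= 141 d when there are neither triangles nor digons.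

   Take a 3-edge-colouring leaving exactly r edges uncoloured.  An uncoloured
   edge e misses a colour x at one end and y at the other; the Kempe chain of
   colours x, y closes with e to an odd cycle whose edges are interchangeable as
   the uncoloured one, and all outgoing edges have the third colour.  By Kempe
   changes these cycles are disjoint and cycles with different third colours are
   not adjacent.  If a <= b <= c count them by third colour, dropping one colour
   class gives 2d <= r + a, so 6|V| >= 142a + b + c suffices.  In a colouring
   with a, then b, minimal, and the number of length-one Kempe chains between
   cycles of the third kind maximal, all cycles but those joined by such a chain
   are pairwise non-adjacent.  A pentagon has five neighbours outside, at most
   three of which are shared with other cycles: two consecutive shared ones must
   be shared via the same colour, and otherwise Kempe chains would match its five
   exits in pairs.  So a pentagon is worth 5 + 2 + 3/3 = 8 vertices; a longer
   cycle has at least three exits because there is no bridge, and is worth at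
   least 7 + 3/3 = 8 as well. *)

Require Import Defs.
From mathcomp Require Import all_boot all_order all_algebra.
From mathcomp Require Import zify lra.
Set Implicit Arguments. Unset Strict Implicit. Unset Printing Implicit Defensive.
Import Order.TTheory GRing.Theory Num.Theory.

(** * Orbits of two involutions *)

(** The three colour classes have a fixed total size, so only two of them can be made minimal. For
    the third colour no improving flip is at hand, and two adjacent cycles of that kind cannot both
    be charged for their surroundings. Maximising the one-edge chains confines this difficulty: a
    cycle with such a chain is charged a single vertex, any other cycle 8, and at least [b] cycles
    of the third kind belong to the latter. The worst case for the resulting count is [a = b = c]
    with no one-edge chain at all; it secures [24a] vertices, and 6*24 = 142 + 1 + 1 is where 141
    comes from.

    The extremal choice is always contradicted in a colouring reached by moving uncoloured edges
    along their cycles. Hence such moves have to preserve the size of every colour class and not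
    only the number of uncoloured edges.

    The weight 3 is forced by contraction, which replaces three vertices of weight 1 by one vertex;
    a further contraction can only lower the total. *)

Section Dihedral.
Variables (T : finType) (s t : T -> T).
Hypotheses (sK : involutive s) (tK : involutive t).

Definition dstep : rel T := fun u v => (v == s u) || (v == t u).
Definition dorb (u : T) : {set T} := [set v | connect dstep u v].
Definition dend (v : T) : bool := (s v == v) || (t v == v).

Lemma dstep_sym : symmetric dstep.
Proof.
by move=> u v; rewrite /dstep; apply/orP/orP => -[/eqP->|/eqP->];
  rewrite ?sK ?tK eqxx; [left|right|left|right].
Qed.

Lemma dorb_refl u : u \in dorb u.
Proof. by rewrite inE connect0. Qed.

Lemma dorb_s u v : v \in dorb u -> s v \in dorb u.
Proof.
rewrite !inE => uv; apply: connect_trans uv (connect1 _).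
by rewrite /dstep eqxx.
Qed.

Lemma dorb_t u v : v \in dorb u -> t v \in dorb u.
Proof.
rewrite !inE => uv; apply: connect_trans uv (connect1 _).
by rewrite /dstep eqxx orbT.
Qed.

Lemma dorb_min (A : {set T}) u : u \in A ->
  (forall v, v \in A -> s v \in A /\ t v \in A) -> dorb u \subset A.
Proof.
move=> uA clA; apply/subsetP => v; rewrite inE => /connectP[p pp ->].
elim: p u uA pp => [|w p IH] u uA //= /andP[/orP[]/eqP-> pp];
  by apply: IH pp; case: (clA _ uA).
Qed.

Lemma dorb_eq u v : v \in dorb u -> dorb v = dorb u.
Proof.
rewrite inE => uv; apply/setP => w; rewrite !inE.
have cs : connect_sym dstep by exact: sym_connect_sym dstep_sym.
exact/esym/(same_connect cs uv).
Qed.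

Section End.
Variable u : T.
Hypothesis su : s u = u.
Let p := s \o t.
Let N := order p u.

Let p_inj : injective p.
Proof. exact: inj_comp (inv_inj sK) (inv_inj tK). Qed.

(** [s] conjugates [p] into its inverse and fixes [u], so it sends the iterate of index [k] to index
    [-k]; [t], being [s \o p], sends it to index [-k-1]. *)
Let flip k : iter k p (s (iter k p u)) = u.
Proof.
elim: k => [|k IH] //=.
rewrite -[LHS]iterS iterSr -[s (p _)]/(s (s (t _))) sK -[p (t _)]/(s (t (t _))) tK.
exact: IH.
Qed.

Let mem_iter k : iter k p u \in dorb u.
Proof.
elim: k => [|k IH]; first exact: dorb_refl.
by rewrite iterS; apply: dorb_s; apply: dorb_t.
Qed.

(** By [flip] the orbit of [p] alone is already stable under both involutions. *)
Lemma dorb_orbit v : v \in dorb u -> exists2 k, k < N & v = iter k p u.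
Proof.
have sub : dorb u \subset [set v | fconnect p u v].
  have s_cl w : fconnect p u w -> fconnect p u (s w).
    move=> /iter_findex <-; set k := findex _ _ _.
    by rewrite fconnect_sym //; have := fconnect_iter p k (s (iter k p u)); rewrite flip.
  apply: dorb_min => [|w]; rewrite !inE ?connect0 // => uw; split.
    exact: s_cl.
  have -> : t w = s (p w) by rewrite /p /= sK.
  exact/s_cl/(connect_trans uw (fconnect1 p w)).
move=> /(subsetP sub); rewrite inE => uv; exists (findex p u v).
  exact: findex_max.
by rewrite iter_findex.
Qed.

Let iterN : iter N p u = u.
Proof. exact: iter_order. Qed.

Let iter_inj k : injective (iter k p).
Proof. by elim: k => [|k IH] x y //= /p_inj /IH. Qed.

(** With indices modulo [N], index [k] is fixed by [s] if [2k = 0] and by [t] if [2k + 1 = 0]. Apart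
    from [k = 0] the only solution is the integer part of [N/2], a fixed point of [s] for even [N]
    and of [t] for odd [N]. *)
Definition dother := iter N./2 p u.

Lemma dother_mem : dother \in dorb u.
Proof. exact: mem_iter. Qed.

Let N_gt0 : 0 < N. Proof. exact: order_gt0. Qed.

Let iter_id k : iter k p u = u -> k < N.*2 -> k = 0 \/ k = N.
Proof.
move=> ku kN.
have inj i j : i < N -> j < N -> iter i p u = iter j p u -> i = j.
  move=> iN jN eqij.
  have := orbit_uniq p u; rewrite /orbit -/N => /(uniqP u) un.
  apply: un; rewrite ?inE ?size_traject //.
  by rewrite !nth_traject.
case: (ltnP k N) => [lt|ge]; first by left; apply: inj.
right; have : k - N = 0; last by lia.
apply: inj => //; first by lia.
by move: ku; rewrite -{1}(subnK ge) iterD iterN.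
Qed.

(* A chain with an end is a path, so it has exactly one other end. *)
Lemma dend_other v : v \in dorb u -> dend v -> v != u -> v = dother.
Proof.
move=> /dorb_orbit[k kN ->] /orP[]/eqP fx nu.
  have : iter (k + k) p u = u by rewrite iterD -{1}fx flip.
  case/iter_id; rewrite -?addnn; try lia.
    by move=> k0; have k0' : k = 0 by [lia]; move: nu; rewrite k0' /= eqxx.
  by move=> kk; rewrite /dother -kk addnn doubleK.
have : iter (k.+1 + k) p u = u.
  rewrite iterD -{1}fx -[t _]sK -[s (t _)]/(p _) -iterS; exact: flip.
case/iter_id; try lia.
move=> kk; rewrite /dother; congr (iter _ p u); lia.
Qed.

Lemma dother_end : dend dother /\ (s dother == dother) = ~~ odd N || (N == 1).
Proof.
case: (boolP (odd N)) => oN /=.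
  have tf : t dother = dother.
    apply: (iter_inj (k := N./2.+1)); rewrite -[in LHS](sK (t _)).
    rewrite -[s (t _)]/(p _) /dother -iterS flip -iterD.
    by rewrite -[in LHS]iterN; congr (iter _ p u); lia.
  split; first by rewrite /dend tf eqxx orbT.
  apply/eqP/eqP => [sf|N1]; last by rewrite /dother N1 /= su.
  have : iter (N./2 + N./2) p u = u.
    by rewrite iterD -[in X in iter _ _ X = _]/dother -sf flip.
  case/iter_id; lia.
have sf : s dother = dother.
  apply: (iter_inj (k := N./2)); rewrite /dother flip -iterD.
  by rewrite -[in LHS]iterN; congr (iter _ p u); lia.
by rewrite /dend sf eqxx.
Qed.

Lemma dother_neq : t u != u -> dother != u.
Proof.
move=> tu; apply/eqP => /iter_id[]; first by lia.
  move=> N0; have N1 : N = 1 by lia.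
  by case/eqP: tu; rewrite -(sK (t u)) -[s (t u)]/(iter 1 p u) -N1 iterN.
lia.
Qed.

Lemma card_dorb : #|dorb u| = N.
Proof.
rewrite /N /order; apply: eq_card => v; rewrite !inE; apply/idP/idP => [uv|].
  have [k _ ->] : exists2 k, k < N & v = iter k p u by apply: dorb_orbit; rewrite inE.
  exact: fconnect_iter.
by move=> /iter_findex <-; have := mem_iter (findex p u v); rewrite inE.
Qed.

End End.

End Dihedral.

(** * Multigraphs and partial edge-colourings *)

Section Graph.
Variables (V E : finType) (ends : E -> V * V).
Local Notation inc := (incident ends).

(** Default value: the first end of [e] if [v] is not an end at all. *)
Definition oth (v : V) (e : E) : V :=
  if v == (ends e).1 then (ends e).2 else (ends e).1.

Lemma inc_oth v e : inc (oth v e) e.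
Proof. by rewrite /oth /incident; case: ifP; rewrite eqxx ?orbT. Qed.

Lemma inc1 e : inc (ends e).1 e.
Proof. by rewrite /incident eqxx. Qed.

Lemma inc2 e : inc (ends e).2 e.
Proof. by rewrite /incident eqxx orbT. Qed.

Lemma oth1 e : oth (ends e).1 e = (ends e).2.
Proof. by rewrite /oth eqxx. Qed.

Lemma inc_eq u v e : inc u e -> inc v e -> v != u -> v = oth u e.
Proof.
rewrite /incident /oth => /orP[]/eqP-> /orP[]/eqP->; rewrite ?eqxx // => nv.
by rewrite eq_sym (negPf nv).
Qed.

Lemma othK v e : inc v e -> oth (oth v e) e = v.
Proof.
rewrite /incident /oth; case: eqVneq => [->|/= nv /eqP->].
  by case: eqVneq.
by rewrite eqxx.
Qed.

Lemma joinsE u w e : u != w -> joins ends u w e = inc u e && inc w e.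
Proof.
rewrite /joins /incident; case: (ends e) => a b /= uw.
rewrite !xpair_eqE !(eq_sym a) !(eq_sym b).
have na : ~~ ((u == a) && (w == a)) by apply: contraNN uw => /andP[/eqP-> /eqP->].
have nb : ~~ ((u == b) && (w == b)) by apply: contraNN uw => /andP[/eqP-> /eqP->].
by move: na nb; do 4!case: (_ == _).
Qed.

Definition cut (X : {set V}) : {set E} :=
  [set e | ((ends e).1 \in X) != ((ends e).2 \in X)].

Definition inside (X : {set V}) : {set E} :=
  [set e | ((ends e).1 \in X) && ((ends e).2 \in X)].

(** Bridgelessness in terms of cuts, a form that passes to contractions because every cut of the
    contracted graph is a cut of the original one. *)
Definition bridgefree : Prop := forall X : {set V}, #|cut X| != 1.

Lemma insideP (X : {set V}) e v : inc v e ->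
  (e \in inside X) = (v \in X) && (oth v e \in X).
Proof.
rewrite inE /incident /oth; case: eqVneq => [->|_ /= /eqP->] //.
by rewrite andbC.
Qed.

Lemma cutP (X : {set V}) e v : inc v e ->
  (e \in cut X) = ((v \in X) != (oth v e \in X)).
Proof.
rewrite inE /incident /oth; case: eqVneq => [->|_ /= /eqP->] //.
by rewrite eq_sym.
Qed.

(** * Partial proper colourings, with [None] for uncoloured edges, and Kempe switches *)

Section Coloring.
Variable C : finType.
Implicit Types (col : {ffun E -> option C}) (c x y z : C) (K : {set V}).

(** Stated for a single vertex because a colouring restricted to a contracted graph is proper
    everywhere except possibly at the contracted vertex. *)
Definition pcol_at col (v : V) : bool :=
  [forall e, forall f, [&& inc v e, inc v f, col e == col f & col e != None] ==> (e == f)].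

Definition pcol col : bool := [forall v, pcol_at col v].

Lemma pcol_atP col v :
  reflect (forall e f c, inc v e -> inc v f -> col e = Some c -> col f = Some c -> e = f)
          (pcol_at col v).
Proof.
apply: (iffP 'forall_forallP) => [H e f c ve vf ec fc|H e f].
  by apply/eqP; move/implyP: (H e f); apply; rewrite ve vf ec fc eqxx.
apply/implyP => /and4P[ve vf /eqP ef]; case ec: (col e) => [c|] // _.
by apply/eqP; apply: (H e f c); rewrite -?ef.
Qed.

Lemma pcolP col :
  reflect (forall v e f c, inc v e -> inc v f -> col e = Some c -> col f = Some c -> e = f)
          (pcol col).
Proof.
apply: (iffP forallP) => H v; first exact/pcol_atP.
by apply/pcol_atP; apply: H.
Qed.

Definition sees col c (v : V) : bool := [exists e, inc v e && (col e == Some c)].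

Lemma seesP col c v : reflect (exists2 e, inc v e & col e = Some c) (sees col c v).
Proof.
by apply: (iffP existsP) => [[e /andP[ve /eqP ec]]|[e ve ec]]; exists e; rewrite // ve ec eqxx.
Qed.

(* [mate col c v = v] when no edge at [v] has colour [c]. *)
Definition mate col c (v : V) : V :=
  if [pick e | inc v e && (col e == Some c)] is Some e then oth v e else v.

Lemma mateE col c v e : pcol col -> inc v e -> col e = Some c -> mate col c v = oth v e.
Proof.
move=> /pcolP pc ve ec; rewrite /mate; case: pickP => [f /andP[vf /eqP fc]|/(_ e)].
  by rewrite (pc v e f c).
by rewrite ve ec eqxx.
Qed.

Lemma mate_id col c v : ~~ sees col c v -> mate col c v = v.
Proof.
move=> nh; rewrite /mate; case: pickP => // e ev; case/negP: nh.
by apply/existsP; exists e.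
Qed.

Lemma mateP col c v : sees col c v ->
  exists e, [/\ inc v e, col e = Some c & mate col c v = oth v e].
Proof.
move=> /seesP[f vf fc]; rewrite /mate; case: pickP => [e /andP[ve /eqP ec]|/(_ f)].
  by exists e.
by rewrite vf fc eqxx.
Qed.

Lemma mateK col c : pcol col -> involutive (mate col c).
Proof.
move=> pc v; case hv: (sees col c v); last by rewrite !(mate_id (negbT hv)).
have [e [ve ec ->]] := mateP hv.
by rewrite (mateE pc (inc_oth v e) ec) othK.
Qed.

Lemma eq_sees col col' c c' v :
  (forall e, inc v e -> (col e == Some c) = (col' e == Some c')) ->
  sees col c v = sees col' c' v.
Proof.
by move=> H; apply: eq_existsb => e; case ve: (inc v e) => //=; apply: H.
Qed.

Lemma eq_mate col col' c c' v :
  (forall e, inc v e -> (col e == Some c) = (col' e == Some c')) ->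
  mate col c v = mate col' c' v.
Proof.
move=> H; rewrite /mate (eq_pick (Q := fun e => inc v e && (col' e == Some c'))) //.
by move=> e /=; case ve: (inc v e) => //=; apply: H.
Qed.

Definition swapo x y (o : option C) : option C :=
  if o == Some x then Some y else if o == Some y then Some x else o.

Lemma swapoK x y : involutive (swapo x y).
Proof.
move=> o; rewrite /swapo; case: (o =P Some x) => [->|nx].
  rewrite eqxx; case: (Some y =P Some x) => [->|] //.
case: (o =P Some y) => [->|ny]; first by rewrite eqxx.
by do 2!case: eqP => //.
Qed.

Lemma swapo_None x y o : (swapo x y o == None) = (o == None).
Proof.
by rewrite /swapo; case: (o =P Some x) => [->|_] //; case: (o =P Some y) => [->|_].
Qed.

Lemma swapo_id x y c : c != x -> c != y -> swapo x y (Some c) = Some c.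
Proof.
by rewrite /swapo => nx ny; rewrite !(inj_eq (@Some_inj _)) (negPf nx) (negPf ny).
Qed.

Definition touches (K : {set V}) (e : E) : bool :=
  ((ends e).1 \in K) || ((ends e).2 \in K).

Lemma touchesP (K : {set V}) e v : inc v e -> touches K e = (v \in K) || (oth v e \in K).
Proof.
rewrite /touches /incident /oth; case: eqVneq => [->|_ /= /eqP->] //.
by rewrite orbC.
Qed.

(** If [K] is closed under both mates, an edge of colour [x] or [y] touching [K] lies inside [K], so
    this is the usual Kempe switch on [K]. *)
Definition swapc col x y (K : {set V}) : {ffun E -> option C} :=
  [ffun e => if touches K e then swapo x y (col e) else col e].

Lemma swapc_in col x y K v e : v \in K -> inc v e -> swapc col x y K e = swapo x y (col e).
Proof. by move=> vK ve; rewrite ffunE (touchesP K ve) vK. Qed.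

Definition closedxy col x y (K : {set V}) : Prop :=
  forall v, v \in K -> mate col x v \in K /\ mate col y v \in K.

Lemma swapc_out col x y K v e : pcol col -> closedxy col x y K -> v \notin K -> inc v e ->
  swapc col x y K e = col e.
Proof.
move=> pc cl vK ve; rewrite ffunE (touchesP K ve) (negPf vK) /=; case: ifP => // oK.
rewrite /swapo.
case: (col e =P Some x) => [ex|_].
  have [+ _] := cl _ oK; rewrite (mateE pc (inc_oth v e) ex) othK //.
  by rewrite (negPf vK).
case: (col e =P Some y) => [ey|//].
have [_] := cl _ oK; rewrite (mateE pc (inc_oth v e) ey) othK //.
by rewrite (negPf vK).
Qed.

Lemma swapc_None col x y K e : (swapc col x y K e == None) = (col e == None).
Proof. by rewrite ffunE; case: ifP => // _; rewrite swapo_None. Qed.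

Lemma swapc_pcol col x y K : pcol col -> closedxy col x y K -> pcol (swapc col x y K).
Proof.
move=> pc cl; apply/pcolP => v e f c ve vf.
case: (boolP (v \in K)) => vK.
  rewrite !(swapc_in _ _ _ vK) // => ec fc.
  have := swapoK x y (col e); have := swapoK x y (col f); rewrite ec fc => {}fc {}ec.
  case cc: (swapo x y (Some c)) => [c'|]; last by move/eqP: cc; rewrite swapo_None.
  by move/pcolP: pc => /(_ v e f c'); apply=> //; rewrite -?ec -?fc.
by rewrite !(swapc_out pc cl vK) //; exact: (pcolP _ pc) v e f c ve vf.
Qed.

Lemma swapc_seesout col x y K v c : pcol col -> closedxy col x y K -> v \notin K ->
  sees (swapc col x y K) c v = sees col c v.
Proof. by move=> pc cl vK; apply: eq_sees => e ve; rewrite (swapc_out pc cl vK ve). Qed.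

Lemma swapc_mateout col x y K v c : pcol col -> closedxy col x y K -> v \notin K ->
  mate (swapc col x y K) c v = mate col c v.
Proof. by move=> pc cl vK; apply: eq_mate => e ve; rewrite (swapc_out pc cl vK ve). Qed.

Lemma swapo_eq x y o c c' : swapo x y (Some c) = Some c' ->
  (swapo x y o == Some c') = (o == Some c).
Proof. by move=> <-; rewrite (inj_eq (inv_inj (@swapoK x y))). Qed.

Lemma swapox x y : swapo x y (Some x) = Some y.
Proof. by rewrite /swapo eqxx. Qed.
Lemma swapoy x y : swapo x y (Some y) = Some x.
Proof. by rewrite -{1}(swapox x y) swapoK. Qed.

Lemma swapc_seesin col x y K v c c' : swapo x y (Some c) = Some c' -> v \in K ->
  sees (swapc col x y K) c' v = sees col c v.
Proof.
by move=> cc vK; apply: eq_sees => e ve; rewrite (swapc_in _ _ _ vK ve) (swapo_eq _ cc).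
Qed.

Definition unc col : nat := #|[set e | col e == None]|.

Definition size_of col c : nat := #|[set e | col e == Some c]|.

Lemma unc_swapc col x y K : unc (swapc col x y K) = unc col.
Proof. by apply: eq_card => e; rewrite !inE swapc_None. Qed.

Definition opt col : Prop := pcol col /\ forall col', pcol col' -> unc col <= unc col'.

Lemma opt_unc col col' : opt col -> pcol col' -> unc col' <= unc col -> opt col'.
Proof.
move=> [_ oc] pc le; split=> // col'' pc''; exact: leq_trans le (oc _ pc'').
Qed.

Lemma opt_swapc col x y K : opt col -> closedxy col x y K -> opt (swapc col x y K).
Proof.
move=> oc cl; apply: (opt_unc oc); last by rewrite unc_swapc.
by apply: swapc_pcol => //; case: oc.
Qed.

Section Loopless.
Hypothesis ll : loopless ends.

Lemma oth_neq v e : oth v e != v.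
Proof.
rewrite /oth; case: ifPn => [/eqP->|]; last by rewrite eq_sym.
by rewrite eq_sym; apply: ll.
Qed.

Lemma mate_eq col c v : (mate col c v == v) = ~~ sees col c v.
Proof.
case: (boolP (sees col c v)) => [|/mate_id->]; last by rewrite eqxx.
by case/mateP => e [_ _ ->]; rewrite (negPf (oth_neq v e)).
Qed.

Lemma card_sees col c : pcol col -> #|[set v | sees col c v]| = (size_of col c).*2.
Proof.
move=> pc; rewrite -addnn.
pose A := [set e | col e == Some c].
pose f1 e := (ends e).1; pose f2 e := (ends e).2.
have inj1 : {in A &, injective f1}.
  move=> e g; rewrite !inE => /eqP ec /eqP gc eg; move/pcolP: pc => /(_ (f1 e) e g c).
  by apply; rewrite ?inc1 // eg inc1.
have inj2 : {in A &, injective f2}.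
  move=> e g; rewrite !inE => /eqP ec /eqP gc eg; move/pcolP: pc => /(_ (f2 e) e g c).
  by apply; rewrite ?inc2 // eg inc2.
have -> : [set v | sees col c v] = f1 @: A :|: f2 @: A.
  apply/setP => v; rewrite !inE; apply/seesP/orP.
    case=> e /orP[]/eqP-> ec; [left|right]; apply/imsetP; exists e => //; by rewrite inE ec.
  by case=> /imsetP[e]; rewrite inE => /eqP ec ->; exists e => //; rewrite ?inc1 ?inc2.
rewrite cardsU !card_in_imset //.
suff -> : f1 @: A :&: f2 @: A = set0 by rewrite cards0 subn0.
apply/setP => v; rewrite !inE; apply/negP => /andP[/imsetP[e eA ->] /imsetP[g gA eg]].
move: eA gA; rewrite !inE => /eqP ec /eqP gc.
have := ll e; move/pcolP: pc => /(_ (f1 e) e g c); rewrite inc1 {1}eg inc2 => /(_ isT isT ec gc) ge.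
by rewrite -[(ends e).1]/(f1 e) eg -ge eqxx.
Qed.

End Loopless.
End Coloring.
End Graph.

(** * Colourings with the fewest uncoloured edges *)

Section Tri.
Implicit Types (x y z c : 'I_3).
Definition tri x y z := uniq [:: x; y; z].

Lemma triP x y z c : tri x y z -> [\/ c = x, c = y | c = z].
Proof.
move=> t; have /(_ c) : [:: x; y; z] =i predT.
  by apply/subset_cardP; rewrite ?subset_predT // (card_uniqP t) card_ord.
by rewrite !inE => /or3P[]/eqP; [constructor 1|constructor 2|constructor 3].
Qed.

Lemma triC x y z : tri x y z -> tri y x z.
Proof. by rewrite /tri /= !inE !negb_or (eq_sym y x) => /andP[/andP[-> ->] /andP[-> _]]. Qed.

Lemma triR x y z : tri x y z -> tri y z x.
Proof.
by rewrite /tri /= !inE !negb_or (eq_sym y x) (eq_sym z x) => /andP[/andP[-> ->] /andP[-> _]].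
Qed.

Lemma tri_ex x y : x != y -> exists z, tri x y z.
Proof.
move=> xy; have : 0 < #|~: [set x; y]|.
  by rewrite cardsCs setCK card_ord cards2 xy.
case/card_gt0P => z; rewrite !inE negb_or => /andP[zx zy].
by exists z; rewrite /tri /= !inE !negb_or xy (eq_sym x) zx (eq_sym y) zy.
Qed.

Lemma tri_neq x y z : tri x y z -> [/\ x != y, x != z & y != z].
Proof. by rewrite /tri /= !inE !negb_or => /andP[/andP[-> ->] /andP[-> _]]. Qed.

Lemma triI x y z : x != y -> x != z -> y != z -> tri x y z.
Proof. by rewrite /tri /= !inE !negb_or => -> -> ->. Qed.

End Tri.

Section Opt.
Variables (V E : finType) (ends : E -> V * V).
Local Notation inc := (incident ends).
Hypotheses (ll : loopless ends) (cub : cubic ends).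
Local Notation coloring := {ffun E -> option 'I_3}.
Implicit Types (col : coloring) (c x y z : 'I_3) (K A : {set V}) (u v w a b : V) (e f g h : E).
Local Notation oth := (oth ends).
Local Notation sees := (sees ends).
Local Notation mate := (mate ends).
Local Notation pcol := (pcol ends).
Local Notation opt := (opt ends).
Local Notation swapc := (swapc ends).

Definition adjz col z : rel V := fun u v => [exists c, (c != z) && (v == mate col c u)].
(* The Kempe component of [u] in the two colours other than [z]. *)
Definition kempe col z u : {set V} := [set v | connect (adjz col z) u v].

Lemma kempe_dorb col x y z u : tri x y z -> kempe col z u = dorb (mate col x) (mate col y) u.
Proof.
move=> t; apply/setP => v; rewrite !inE; apply: eq_connect => {u v} u v.
have [xy xz yz] := tri_neq t.
apply/existsP/orP => [[c /andP[cz /eqP->]]|[]/eqP->].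
- by case: (triP c t) cz => ->; rewrite ?eqxx; [left|right|].
- by exists x; rewrite xz eqxx.
- by exists y; rewrite yz eqxx.
Qed.

Lemma kempe_refl col z u : u \in kempe col z u.
Proof. by rewrite inE connect0. Qed.

Lemma kempe_mate col z u v c : c != z -> v \in kempe col z u -> mate col c v \in kempe col z u.
Proof.
move=> cz; rewrite !inE => uv; apply: connect_trans uv (connect1 _).
by apply/existsP; exists c; rewrite cz eqxx.
Qed.

Lemma kempe_closedxy col x y z u : tri x y z -> closedxy ends col x y (kempe col z u).
Proof. by case/tri_neq => _ xz yz v vK; split; apply: kempe_mate. Qed.

Lemma kempe_min col z u A : u \in A ->
  (forall v c, v \in A -> c != z -> mate col c v \in A) -> kempe col z u \subset A.
Proof.
move=> uA clA; apply/subsetP => v; rewrite inE => /connectP[p pp ->].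
elim: p u uA pp => [|w p IH] u uA //= /andP[/existsP[c /andP[cz /eqP->]] pp].
by apply: IH pp; apply: clA.
Qed.

Lemma adjz_sym col z : pcol col -> symmetric (adjz col z).
Proof.
move=> pc u v; apply/existsP/existsP => -[c /andP[cz /eqP->]]; exists c;
  by rewrite cz (mateK c pc) eqxx.
Qed.

Lemma kempe_eq col z u v : pcol col -> v \in kempe col z u -> kempe col z v = kempe col z u.
Proof.
move=> pc; rewrite inE => uv; apply/setP => w; rewrite !inE.
exact/esym/(same_connect (sym_connect_sym (adjz_sym z pc)) uv).
Qed.

Lemma kempe_sym col z u v : pcol col -> v \in kempe col z u -> u \in kempe col z v.
Proof. by move=> pc /(kempe_eq pc)->; apply: kempe_refl. Qed.

Definition zend col x y v := ~~ sees col x v || ~~ sees col y v.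

Lemma zend_dend col x y v : zend col x y v = dend (mate col x) (mate col y) v.
Proof. by rewrite /zend /dend !mate_eq. Qed.

Lemma ends_uniq col x y z u v w : pcol col -> tri x y z -> zend col x y u ->
  v \in kempe col z u -> w \in kempe col z u -> zend col x y v -> zend col x y w ->
  v != u -> w != u -> v = w.
Proof.
move=> pc t; wlog nx: x y t / ~~ sees col x u => [hwlog|_].
  case/orP => nx.
    by apply: hwlog => //; rewrite /zend nx.
  have sw q : zend col x y q = zend col y x q by rewrite /zend orbC.
  by rewrite !sw; apply: hwlog; rewrite ?(triC t) // /zend nx.
have su : mate col x u = u by rewrite mate_id.
rewrite !(kempe_dorb _ _ t) !zend_dend => vu wu ve we vnu wnu.
have d := dend_other (mateK x pc) (mateK y pc) su.
by rewrite (d _ vu ve vnu) (d _ wu we wnu).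
Qed.

Lemma ends_other col x y z u : pcol col -> tri x y z -> ~~ sees col x u -> sees col y u ->
  exists v, [/\ v \in kempe col z u, v != u & zend col x y v].
Proof.
move=> pc t nx hy; have su : mate col x u = u by rewrite mate_id.
exists (dother (mate col x) (mate col y) u); rewrite (kempe_dorb _ _ t) zend_dend; split.
- exact: dother_mem.
- by apply: dother_neq; rewrite ?mate_eq ?hy //; apply: mateK.
- by case: (dother_end (mateK x pc) (mateK y pc) su).
Qed.

Lemma ends_odd col x y z u v : pcol col -> tri x y z -> ~~ sees col x u ->
  v \in kempe col z u -> v != u -> ~~ sees col y v -> sees col x v -> odd #|kempe col z u|.
Proof.
move=> pc t nx + vnu ny hx; have su : mate col x u = u by rewrite mate_id.
rewrite (kempe_dorb _ _ t) => vu.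
have ve : dend (mate col x) (mate col y) v by rewrite -zend_dend /zend ny orbT.
have vE := dend_other (mateK x pc) (mateK y pc) su vu ve vnu.
rewrite (card_dorb (mateK x pc) (mateK y pc) su).
have [_] := dother_end (mateK x pc) (mateK y pc) su.
by rewrite -vE mate_eq // hx; case: odd.
Qed.

(** Both sides are three minus the number of coloured edges at [v], since the degree equals the
    number of colours. *)
Lemma miss_unc col v : pcol col ->
  #|[set c | ~~ sees col c v]| = #|[set e | inc v e && (col e == None)]|.
Proof.
move=> pc; have d3 : #|[set e | inc v e]| = 3 := cub v.
pose B := [set e | inc v e && (col e != None)].
pose f e : 'I_3 := odflt ord0 (col e).
have fi : {in B &, injective f}.
  move=> e g; rewrite !inE /f => /andP[ve ec] /andP[vg gc].
  case ee: (col e) ec => [c|] // _; case gg: (col g) gc => [c'|] // _ /= cc.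
  by apply: (pcolP _ _ pc v e g c ve vg ee); rewrite gg cc.
have fB : f @: B = [set c | sees col c v].
  apply/setP => c; rewrite inE; apply/imsetP/seesP => [[e]|[e ve ec]].
    rewrite inE => /andP[ve]; rewrite /f; case ec: (col e) => [c'|] // _ ->.
    by exists e.
  by exists e; rewrite ?inE ?ve /f ec.
have c1 : #|[set c | sees col c v]| + #|[set c | ~~ sees col c v]| = 3.
  apply: etrans (card_ord 3); rewrite -(cardsC [set c | sees col c v]); congr (_ + _).
  by apply: eq_card => c; rewrite !inE.
have c2 : #|B| + #|[set e | inc v e && (col e == None)]| = 3.
  apply: etrans d3; rewrite -[RHS](cardsID [set e | col e != None]); congr (_ + _).
    by apply: eq_card => e; rewrite !inE.
  by apply: eq_card => e; rewrite !inE negbK andbC.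
have : #|B| = #|[set c | sees col c v]| by rewrite -fB card_in_imset.
lia.
Qed.

Lemma unc_miss col v e : pcol col -> inc v e -> col e = None -> exists c, ~~ sees col c v.
Proof.
move=> pc ve ec; have : 0 < #|[set c | ~~ sees col c v]|.
  by rewrite miss_unc //; apply/card_gt0P; exists e; rewrite inE ve ec.
by case/card_gt0P => c; rewrite inE; exists c.
Qed.

Lemma miss_exunc col v c : pcol col -> ~~ sees col c v -> exists e, inc v e /\ col e = None.
Proof.
move=> pc nc; have : 0 < #|[set e | inc v e && (col e == None)]|.
  by rewrite -miss_unc //; apply/card_gt0P; exists c; rewrite inE.
by case/card_gt0P => e; rewrite inE => /andP[ve /eqP ec]; exists e.
Qed.

Lemma unc2_miss2 col v e f : pcol col -> inc v e -> inc v f -> e != f ->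
  col e = None -> col f = None ->
  exists c c', [/\ c != c', ~~ sees col c v & ~~ sees col c' v].
Proof.
move=> pc ve vf ef ec fc; have : 1 < #|[set c | ~~ sees col c v]|.
  rewrite miss_unc //; apply/card_gt1P; exists e, f.
  by rewrite !inE ve vf ec fc ef.
by case/card_gt1P => c [c' []]; rewrite !inE => ? ? ?; exists c, c'.
Qed.

Definition setc col e o : coloring := [ffun f => if f == e then o else col f].

Lemma setc_unc col e c : col e = None -> (unc (setc col e (Some c))).+1 = unc col.
Proof.
move=> ec; rewrite /unc [in RHS](cardsD1 e) inE ec eqxx add1n; congr _.+1.
by apply: eq_card => f; rewrite !inE ffunE; case: (f =P e).
Qed.

(** A colour missing at both ends could be given to [e]. *)
Lemma opt_nocommon col e a c : opt col -> inc a e -> col e = None ->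
  ~~ sees col c a -> sees col c (oth a e).
Proof.
move=> [pc oc] ae ec na; case: (boolP (sees col c (oth a e))) => // nb.
have : unc col <= unc (setc col e (Some c)).
  apply: oc; apply/pcolP => v f g d vf vg; rewrite !ffunE.
  have key h : inc v h -> inc v e -> col h = Some c -> False.
    move=> vh ve hc; have hv : sees col c v by apply/seesP; exists h.
    case: (eqVneq v a) => [va|va]; first by move: na; rewrite -va hv.
    by move: nb; rewrite -(inc_eq ae ve va) hv.
  case: (f =P e) => [fe|_]; case: (g =P e) => [ge|_] //; first by rewrite fe ge.
  - by move=> [<-] gc; case: (key g) => //; rewrite -fe.
  - by move=> fc [cd]; case: (key f) => //; rewrite -?ge // fc cd.
  - exact: (pcolP _ _ pc v f g d vf vg).
by rewrite -(setc_unc c ec) ltnn.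
Qed.

(** If the chain from [a] did not reach the other end, switching it would make [y] missing at both
    ends. *)
Lemma opt_chain col e a x y z : opt col -> tri x y z -> inc a e -> col e = None ->
  ~~ sees col x a -> ~~ sees col y (oth a e) -> oth a e \in kempe col z a.
Proof.
move=> oc t ae ec nx ny; apply/negPn/negP => nK.
have [pc _] := oc.
have cl : closedxy ends col x y (kempe col z a) by apply: kempe_closedxy.
have oc' := opt_swapc oc cl.
have ec' : swapc col x y (kempe col z a) e = None by apply/eqP; rewrite swapc_None ec.
have nya : ~~ sees (swapc col x y (kempe col z a)) y a.
  by rewrite (swapc_seesin _ _ (swapox x y)) ?kempe_refl.
have := opt_nocommon oc' ae ec' nya.
by rewrite swapc_seesout // (negPf ny).
Qed.

(** Two uncoloured edges at [v] leave two colours [x], [y] missing there, so both far ends see [x]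
    and [y] and miss [z]. Both are then ends of the [x]-[z] chain starting at [v], which has only
    one other end. So the edges are parallel, and their common far end would miss two colours
    although it sees [x] and [y]. *)
Lemma opt_unc_uniq col v e f : opt col -> inc v e -> inc v f -> col e = None -> col f = None ->
  e = f.
Proof.
move=> oc ve vf ec fc; apply/eqP/negPn/negP => ef; have [pc _] := oc.
have [x [y [xy nx ny]]] := unc2_miss2 pc ve vf ef ec fc.
have [z t] := tri_ex xy.
have far g : inc v g -> col g = None -> ~~ sees col z (oth v g) /\ (z \in [set c | sees col c v]).
  move=> vg gc; have hx := opt_nocommon oc vg gc nx; have hy := opt_nocommon oc vg gc ny.
  have [c nc] := unc_miss pc (inc_oth ends v g) gc.
  case: (triP c t) nc => ->; rewrite ?hx ?hy // => nz; split=> //.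
  rewrite inE -(othK vg); apply: (opt_nocommon oc (inc_oth _ _ _) gc nz).
have [nze hz] := far e ve ec; have [nzf _] := far f vf fc.
have [xy' xz yz] := tri_neq t.
have t' : tri x z y by rewrite triI // eq_sym.
have inK g : inc v g -> col g = None -> oth v g \in kempe col y v.
  by move=> vg gc; have [nz _] := far g vg gc; apply: (opt_chain oc t').
have same : oth v e = oth v f.
  apply: (@ends_uniq col x z y v) => //; rewrite ?inK ?oth_neq // /zend ?nx ?nze ?nzf ?orbT //.
have vf' : inc (oth v e) f by rewrite same inc_oth.
have [c [c' [cc nc nc']]] := unc2_miss2 pc (inc_oth _ v e) vf' ef ec fc.
have hx := opt_nocommon oc ve ec nx; have hy := opt_nocommon oc ve ec ny.
by move: cc nc nc'; case: (triP c t) => ->; rewrite ?hx ?hy //; case: (triP c' t) => ->;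
  rewrite ?hx ?hy ?eqxx.
Qed.

Lemma opt_miss_uniq col v c c' : opt col -> ~~ sees col c v -> ~~ sees col c' v -> c = c'.
Proof.
move=> oc nc nc'; apply/eqP/negPn/negP => cc; have [pc _] := oc.
have : 1 < #|[set e | inc v e && (col e == None)]|.
  by rewrite -miss_unc //; apply/card_gt1P; exists c, c'; rewrite !inE nc nc' cc.
case/card_gt1P => e [f []]; rewrite !inE => /andP[ve /eqP ec] /andP[vf /eqP fc] /eqP; apply.
exact: (opt_unc_uniq oc ve vf).
Qed.

End Opt.

(** * Moving an uncoloured edge along its odd cycle *)

Section Shift.
Variables (V E : finType) (ends : E -> V * V).
Local Notation inc := (incident ends).
Hypotheses (ll : loopless ends) (cub : cubic ends).
Local Notation coloring := {ffun E -> option 'I_3}.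
Implicit Types (col : coloring) (c x y z : 'I_3) (K A : {set V}) (u v w a b : V) (e f g h : E).
Local Notation oth := (oth ends).
Local Notation sees := (sees ends).
Local Notation mate := (mate ends).
Local Notation pcol := (pcol ends).
Local Notation opt := (opt ends).
Local Notation swapc := (swapc ends).
Local Notation kempe := (kempe ends).
Local Notation inside := (inside ends).

Lemma sees_other col a c x : opt col -> ~~ sees col x a -> c != x -> sees col c a.
Proof.
move=> oc nx; apply: contraNT => nc; apply/eqP; exact: (opt_miss_uniq ll cub oc nc nx).
Qed.

(* The colour seen at both ends of an uncoloured edge of an optimal colouring
   (a junk value otherwise). *)
Definition third col e : 'I_3 :=
  odflt ord0 [pick z | sees col z (ends e).1 && sees col z (ends e).2].

(* The vertex set of the odd cycle formed by [e] and the Kempe chain between its ends. *)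
Definition hole col e : {set V} := kempe col (third col e) (ends e).1.

(** An uncoloured edge read from its end [a]; [defect_sym] reads it from the other end. *)
Definition defect col e a x y z : Prop :=
  [/\ tri x y z, inc a e, col e = None, ~~ sees col x a & ~~ sees col y (oth a e)].

Lemma defect_sym col e a x y z : defect col e a x y z -> defect col e (oth a e) y x z.
Proof. by case=> t ae ec nx ny; split; rewrite ?othK ?inc_oth //; apply: triC. Qed.

Lemma defect_third col e a x y z : opt col -> defect col e a x y z -> third col e = z.
Proof.
move=> oc [t ae ec nx ny]; rewrite /third.
have [xy xz yz] := tri_neq t.
have key c : (sees col c (ends e).1 && sees col c (ends e).2) = (c == z).
  have sa d : sees col d a = (d != x).
    apply/idP/idP => [sd|dx]; last exact: sees_other oc nx dx.
    by apply: contraNneq nx => <-.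
  have sb d : sees col d (oth a e) = (d != y).
    apply/idP/idP => [sd|dy]; last exact: sees_other oc ny dy.
    by apply: contraNneq ny => <-.
  have -> : sees col c (ends e).1 && sees col c (ends e).2 = sees col c a && sees col c (oth a e).
    move: ae; rewrite /incident /oth; case: eqVneq => [->|_ /= /eqP->] //.
    by rewrite andbC.
  rewrite sa sb; case: (triP c t) => ->; rewrite ?eqxx ?(eq_sym z) ?xz ?yz //=.
    by rewrite (negPf xz).
  by rewrite andbF (negPf yz).
case: pickP => [c|/(_ z)]; rewrite /= key; first by move/eqP.
by rewrite eqxx.
Qed.

Lemma cfgP col e a : opt col -> inc a e -> col e = None ->
  exists x y, defect col e a x y (third col e).
Proof.
move=> oc ae ec; have [pc _] := oc.
have [x nx] := unc_miss cub pc ae ec.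
have [y ny] := unc_miss cub pc (inc_oth ends a e) ec.
have xy : x != y.
  by apply: contraNneq ny => <-; apply: (opt_nocommon oc).
have [z t] := tri_ex xy.
have cf : defect col e a x y z by [].
by exists x, y; rewrite (defect_third oc cf).
Qed.

Lemma defect_hole col e a x y z : opt col -> defect col e a x y z -> hole col e = kempe col z a.
Proof.
move=> oc cf; rewrite /hole (defect_third oc cf); have [pc _] := oc.
case: cf => t ae ec nx ny.
move: (ae); rewrite /incident => /orP[]/eqP aE; first by rewrite -aE.
have -> : (ends e).1 = oth a e.
  by rewrite /oth aE; case: eqP => // ee; have := ll e; rewrite -ee eqxx.
by apply: kempe_eq => //; apply: (opt_chain oc t).
Qed.

Definition missK col K c := #|[set v in K | ~~ sees col c v]|.

(** A colour class is half the number of vertices that see it, and inside [K] the vertices seeing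
    [x] after the switch are those that saw [y] before. *)
Lemma size_swap col x y K : pcol col -> closedxy ends col x y K -> x != y ->
  (size_of (swapc col x y K) x).*2 + missK col K y = (size_of col x).*2 + missK col K x.
Proof.
move=> pc cl xy; have pc' := swapc_pcol pc cl.
rewrite -!(card_sees ll) //.
rewrite -(cardsID K [set v | sees (swapc col x y K) x v]) -(cardsID K [set v | sees col x v]).
have -> : [set v | sees (swapc col x y K) x v] :\: K = [set v | sees col x v] :\: K.
  by apply/setP => v; rewrite !inE; case: (boolP (v \in K)) => //= vK; rewrite swapc_seesout.
have -> : [set v | sees (swapc col x y K) x v] :&: K = [set v in K | sees col y v].
  apply/setP => v; rewrite !inE andbC; case: (boolP (v \in K)) => //= vK.
  by rewrite (swapc_seesin _ _ (swapoy x y)).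
have split c : #|[set v in K | sees col c v]| + missK col K c = #|K|.
  rewrite /missK -[RHS](cardsID [set v | sees col c v]); congr (_ + _); apply: eq_card => v;
    by rewrite !inE // andbC.
have -> : [set v | sees col x v] :&: K = [set v in K | sees col x v].
  by apply/setP => v; rewrite !inE andbC.
have := split x; have := split y; lia.
Qed.

Lemma size_swap_other col x y K c : c != x -> c != y ->
  size_of (swapc col x y K) c = size_of col c.
Proof.
move=> cx cy; apply: eq_card => e; rewrite !inE ffunE; case: ifP => // _.
by rewrite (swapo_eq _ (swapo_id cx cy)).
Qed.

Lemma swapo_C x y (o : option 'I_3) : swapo x y o = swapo y x o.
Proof.
rewrite /swapo; case: (o =P Some x) => [->|_] //.
by case: (Some x =P Some y) => [->|].
Qed.

Lemma swapc_C col x y K : swapc col x y K = swapc col y x K.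
Proof. by apply/ffunP => e; rewrite !ffunE swapo_C. Qed.

(* [col1] is obtained from [col] by moving the uncoloured edge inside [K]. *)
Definition shiftR col K z col1 : Prop :=
  [/\ opt col1, forall h, h \notin inside K -> col1 h = col h,
      forall h, (col1 h == Some z) = (col h == Some z) &
      forall c, size_of col1 c = size_of col c].

Lemma shiftR_trans col K z col1 col2 :
  shiftR col K z col1 -> shiftR col1 K z col2 -> shiftR col K z col2.
Proof.
case=> o1 i1 z1 s1 [o2 i2 z2 s2]; split=> // [h hK|h|c].
- by rewrite i2 // i1.
- by rewrite z2 z1.
- by rewrite s2 s1.
Qed.

Definition closedz col K z : Prop := forall v c, v \in K -> c != z -> mate col c v \in K.

Lemma shiftR_closed col K z col1 : pcol col -> closedz col K z -> shiftR col K z col1 ->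
  closedz col1 K z.
Proof.
move=> pc cl [o1 i1 _ _] v c vK cz; case sv: (sees col1 c v); last by rewrite mate_id ?sv.
have [e [ve ec ->]] := mateP sv; apply/negPn/negP => oK.
have eK : e \notin inside K by rewrite (insideP _ ve) vK (negPf oK).
have ec0 : col e = Some c by rewrite -i1.
by have := cl v c vK cz; rewrite (mateE pc ve ec0) (negPf oK).
Qed.

Lemma shiftR_out col K z col1 v c : shiftR col K z col1 -> v \notin K ->
  (sees col1 c v = sees col c v) * (mate col1 c v = mate col c v).
Proof.
case=> _ i1 _ _ vK.
have H e : inc v e -> (col1 e == Some c) = (col e == Some c).
  by move=> ve; rewrite i1 // (insideP _ ve) (negPf vK).
by split; [apply: eq_sees|apply: eq_mate].
Qed.

Lemma shiftR_z col K z col1 v : shiftR col K z col1 ->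
  (sees col1 z v = sees col z v) * (mate col1 z v = mate col z v).
Proof. by case=> _ _ z1 _; split; [apply: eq_sees|apply: eq_mate]. Qed.

(** Colour [y] moves from [g] to [h]: the far end of [h] misses [y], and at [v] the edge [g] gives
    it up. Then [v] still misses [x], and the far end of [g] now misses [y]. *)
Lemma shift_step col h v x y z g K : opt col -> defect col h v x y z -> inc v g ->
  col g = Some y -> h \in inside K -> g \in inside K ->
  exists2 col1, shiftR col K z col1 & defect col1 g v x y z.
Proof.
move=> oc [t vh hc nx ny] vg gy hK gK; have [pc _] := oc.
have [xy xz yz] := tri_neq t.
have gh : g != h by apply: contra_eq_neq hc => <-; rewrite gy.
pose col1 : coloring := [ffun f => if f == h then Some y else if f == g then None else col f].
have c1h : col1 h = Some y by rewrite ffunE eqxx.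
have c1g : col1 g = None by rewrite ffunE (negPf gh) eqxx.
have c1 f : f != h -> f != g -> col1 f = col f by rewrite ffunE => /negPf-> /negPf->.
have noy e w : inc w h -> inc w e -> e != g -> col e <> Some y.
  move=> wh we eg ec; case: (eqVneq w v) => [wv|wv].
    by case/eqP: eg; apply: (pcolP _ _ pc v e g y); rewrite // -wv.
  case/negP: ny; rewrite -(inc_eq vh wh wv); apply/seesP; by exists e.
have p1 : pcol col1.
  apply/pcolP => w e f c we wf; rewrite !ffunE.
  case: (e =P h) => [eh|/eqP eh]; case: (f =P h) => [fh|/eqP fh]; rewrite ?eh ?fh //.
  - case: (f =P g) => // /eqP fg [<-] /noy; case/(_ w) => //; by rewrite -eh.
  - by case: (e =P g) => // /eqP eg + [yc]; rewrite -yc => /noy; case/(_ w) => //; rewrite -fh.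
  - case: (e =P g) => // _; case: (f =P g) => // _; exact: (pcolP _ _ pc w e f c).
have u1 : unc col1 = unc col.
  rewrite /unc (cardsD1 g) [RHS](cardsD1 h) !inE c1g hc !eqxx; congr (_ + _).
  apply: eq_card => f; rewrite !inE ffunE.
  case: (eqVneq f h) => [->|fh]; first by rewrite andbF.
  by case: (eqVneq f g) => [->|fg] //; rewrite gy.
have o1 : opt col1 by apply: (opt_unc oc); rewrite ?u1.
exists col1.
  split=> // [f fK|f|c].
  - by rewrite c1 //; apply: contraNneq fK => ->.
  - rewrite ffunE; case: (eqVneq f h) => [->|fh].
      by rewrite hc (inj_eq (@Some_inj _)) (negPf yz).
    case: (eqVneq f g) => [->|//].
    by rewrite gy (inj_eq (@Some_inj _)) (negPf yz).
  case: (eqVneq c y) => [->|cy].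
    rewrite /size_of (cardsD1 h) [RHS](cardsD1 g) !inE c1h gy !eqxx; congr (_ + _).
    apply: eq_card => f; rewrite !inE ffunE.
    case: (eqVneq f h) => [->|fh]; first by rewrite hc andbF.
    by case: (eqVneq f g) => [->|fg].
  apply: eq_card => f; rewrite !inE ffunE.
  case: (eqVneq f h) => [->|fh].
    by rewrite hc (inj_eq (@Some_inj _)) (eq_sym y) (negPf cy).
  case: (eqVneq f g) => [->|//].
  by rewrite gy (inj_eq (@Some_inj _)) (eq_sym y) (negPf cy).
split=> //.
  apply/negP => /seesP[e ve]; rewrite ffunE.
  case: (e =P h) => [_ [yx]|_]; first by rewrite yx eqxx in xy.
  by case: (e =P g) => // _ ec; case/negP: nx; apply/seesP; exists e.
apply/negP => /seesP[e we]; rewrite ffunE.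
case: (e =P h) => [eh _|/eqP eh].
  rewrite eh in we; have := inc_eq vh we (oth_neq ll v g) => wE.
  by case/negP: ny; rewrite -wE; apply/seesP; exists g; rewrite ?inc_oth.
case: (e =P g) => // /eqP eg ec; case/eqP: eg.
by apply: (pcolP _ _ pc (oth v g) e g y); rewrite ?inc_oth.
Qed.

(** The chain through both ends of [h] is switched as a whole. Exactly one of its vertices misses
    [x] and exactly one misses [y], a further one being a third end, so all class sizes are kept. *)
Lemma shift_swap col h v x y z K : opt col -> defect col h v x y z -> closedz col K z -> v \in K ->
  exists2 col1, shiftR col K z col1 & defect col1 h v y x z.
Proof.
move=> oc [t vh hc nx ny] clK vK; have [pc _] := oc.
have [xy xz yz] := tri_neq t.
pose K1 := kempe col z v; have cl : closedxy ends col x y K1 by apply: kempe_closedxy.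
have K1K : K1 \subset K by apply: kempe_min => // w c wK cz; apply: clK.
have o1 := opt_swapc oc cl.
have vK1 : v \in K1 := kempe_refl _ _ _ _.
have v'K1 : oth v h \in K1 by apply: (opt_chain oc t).
have one c w : w \in K1 -> ~~ sees col c w -> c != z -> missK col K1 c = 1.
  move=> wK nc cz; apply: etrans (cards1 w); apply: eq_card => u; rewrite in_set in_set1.
  apply/idP/eqP => [/andP[uK nu]|->]; last by rewrite wK nc.
  apply/eqP/negPn/negP => uw.
  have ze q : ~~ sees col c q -> zend ends col x y q.
    by move=> nq; rewrite /zend; case: (triP c t) nq cz => -> nq'; rewrite ?nq' ?eqxx ?orbT.
  have : exists q, [/\ q \in K1, zend ends col x y q & sees col c q].
    case: (triP c t) cz => cE; rewrite cE ?eqxx // => _.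
      exists (oth v h); split=> //; first by rewrite /zend ny orbT.
      exact: (sees_other oc ny).
    exists v; split=> //; first by rewrite /zend nx.
    by apply: (sees_other oc nx); rewrite eq_sym.
  case=> q [qK qe qc].
  have := @ends_uniq _ _ ends ll col x y z q u w pc t qe.
  rewrite (kempe_eq pc qK) => /(_ uK wK (ze _ nu) (ze _ nc)) H.
  have uq : u != q by apply: contraNneq nu => ->.
  have wq : w != q by apply: contraNneq nc => ->.
  by rewrite (H uq wq) eqxx in uw.
have sz c : size_of (swapc col x y K1) c = size_of col c.
  have mx := one x v vK1 nx xz; have my := one y _ v'K1 ny yz.
  have yx : y != x by rewrite eq_sym.
  case: (triP c t) => ->.
  - by have /eqP := size_swap pc cl xy; rewrite mx my eqn_add2r => /eqP/double_inj.
  - rewrite swapc_C; have cl' : closedxy ends col y x K1 by move=> w /cl[].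
    by have /eqP := size_swap pc cl' yx; rewrite mx my eqn_add2r => /eqP/double_inj.
  by rewrite size_swap_other // eq_sym.
exists (swapc col x y K1).
  split=> // [f fK|f].
    rewrite ffunE; case: ifP => // tf.
    have [q [fq qK1]] : exists q, inc q f /\ q \in K1.
      case/orP: tf => q; [exists (ends f).1|exists (ends f).2]; split=> //; [exact: inc1|exact: inc2].
    rewrite /swapo; case: eqP => [fx|_].
      by case/negP: fK; rewrite (insideP _ fq) !(subsetP K1K) // -(mateE pc fq fx); case: (cl _ qK1).
    case: eqP => [fy|_] //.
    by case/negP: fK; rewrite (insideP _ fq) !(subsetP K1K) // -(mateE pc fq fy); case: (cl _ qK1).
  rewrite ffunE; case: ifP => // _.
  by rewrite (swapo_eq _ (swapo_id _ _)) // eq_sym.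
split; first exact: triC.
- by [].
- by apply/eqP; rewrite swapc_None hc.
- by rewrite (swapc_seesin _ _ (swapox x y)).
- by rewrite (swapc_seesin _ _ (swapoy x y)).
Qed.

(** Steps and switches alternate and carry the uncoloured edge around the cycle one vertex at a
    time; both the new edge and the end that misses [x] can be prescribed. *)
Lemma shift col e a x y z v h0 : opt col -> defect col e a x y z ->
  let K := kempe col z a in
  h0 \in inside K -> col h0 != Some z -> inc v h0 ->
  exists2 col1, shiftR col K z col1 & defect col1 h0 v x y z.
Proof.
move=> oc cf K h0K h0z vh0; have [pc _] := oc; have [t ae ec nx ny] := cf.
have [xy xz yz] := tri_neq t.
have clK : closedz col K z by move=> w c wK cz; apply: kempe_mate.
(* Where [w] misses [x], any other cycle edge at [w] must have colour [y], which is what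
   [shift_step] asks for. A switch then lets the far end of that edge miss [x], so the property
   passes to the next vertex. *)
pose reach w := exists col1 h, [/\ shiftR col K z col1, defect col1 h w x y z & h \in inside K].
have use w g : reach w -> g \in inside K -> col g != Some z -> inc w g ->
  exists2 col1, shiftR col K z col1 & defect col1 g w x y z.
  case=> col1 [h [R cf1 hK]] gK gz wg.
  case: (eqVneq g h) => [->|gh]; first by exists col1.
  have [o1 _ z1 _] := R; have [p1 _] := o1; have [_ wh hc nx1 ny1] := cf1.
  have gz1 : col1 g != Some z by rewrite z1.
  have gy : col1 g = Some y.
    case gc: (col1 g) gz1 => [c|].
      case: (triP c t) gc => -> // gc; last by rewrite eqxx.
      by case/negP: nx1; apply/seesP; exists g.
    by case/eqP: gh; apply: (opt_unc_uniq ll cub o1 wg wh).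
  have [col2 R2 cf2] := shift_step o1 cf1 wg gy hK gK.
  by exists col2 => //; apply: shiftR_trans R R2.
have next w g : reach w -> g \in inside K -> col g != Some z -> inc w g -> reach (oth w g).
  move=> rw gK gz wg; have [col1 R cf1] := use w g rw gK gz wg.
  have [o1 _ _ _] := R.
  have wK : w \in K by move: gK; rewrite (insideP _ wg) => /andP[].
  have [col2 R2 cf2] := shift_swap o1 cf1 (shiftR_closed pc clK R) wK.
  exists col2, g; split=> //; first exact: shiftR_trans R R2.
  exact: defect_sym.
suff all w : w \in K -> reach w.
  by apply: use => //; apply: all; move: h0K; rewrite (insideP _ vh0) => /andP[].
have ra : reach a.
  exists col, e; split=> //; rewrite (insideP _ ae) kempe_refl; exact: (opt_chain oc t).
have aK : a \in K by apply: kempe_refl.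
rewrite inE => /connectP[p pp ->].
suff walk q b : b \in K -> reach b -> path (adjz ends col z) b q -> reach (last b q).
  exact: walk aK ra pp.
elim: q b => [|w' q IH] b //= bK rb /andP[/existsP[c /andP[cz /eqP wE]]].
apply: IH; rewrite wE; first exact: clK.
case sb: (sees col c b); last by rewrite mate_id ?sb.
have [g [bg gc mE]] := mateP sb; rewrite mE; apply: next => //.
  by rewrite (insideP _ bg) bK -mE clK.
by rewrite gc (inj_eq (@Some_inj _)).
Qed.

End Shift.

(** * Odd cycles of uncoloured edges are disjoint *)

Section Holes.
Variables (V E : finType) (ends : E -> V * V).
Local Notation inc := (incident ends).
Hypotheses (ll : loopless ends) (cub : cubic ends).
Local Notation coloring := {ffun E -> option 'I_3}.
Implicit Types (col : coloring) (c x y z p q r : 'I_3) (K A : {set V}) (u v w a b s : V) (e f g h : E).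
Local Notation oth := (oth ends).
Local Notation sees := (sees ends).
Local Notation mate := (mate ends).
Local Notation pcol := (pcol ends).
Local Notation opt := (opt ends).
Local Notation kempe := (kempe ends).
Local Notation inside := (inside ends).
Local Notation defect := (defect ends).
Local Notation hole := (hole ends).
Local Notation third := (third ends).
Local Notation closedz := (closedz ends).
Local Notation shiftR := (shiftR ends).

Lemma kempe_ind col z u (P : V -> Prop) : P u ->
  (forall v c, P v -> c != z -> P (mate col c v)) -> forall v, v \in kempe col z u -> P v.
Proof.
move=> Pu clP v; rewrite inE => /connectP[l pl ->].
elim: l u Pu pl => [|w l IH] u Pu //= /andP[/existsP[c /andP[cz /eqP->]] pl].
by apply: IH pl; apply: clP.
Qed.

Lemma sees_mate col c v K : pcol col -> mate col c v \in K -> sees col c v ->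
  exists g, [/\ inc v g, col g = Some c & oth v g \in K].
Proof. by move=> pc + /mateP[g [vg gc mE]]; rewrite mE => gK; exists g. Qed.

Section Cfg.
Variables (col : coloring) (e : E) (a : V) (x y z : 'I_3).
Hypotheses (oc : opt col) (cf : defect col e a x y z).
Let K := kempe col z a.
Let pc : pcol col. Proof. by case: oc. Qed.

Lemma defect_inside : (a \in K) * (oth a e \in K) * (e \in inside K).
Proof.
case: cf => t ae ec nx ny.
have h1 : a \in K by apply: kempe_refl.
have h2 : oth a e \in K by apply: (opt_chain oc t).
by rewrite (insideP _ ae) h1 h2.
Qed.

Lemma defect_end v : v \in K -> zend ends col x y v -> v = a \/ v = oth a e.
Proof.
move=> vK ve; case: (eqVneq v a) => [->|va]; first by left.
case: cf => t ae ec nx ny; right.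
apply: (@ends_uniq _ _ _ ll col x y z a) => //; rewrite ?oth_neq //.
- by rewrite /zend nx.
- by rewrite defect_inside.
- by rewrite /zend ny orbT.
Qed.

(** A vertex of [K] missing [x] or [y] is an end of [e], and no vertex has two uncoloured edges. If
    [w] misses [z] instead, then either [f] lies inside [K] and its other end misses [x] or [y], or
    the uncoloured edge of [K] can be moved next to [w] while [f] stays uncoloured. *)
Lemma unc_out f w : f != e -> col f = None -> inc w f -> w \notin K.
Proof.
move=> fe fc wf; apply/negP => wK; have [t ae ec nx ny] := cf.
have noend u : inc u f -> u \in K -> zend ends col x y u -> False.
  move=> uf uK ue; have ue' : inc u e.
    by case: (defect_end uK ue) => ->; rewrite ?inc_oth.
  by case/eqP: fe; apply: (opt_unc_uniq ll cub oc uf ue').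
have [c nc] := unc_miss cub pc wf fc.
case: (triP c t) nc => -> nc.
- by apply: (noend w) => //; rewrite /zend nc.
- by apply: (noend w) => //; rewrite /zend nc orbT.
have [xy xz yz] := tri_neq t.
have sx : sees col x w by apply: (sees_other ll cub oc nc).
have [g [wg gx gK]] := sees_mate pc (kempe_mate xz wK) sx.
have gi : g \in inside K by rewrite (insideP _ wg) wK.
have gz : col g != Some z by rewrite gx (inj_eq (@Some_inj _)).
case: (boolP (f \in inside K)) => fi.
  have w'K : oth w f \in K by move: fi; rewrite (insideP _ wf) => /andP[].
  apply: (noend (oth w f)) => //; rewrite ?inc_oth //.
  have [c' nc'] := unc_miss cub pc (inc_oth ends w f) fc.
  have := opt_nocommon oc wf fc nc; rewrite /zend.
  by case: (triP c' t) nc' => -> n'; rewrite ?n' ?(negPf n') ?orbT.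
have [col1 [o1 i1 _ _] [_ _ gc _ _]] := shift ll cub oc cf gi gz wg.
have fg : f = g by apply: (opt_unc_uniq ll cub o1 wf wg _ gc); rewrite i1.
by rewrite fg gi in fi.
Qed.

Lemma defect_sees v : v \in K -> sees col z v.
Proof.
move=> vK; have [t ae ec nx ny] := cf; have [xy xz yz] := tri_neq t.
case: (boolP (sees col z v)) => // nz.
have [f [vf fc]] := miss_exunc cub pc nz.
case: (eqVneq f e) => [fe|fe]; last by case/negP: (unc_out fe fc vf).
case/negP: nz; rewrite fe in vf; case: (eqVneq v a) => [va|va].
  by rewrite va; apply: (sees_other ll cub oc nx); rewrite eq_sym.
rewrite (inc_eq ae vf va).
by apply: (sees_other ll cub oc ny); rewrite eq_sym.
Qed.

Lemma defect_leave v g : v \in K -> inc v g -> oth v g \notin K -> col g = Some z.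
Proof.
move=> vK vg oK; case gc: (col g) => [c|].
  congr Some; apply/eqP/negPn/negP => cz.
  by have := kempe_mate cz vK; rewrite (mateE pc vg gc) (negPf oK).
case: (eqVneq g e) => [ge|ge]; last by case/negP: (unc_out ge gc vg).
have := defect_inside; rewrite -ge => -[_].
by rewrite (insideP _ vg) (negPf oK) andbF.
Qed.

Lemma defect_cedge v : v \in K -> exists h, [/\ h \in inside K, inc v h & col h != Some z].
Proof.
move=> vK; have [t ae ec nx ny] := cf; have [xy xz yz] := tri_neq t.
case: (boolP (sees col x v)) => sx.
  have [g [vg gx gK]] := sees_mate pc (kempe_mate xz vK) sx.
  by exists g; rewrite (insideP _ vg) vK gK gx (inj_eq (@Some_inj _)).
have [f [vf fc]] := miss_exunc cub pc sx.
case: (eqVneq f e) => [fe|fe]; last by case/negP: (unc_out fe fc vf).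
by exists f; rewrite fc fe defect_inside -fe.
Qed.

Lemma defect_odd : odd #|K|.
Proof.
have [t ae ec nx ny] := cf; have [xy xz yz] := tri_neq t.
apply: (@ends_odd _ _ ends ll col x y z a (oth a e)) => //; rewrite ?defect_inside ?oth_neq //.
exact: (sees_other ll cub oc ny).
Qed.

End Cfg.

Lemma shiftR_defect col K z col1 f s p q r : opt col -> shiftR col K z col1 ->
  defect col f s p q r -> s \notin K -> oth s f \notin K -> defect col1 f s p q r.
Proof.
move=> oc R [t sf fc np nq] sK s'K; split=> //.
- by case: R => _ i1 _ _; rewrite i1 // (insideP _ sf) (negPf sK).
- by rewrite (shiftR_out _ R sK).
- by rewrite (shiftR_out _ R s'K).
Qed.

(** Where the chain of [f] would first enter [K], at [w], the edge [e] is moved so that [w] misses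
    [x]. Since [x] is a chain colour of [f], [w] becomes an end of that chain and hence an end of
    [f], but both ends of [f] lie outside [K]. *)
Lemma defect_disj1 col e a x y z f s p q : opt col -> defect col e a x y z -> defect col f s p q y ->
  f != e -> forall v, v \in kempe col y s -> v \notin kempe col z a.
Proof.
move=> oc cf cg fe v vs; set K := kempe col z a; have [pc _] := oc.
have [t ae ec nx ny] := cf; have [xy xz yz] := tri_neq t.
have [t' sf fc np nq] := cg; have [pq py qy] := tri_neq t'.
have sK : s \notin K by apply: (unc_out oc cf fe fc).
have s'K : oth s f \notin K by apply: (unc_out oc cf fe fc); rewrite inc_oth.
(* The part of the chain walked so far has to survive every move inside [K], as the move used
   depends on where the chain enters. *)
suff : v \notin K /\ forall col1, shiftR col K z col1 -> v \in kempe col1 y s by case.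
elim/kempe_ind: v / vs; first by split=> // col1 _; apply: kempe_refl.
move=> v c [vK H] cy.
have H' col1 : shiftR col K z col1 -> mate col c v \in kempe col1 y s.
  by move=> R; rewrite -(shiftR_out _ R vK); apply: kempe_mate => //; apply: H.
split=> //; apply/negP => wK.
set w := mate col c v in wK H'.
have [h0 [h0K wh h0z]] := defect_cedge oc cf wK.
have [col1 R [_ _ _ nxw _]] := shift ll cub oc cf h0K h0z wh.
have cg1 := shiftR_defect oc R cg sK s'K.
have [o1 _ _ _] := R.
have : w = s \/ w = oth s f.
  apply: (defect_end o1 cg1); first exact: H'.
  rewrite /zend; case: (triP x t') nxw xy => -> n'; rewrite ?n' ?orbT ?eqxx //.
by case=> wE; [case/negP: sK|case/negP: s'K]; rewrite -wE.
Qed.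

(** If the third colours agree, both vertex sets are components for the same two colours, so they
    are equal or disjoint, and [unc_out] excludes equality. *)
Lemma defect_disj col e a x y z f s p q r : opt col -> defect col e a x y z -> defect col f s p q r ->
  f != e -> forall v, v \in kempe col r s -> v \notin kempe col z a.
Proof.
move=> oc cf cg fe v vs; have [pc _] := oc; have [t ae _ _ _] := cf.
case: (triP r t) cg vs => ->.
- move=> cg vs; have cf' := defect_sym cf.
  have -> : kempe col z a = kempe col z (oth a e).
    by apply/esym/kempe_eq => //; rewrite (defect_inside oc cf).
  exact: (defect_disj1 oc cf' cg fe vs).
- by move=> cg; apply: (defect_disj1 oc cf cg fe).
case=> _ sf fc _ _ vs; apply/negP => va.
have sa : s \in kempe col z a.
  by rewrite -(kempe_eq pc va); apply: kempe_sym.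
by case/negP: (unc_out oc cf fe fc sf).
Qed.

Section Hole.
Variables (col : coloring) (oc : opt col).
Let pc : pcol col. Proof. by case: oc. Qed.

Lemma hole_defect e : col e = None -> exists a x y,
  [/\ defect col e a x y (third col e), hole col e = kempe col (third col e) a & a = (ends e).1].
Proof.
move=> ec; have [x [y cf]] := cfgP ll cub oc (inc1 ends e) ec.
by exists (ends e).1, x, y; rewrite (defect_hole ll cub oc cf).
Qed.

Lemma hole_disj e f v : col e = None -> col f = None -> e != f ->
  v \in hole col e -> v \notin hole col f.
Proof.
move=> ec fc ef; have [a [x [y [cf -> _]]]] := hole_defect ec.
have [b [x' [y' [cg -> _]]]] := hole_defect fc.
exact: (defect_disj oc cg cf).
Qed.

Lemma hole_inside e v : col e = None -> inc v e -> v \in hole col e.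
Proof.
move=> ec ve; have [a [x [y [cf -> _]]]] := hole_defect ec.
have [_ ae _ _ _] := cf.
case: (eqVneq v a) => [->|va]; first exact: kempe_refl.
by rewrite (inc_eq ae ve va) (defect_inside oc cf).
Qed.

Lemma hole_unc e f v : col e = None -> v \in hole col e -> inc v f -> col f = None -> f = e.
Proof.
move=> ec vK vf fc; apply/eqP/negPn/negP => fe.
have := hole_inside fc vf; apply/negP; apply: hole_disj vK => //; by rewrite eq_sym.
Qed.

Lemma hole_leave e v g : col e = None -> v \in hole col e -> inc v g -> oth v g \notin hole col e ->
  col g = Some (third col e).
Proof. by move=> ec; have [a [x [y [cf -> _]]]] := hole_defect ec; apply: (defect_leave oc cf). Qed.

Lemma hole_sees e v : col e = None -> v \in hole col e -> sees col (third col e) v.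
Proof. by move=> ec; have [a [x [y [cf -> _]]]] := hole_defect ec; apply: (defect_sees oc cf). Qed.

Lemma hole_closed e : closedz col (hole col e) (third col e).
Proof. by move=> v c vK cz; apply: kempe_mate. Qed.

Lemma hole_odd e : col e = None -> odd #|hole col e|.
Proof. by move=> ec; have [a [x [y [cf -> _]]]] := hole_defect ec; apply: (defect_odd oc cf). Qed.

Lemma hole_mateout e v c : col e = None -> v \notin hole col e -> c != third col e ->
  mate col c v \notin hole col e.
Proof.
move=> ec vK cz; apply: contra vK => mK.
by rewrite -(mateK c pc v); apply: hole_closed.
Qed.

Lemma hole_shift e h v x y : col e = None -> tri x y (third col e) ->
  h \in inside (hole col e) -> col h != Some (third col e) -> inc v h ->
  exists2 col1, shiftR col (hole col e) (third col e) col1 & defect col1 h v x y (third col e).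
Proof.
move=> ec t; have [a [x' [y' [cf -> _]]]] := hole_defect ec.
have [t' ae _ _ _] := cf.
have KE : kempe col (third col e) a = kempe col (third col e) (oth a e).
  by apply/esym/kempe_eq => //; rewrite (defect_inside oc cf).
case: (triP x t') t => ->; case: (triP y t') => -> t hK hz vh;
  try by case: (tri_neq t); rewrite ?eqxx.
- exact: (shift ll cub oc cf).
- by rewrite KE in hK *; apply: (shift ll cub oc (defect_sym cf)).
Qed.

Lemma hole_cedge e v : col e = None -> v \in hole col e ->
  exists h, [/\ h \in inside (hole col e), inc v h & col h != Some (third col e)].
Proof. by move=> ec; have [a [x [y [cf -> _]]]] := hole_defect ec; apply: (defect_cedge oc cf). Qed.

End Hole.
End Holes.

(** * Exchanging two odd cycles *)

Section Exchange.
Variables (V E : finType) (ends : E -> V * V).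
Local Notation inc := (incident ends).
Hypotheses (ll : loopless ends) (cub : cubic ends).
Local Notation coloring := {ffun E -> option 'I_3}.
Implicit Types (col : coloring) (c x y z p q r : 'I_3) (K A : {set V}) (u v w a b s : V) (e f g h : E).
Local Notation oth := (oth ends).
Local Notation sees := (sees ends).
Local Notation mate := (mate ends).
Local Notation pcol := (pcol ends).
Local Notation opt := (opt ends).
Local Notation kempe := (kempe ends).
Local Notation inside := (inside ends).
Local Notation defect := (defect ends).
Local Notation hole := (hole ends).
Local Notation third := (third ends).
Local Notation shiftR := (shiftR ends).

Lemma kempe_ext col col' z u :
  (forall v c, v \in kempe col z u -> mate col' c v = mate col c v) -> kempe col' z u = kempe col z u.
Proof.
move=> H; apply/eqP; rewrite eqEsubset; apply/andP; split.
  by apply: kempe_min => [|v c vK cz]; rewrite ?kempe_refl // H // kempe_mate.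
apply/subsetP => v vK; suff : v \in kempe col z u /\ v \in kempe col' z u by case.
elim/kempe_ind: v / vK => [|v c [v1 v2] cz]; first by rewrite !kempe_refl.
by rewrite kempe_mate // -H // kempe_mate.
Qed.

(** Carries a hole that a recolouring does not touch over to the new colouring. *)
Lemma hole_agree col col' g : opt col -> opt col' -> col g = None -> col' g = None ->
  (forall v c, v \in hole col g -> sees col' c v = sees col c v) ->
  (forall v c, v \in hole col g -> mate col' c v = mate col c v) ->
  third col' g = third col g /\ hole col' g = hole col g.
Proof.
move=> oc oc' gc gc' Hs Hm.
have [a [x [y [cf hE aE]]]] := hole_defect ll cub oc gc.
have aK : a \in hole col g by apply: (hole_inside ll cub oc); rewrite // aE inc1.
have bK : oth a g \in hole col g by apply: (hole_inside ll cub oc); rewrite // inc_oth.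
have cf' : defect col' g a x y (third col g).
  by case: cf => t ag _ nx ny; split; rewrite ?Hs.
split; first exact: (defect_third ll cub oc' cf').
rewrite (defect_hole ll cub oc' cf') hE; apply: kempe_ext => v c; rewrite -hE; exact: Hm.
Qed.

Lemma mate_edge col c v w : pcol col -> mate col c v = w -> w != v ->
  exists g, [/\ inc v g, inc w g, col g = Some c, oth v g = w & oth w g = v].
Proof.
move=> pc mv wv; have sv : sees col c v.
  by move: wv; rewrite -mv; apply: contraR => /mate_id->.
have [g [vg gc mE]] := mateP sv; exists g.
have wE : oth v g = w by rewrite -mE.
by split; rewrite -?wE ?inc_oth ?othK.
Qed.

(* [v - w - u] becomes a two-edge Kempe chain of colours [z], [c] once [e] and [f]
   are moved next to [v] and [u]; swapping it exchanges the third colours of [e], [f]. *)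
Lemma exchange col e f z c c' v h w u : opt col -> col e = None -> col f = None -> e != f ->
  third col e = z -> third col f = c -> tri c c' z ->
  h \in inside (hole col e) -> col h != Some z -> inc v h ->
  mate col z v = w -> w \notin hole col e ->
  mate col c w = u -> u \in hole col f -> w \notin hole col f ->
  exists col', [/\ opt col', defect col' h v z c' c,
    forall s p, s \notin hole col e -> s \notin hole col f -> s != w ->
      sees col' p s = sees col p s /\ mate col' p s = mate col p s,
    forall s, s \in hole col e -> s != v -> mate col' z s = mate col z s &
    forall g, col g = None -> g != e -> g != f ->
      col' g = None /\ hole col' g = hole col g].
Proof.
move=> oc ec fc ef te tf t hK hz vh vw wK wu uKf wKf.
have [pc _] := oc; have [cc' cz c'z] := tri_neq t.
have t3 : tri c c' (third col e) by rewrite te.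
have [vK v'K] : v \in hole col e /\ oth v h \in hole col e.
  by move: hK; rewrite (insideP _ vh) => /andP[].
have dis s : s \in hole col e -> s \notin hole col f by apply: (hole_disj ll cub oc).
have dis' s : s \in hole col f -> s \notin hole col e by apply: contraL; apply: dis.
have hz' : col h != Some (third col e) by rewrite te.
have [col1 R1 cf1] := hole_shift ll cub oc ec t3 hK hz' vh.
rewrite te in cf1 R1; have [o1 i1 _ _] := R1; have [p1 _] := o1.
have fnK : f \notin inside (hole col e).
  apply: contra ef; rewrite (insideP _ (inc1 ends f)) => /andP[fK _].
  by rewrite eq_sym; apply/eqP; apply: (hole_unc ll cub oc ec fK (inc1 _ _)).
have f1c : col1 f = None by rewrite i1.
have [tf1 hf1] : third col1 f = third col f /\ hole col1 f = hole col f.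
  apply: hole_agree => // s p sK; by rewrite (shiftR_out _ R1 (dis' _ sK)).
rewrite tf in tf1.
have uKf1 : u \in hole col1 f by rewrite hf1.
have [h2 [h2K uh2 h2c]] := hole_cedge ll cub o1 f1c uKf1.
have t2 : tri z c' (third col1 f) by rewrite tf1; apply: triC; apply: triR.
have [col2 R2 cf2] := hole_shift ll cub o1 f1c t2 h2K h2c uh2.
rewrite tf1 hf1 in cf2 R2; have [o2 i2 _ _] := R2; have [p2 _] := o2.
have vKf := dis _ vK.
have wv : w != v by apply: contraNneq wK => ->.
have uw : u != w by apply: contraNneq wKf => <-.
have uv : u != v by apply: contraNneq vKf => <-.
have nv2 : ~~ sees col2 c v by rewrite (shiftR_out _ R2 vKf); case: cf1.
have nu2 : ~~ sees col2 z u by case: cf2.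
have m2vz : mate col2 z v = w by rewrite (shiftR_out _ R2 vKf) (shiftR_z _ R1).
have m2wc : mate col2 c w = u by rewrite (shiftR_z _ R2) (shiftR_out _ R1 wK).
have m2wz : mate col2 z w = v by rewrite -m2vz (mateK _ p2).
have m2uc : mate col2 c u = w by rewrite -m2wc (mateK _ p2).
pose K0 := [set v; w; u].
have cl0 : closedxy ends col2 c z K0.
  move=> s; rewrite !inE => /orP[/orP[]|] /eqP->.
  - by rewrite (mate_id nv2) m2vz !eqxx ?orbT.
  - by rewrite m2wc m2wz !eqxx ?orbT.
  - by rewrite m2uc (mate_id nu2) !eqxx ?orbT.
have o3 := opt_swapc o2 cl0.
have out s p : s \notin hole col e -> s \notin hole col f -> s != w ->
    sees (swapc ends col2 c z K0) p s = sees col p s /\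
    mate (swapc ends col2 c z K0) p s = mate col p s.
  move=> sK sKf sw; have s0 : s \notin K0.
    rewrite !inE (negPf sw) orbF negb_or; apply/andP; split.
      by apply: contraNneq sK => ->.
    by apply: contraNneq sKf => ->.
  rewrite swapc_seesout // swapc_mateout //.
  by rewrite !(shiftR_out _ R2 sKf) !(shiftR_out _ R1 sK).
exists (swapc ends col2 c z K0); split=> //.
- have [_ _ hc1 nx1 ny1] := cf1; split=> //.
  + by apply: triC; apply: triR.
  + apply/eqP; rewrite swapc_None i2 ?hc1 //.
    by rewrite (insideP _ vh) (negPf vKf).
  + by rewrite (swapc_seesin _ _ (swapox c z)) // !inE eqxx.
  + rewrite swapc_seesout //.
      by rewrite (shiftR_out _ R2) ?dis.
    rewrite !inE (negPf (oth_neq ll v h)) /= negb_or; apply/andP; split.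
      by apply: contraNneq wK => <-.
    by apply: contraNneq (dis _ v'K) => ->.
- move=> s sK sv; have s0 : s \notin K0.
    rewrite !inE (negPf sv) /= negb_or; apply/andP; split.
      by apply: contraNneq wK => <-.
    by apply: contraNneq (dis _ sK) => ->.
  by rewrite swapc_mateout // (shiftR_out _ R2) ?dis // (shiftR_z _ R1).
move=> g gc ge gf.
have gs s : s \in hole col g -> [/\ s \notin hole col e, s \notin hole col f & s != w].
  move=> sg; split; [exact: (hole_disj ll cub oc gc ec ge)|exact: (hole_disj ll cub oc gc fc gf)|].
  (* If [w] were on the hole of [g], the edge to [v] would leave that hole and force its third
     colour to be [z]; the hole would then be closed under colour [c] and contain [u], which lies on
     the hole of [f]. *)
  apply: contraTneq sg => ->; apply/negP => wg.
  have vng : v \notin hole col g by apply: (hole_disj ll cub oc ec); rewrite // eq_sym.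
  have vm : mate col z w = v by rewrite -vw (mateK _ pc).
  have vw' : v != w by rewrite eq_sym.
  have [k [wk vk kc kE _]] := mate_edge pc vm vw'.
  have gz : third col g = z.
    by apply/esym/Some_inj; rewrite -kc; apply: (hole_leave ll cub oc gc wg wk); rewrite kE.
  have := @hole_closed _ _ ends col g w c wg; rewrite gz wu => /(_ cz).
  by apply/negP; apply: (hole_disj ll cub oc fc); rewrite // eq_sym.
have g3 : swapc ends col2 c z K0 g = None.
  have [i1g _ _] := gs _ (hole_inside ll cub oc gc (inc1 ends g)).
  have [_ i2g _] := gs _ (hole_inside ll cub oc gc (inc1 ends g)).
  apply/eqP; rewrite swapc_None i2 ?i1 ?gc // (insideP _ (inc1 ends g)) ?(negPf i1g) //.
  by rewrite (negPf i2g).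
split=> //; have [||_ //] := hole_agree oc o3 gc g3.
  by move=> s p /gs[sK sKf sw]; case: (out s p sK sKf sw).
by move=> s p /gs[sK sKf sw]; case: (out s p sK sKf sw).
Qed.

(* The chains of colour [c] are cut where they enter [K]. *)
Definition cutmate col c K (u : V) : V :=
  if (u \in K) || (mate col c u \in K) then u else mate col c u.

Lemma cutmateK col c K : pcol col -> involutive (cutmate col c K).
Proof.
move=> pc u; rewrite {2}/cutmate; case: (boolP (_ || _)) => uK; rewrite /cutmate.
  by rewrite uK.
by rewrite mateK // orbC (negPf uK).
Qed.

(** * What an exchange at [v] implies for the exit of the next cycle vertex *)

Section Consequences.
Variables (col : coloring) (e f : E) (z c c' : 'I_3) (v w u w' : V) (h : E).
Hypotheses (oc : opt col) (ec : col e = None) (fc : col f = None) (ef : e != f).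
Hypotheses (te : third col e = z) (tf : third col f = c) (t : tri c c' z).
Hypotheses (hK : h \in inside (hole col e)) (hz : col h != Some z) (vh : inc v h).
Hypotheses (vw : mate col z v = w) (wK : w \notin hole col e).
Hypotheses (wu : mate col c w = u) (uKf : u \in hole col f) (wKf : w \notin hole col f).
Hypotheses (vw' : mate col z (oth v h) = w') (w'K : w' \notin hole col e).
Let pc : pcol col. Proof. by case: oc. Qed.

Let w'Kf : w' \notin hole col f.
Proof.
have [cc' cz c'z] := tri_neq t.
have [vK v'K] : v \in hole col e /\ oth v h \in hole col e.
  by move: hK; rewrite (insideP _ vh) => /andP[].
apply: contraL v'K => w'f; rewrite -(mateK z pc (oth v h)) vw'.
apply: (hole_disj ll cub oc fc); rewrite 1?eq_sym //.
by apply: hole_closed => //; rewrite tf eq_sym.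
Qed.

Let w'w : w' != w.
Proof.
by apply: contraNneq (oth_neq ll v h); rewrite -vw -vw' => /(inv_inj (mateK z pc))->.
Qed.

(** After the exchange the cycle of [h] has third colour [c], so it runs through [w'] and on along
    colour [c']. Such an edge into the hole of [g] would make two holes of an optimal colouring
    meet. *)
Lemma shared_kind g : col g = None -> third col g = c' -> mate col c' w' \notin hole col g.
Proof.
move=> gc tg; apply/negP => w'g.
have [col' [o' cf' out inn oth_h]] := exchange oc ec fc ef te tf t hK hz vh vw wK wu uKf wKf.
have [cc' cz c'z] := tri_neq t.
have [vK v'K] : v \in hole col e /\ oth v h \in hole col e.
  by move: hK; rewrite (insideP _ vh) => /andP[].
have ge : g != e by apply: contraNneq c'z => ge; rewrite -te -tg ge.
have gf : g != f by apply: contraNneq cc' => gf; rewrite -tf -tg gf.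
have [g' hg] := oth_h g gc ge gf.
have [_ _ h' _ _] := cf'.
have w'h : w' \in hole col' h.
  rewrite (defect_hole ll cub o' cf') -vw' -inn // ?(oth_neq ll) //.
  by apply: kempe_mate; rewrite 1?eq_sym // (defect_inside o' cf').
have th' := defect_third ll cub o' cf'.
have : mate col' c' w' \in hole col' h by apply: hole_closed; rewrite // th' eq_sym.
have [_ ->] := out w' c' w'K w'Kf w'w.
apply/negP; apply: (hole_disj ll cub o' g' h'); last by rewrite hg.
apply: contraNneq ge => gh; apply/eqP/(hole_unc ll cub oc ec vK) => //.
by rewrite gh.
Qed.

(** After the exchange the chain of colours [z], [c'] from [v] runs through [oth v h] and [w'], and
    its only ends are [v] and [oth v h]. Outside the two holes it follows the old colours except at
    [w], so the cut chain starting at [w'] cannot simply stop and has to return to the cycle. *)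
Lemma exit_partner : exists q : V,
  [/\ q \in dorb (cutmate col z (hole col e)) (mate col c') w', q != w',
      mate col z q \in hole col e & q \notin hole col e].
Proof.
have [col' [o' cf' out inn _]] := exchange oc ec fc ef te tf t hK hz vh vw wK wu uKf wKf.
have [cc' cz c'z] := tri_neq t.
have [vK v'K] : v \in hole col e /\ oth v h \in hole col e.
  by move: hK; rewrite (insideP _ vh) => /andP[].
set s := cutmate col z (hole col e); set O := dorb s (mate col c') w'.
have sK : involutive s by apply: cutmateK.
have tK : involutive (mate col c') by apply: mateK.
have z'w' : mate col z w' = oth v h by rewrite -vw' mateK.
have sw' : s w' = w' by rewrite /s /cutmate z'w' v'K orbT.
have w'h : w' \in kempe col' c v.
  rewrite -vw' -inn // ?(oth_neq ll) //.
  by apply: kempe_mate; rewrite 1?eq_sym // (defect_inside o' cf').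
have noend (q : V) : q \in kempe col' c v -> q \notin (hole col e) -> zend ends col' z c' q -> False.
  move=> qK qe qend; case: (defect_end ll o' cf' qK qend) => qE; first by rewrite qE vK in qe.
  by rewrite qE v'K in qe.
have tw' : mate col c' w' != w'.
  rewrite mate_eq // negbK; case: (boolP (sees col c' w')) => // nw; exfalso.
  apply: (noend w') => //; rewrite /zend; have [-> _] := out w' c' w'K w'Kf w'w.
  by rewrite nw orbT.
set q := dother s (mate col c') w'.
have qO : q \in O by apply: dother_mem.
have qw' : q != w' by apply: dother_neq.
have qend : dend s (mate col c') q by case: (dother_end sK tK sw').
have OKe : O \subset ~: (hole col e).
  apply: dorb_min => [|r0]; rewrite !in_setC //= => rK; split.
    by rewrite /s /cutmate; case: ifPn => //; rewrite negb_or => /andP[].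
  by apply: (hole_mateout oc) => //; rewrite te.
have qK : q \notin (hole col e) by move/subsetP: OKe => /(_ _ qO); rewrite in_setC.
exists q; split=> //; case: (boolP (mate col z q \in (hole col e))) => // mqK; exfalso.
(* If the far end [q] did not exit to the cycle, [w] would not occur on the cut chain, being an end
   of it whose mate is [v]. Old and new colours then agree all along, and [q] would be a forbidden
   end of the new chain. *)
pose A := [set r : V in O | (r \in kempe col' c v) && (r \notin hole col f)].
have unw (r : V) : r \in O -> r != w.
  move=> rO; apply: contraNneq mqK => rw; rewrite rw in rO.
  have wE : w = q.
    apply: (dend_other sK tK sw') => //; last by rewrite eq_sym.
    by rewrite /dend /s /cutmate -vw mateK // vK orbT eqxx.
  by rewrite -wE -vw mateK.
have OA : O \subset A.
  apply: dorb_min => [|r]; first by rewrite in_set dorb_refl w'h w'Kf.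
  rewrite in_set => /and3P[rO rK rf]; have rw := unw r rO.
  have re : r \notin (hole col e) by move/subsetP: OKe => /(_ _ rO); rewrite in_setC.
  split; rewrite in_set.
    rewrite dorb_s //= /s /cutmate (negPf re) /=; case: ifP => _; first by rewrite rK.
    have [_ <-] := out r z re rf rw; rewrite kempe_mate 1?eq_sym //=.
    have [_ ->] := out r z re rf rw.
    by apply: (hole_mateout oc) => //; rewrite tf eq_sym.
  rewrite dorb_t //=; have [_ <-] := out r c' re rf rw; rewrite kempe_mate 1?eq_sym //=.
  have [_ ->] := out r c' re rf rw.
  by apply: (hole_mateout oc) => //; rewrite tf eq_sym.
have : q \in A by apply: (subsetP OA).
rewrite in_set => /and3P[_ qKz qf]; apply: (noend q) => //.
have o (p : 'I_3) := out q p qK qf (unw q qO).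
rewrite /zend; have [-> _] := o z; have [-> _] := o c'.
case/orP: qend; last by rewrite mate_eq // => ->; rewrite orbT.
by rewrite /s /cutmate (negPf qK) (negPf mqK) /= mate_eq // => ->.
Qed.

End Consequences.
End Exchange.

(** * Shared exits of a pentagon *)

Lemma even_invol (T : finType) (A : {set T}) (f : T -> T) :
  (forall a, a \in A -> [/\ f a \in A, f a != a & f (f a) = a]) -> ~~ odd #|A|.
Proof.
have [n] := ubnP #|A|; elim: n A => // n IH A ltA fA.
case: (set_0Vmem A) => [->|[a aA]]; first by rewrite cards0.
have [faA faa ffa] := fA a aA.
have cA : #|A| = #|A :\ a :\ f a|.+2.
  by rewrite (cardsD1 a) aA (cardsD1 (f a) (A :\ a)) !inE faa faA.
rewrite cA /= negbK; apply: IH; first by lia.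
move=> b; rewrite !inE => /and3P[bfa ba bA]; have [fbA fbb ffb] := fA b bA.
split=> //; rewrite fbA andbT; apply/andP; split.
  by apply: contraNneq ba => eq; rewrite -ffb eq ffa.
by apply: contraNneq bfa => eq; rewrite -ffb eq.
Qed.

(** Four shared exits would be consecutive on the pentagon, hence all of one kind, and then every
    vertex would have a neighbour of that kind. *)
Lemma pentagon_bits (x0 x1 x2 x3 x4 y0 y1 y2 y3 y4 : bool) :
  [&& x0 ==> ~~ y1, x1 ==> ~~ y2, x2 ==> ~~ y3, x3 ==> ~~ y4 & x4 ==> ~~ y0] ->
  [&& x1 ==> ~~ y0, x2 ==> ~~ y1, x3 ==> ~~ y2, x4 ==> ~~ y3 & x0 ==> ~~ y4] ->
  ~~ [&& x4 || x1, x0 || x2, x1 || x3, x2 || x4 & x3 || x0] ->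
  ~~ [&& y4 || y1, y0 || y2, y1 || y3, y2 || y4 & y3 || y0] ->
  (x0 || y0) + ((x1 || y1) + ((x2 || y2) + ((x3 || y3) + ((x4 || y4) + 0)))) <= 3.
Proof. by case: x0 x1 x2 x3 x4 y0 y1 y2 y3 y4 => [] [] [] [] [] [] [] [] [] []. Qed.

Section Shared.
Variables (V E : finType) (ends : E -> V * V).
Local Notation inc := (incident ends).
Hypotheses (ll : loopless ends) (cub : cubic ends).
Local Notation coloring := {ffun E -> option 'I_3}.
Implicit Types (c x y z p r : 'I_3) (K A : {set V}) (u v w a b s : V) (e f g h : E).
Local Notation oth := (oth ends).
Local Notation sees := (sees ends).
Local Notation mate := (mate ends).
Local Notation pcol := (pcol ends).
Local Notation opt := (opt ends).
Local Notation kempe := (kempe ends).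
Local Notation inside := (inside ends).
Local Notation defect := (defect ends).
Local Notation hole := (hole ends).
Local Notation third := (third ends).
Variable col : coloring.
Hypothesis oc : opt col.
Let pc : pcol col. Proof. by case: oc. Qed.

(** The exit of [v] is one edge of colour [c] away from another hole; by [kindP] that hole has third
    colour [c]. *)
Definition kind e c v := [exists f, [&& col f == None, f != e,
  mate col c (mate col (third col e) v) \in hole col f & mate col (third col e) v \notin hole col f]].

Definition shared e v := [exists c, (c != third col e) && kind e c v].

(** Adjacency along the odd cycle: the edges inside a hole that avoid the third colour are the chain
    edges and [e] itself. *)
Definition cadj e v v' := exists h, [/\ h \in inside (hole col e), col h != Some (third col e),
  inc v h & oth v h = v'].

Lemma cadj_sym e v v' : cadj e v v' -> cadj e v' v.
Proof. by case=> h [hK hz vh <-]; exists h; rewrite inc_oth othK. Qed.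

Variable e : E.
Hypothesis ec : col e = None.
Local Notation z := (third col e).
Local Notation K := (hole col e).

Lemma kindP c v : kind e c v -> exists f, [/\ col f = None, e != f, third col f = c,
  mate col c (mate col z v) \in hole col f & mate col z v \notin hole col f].
Proof.
case/existsP => f /and4P[/eqP fc fe uf wf]; exists f; split=> //; first by rewrite eq_sym.
set w := mate col z v in uf wf *; set u := mate col c w in uf *.
have uw : u != w by apply: contraNneq wf => <-.
have [k [wk uk kc _ kE]] := mate_edge pc (erefl u) uw.
by apply/esym/Some_inj; rewrite -kc; apply: (hole_leave ll cub oc fc uf uk); rewrite kE.
Qed.

Section Exits.
Hypothesis exits : forall v, v \in K -> mate col z v \notin K.

Lemma cadj_in v v' : cadj e v v' -> v \in K /\ v' \in K.
Proof. by case=> h [hK _ vh <-]; move: hK; rewrite (insideP _ vh) => /andP[]. Qed.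

Lemma kind_adj c c' v v' : tri c c' z -> cadj e v v' -> kind e c v -> ~~ kind e c' v'.
Proof.
move=> t [h [hK hz vh hE]] /kindP[f [fc ef tf uf wf]]; apply/negP => /kindP[g [gc eg tg ug _]].
have [vK v'K] := cadj_in (ex_intro _ h (And4 hK hz vh hE)).
rewrite -hE in v'K ug.
have := shared_kind ll cub oc ec fc ef erefl tf t hK hz vh erefl (exits vK) erefl uf wf erefl
  (exits v'K) gc tg.
by rewrite ug.
Qed.

Definition has_partner c' v' := exists q : V,
  [/\ q \in dorb (cutmate ends col z K) (mate col c') (mate col z v'), q != mate col z v',
      mate col z q \in K & q \notin K].

Lemma kind_partner c c' v v' : tri c c' z -> cadj e v v' -> kind e c v -> has_partner c' v'.
Proof.
move=> t [h [hK hz vh hE]] /kindP[f [fc ef tf uf wf]].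
have [vK v'K] := cadj_in (ex_intro _ h (And4 hK hz vh hE)).
rewrite -hE in v'K *.
exact: (exit_partner ll cub oc ec fc ef erefl tf t hK hz vh erefl (exits vK) erefl uf wf erefl
  (exits v'K)).
Qed.

(** Sending an exit to the other end of its cut chain would be a fixed-point-free involution on the
    exits, which are as many as the vertices of the odd cycle. *)
Lemma no_partners c' : ~ (forall v, v \in K -> has_partner c' v).
Proof.
move=> H; pose W := mate col z @: K.
have oW : odd #|W|.
  rewrite card_imset; first exact: (hole_odd ll cub oc ec).
  exact: inv_inj (mateK z pc).
set s := cutmate ends col z K; have sK : involutive s by apply: cutmateK.
have tK : involutive (mate col c') by apply: mateK.
have inW q : mate col z q \in K -> q \in W.
  by move=> qK; apply/imsetP; exists (mate col z q); rewrite ?mateK.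
suff : ~~ odd #|W| by rewrite oW.
apply: (@even_invol _ _ (dother s (mate col c'))) => _ /imsetP[v vK ->].
set w := mate col z v; have [q [qO qw mq qK]] := H v vK.
have sW (r : V) : mate col z r \in K -> s r = r by move=> rK; rewrite /s /cutmate rK orbT.
have sw : s w = w by apply: sW; rewrite /w mateK.
have sq := sW _ mq.
have qE : q = dother s (mate col c') w.
  by apply: (dend_other sK tK sw) => //; rewrite /dend sq eqxx.
rewrite -qE; split=> //; first exact: inW.
apply/esym/(dend_other sK tK sq).
- by rewrite (dorb_eq sK tK qO) dorb_refl.
- by rewrite /dend sw eqxx.
- by rewrite eq_sym.
Qed.

End Exits.

Lemma pentagon : #|K| = 5 -> exists s0 s1 s2 s3 s4, [/\ K =i [:: s0; s1; s2; s3; s4],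
  uniq [:: s0; s1; s2; s3; s4],
  [/\ cadj e s0 s1, cadj e s1 s2, cadj e s2 s3, cadj e s3 s4 & cadj e s4 s0] &
  exists x y, tri x y z].
Proof.
move=> K5; have [a [x [y [cf hE _]]]] := hole_defect ll cub oc ec.
have [t ae _ nx ny] := cf; have [xy xz yz] := tri_neq t.
have [xK yK] := (mateK x pc, mateK y pc).
have sa : mate col x a = a by rewrite mate_id.
have KE : K = dorb (mate col x) (mate col y) a by rewrite hE (kempe_dorb _ _ _ t).
have N5 := card_dorb xK yK sa; rewrite -KE K5 in N5.
set s1 := mate col y a; set s2 := mate col x s1; set s3 := mate col y s2; set s4 := mate col x s3.
have oE : dother (mate col x) (mate col y) a = s4 by rewrite /dother -N5.
have aK : a \in K by rewrite KE dorb_refl.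
have bK : oth a e \in K by rewrite hE (defect_inside oc cf).
have bE : oth a e = s4.
  rewrite -oE; apply: (dend_other xK yK sa); rewrite ?oth_neq -?KE //.
  by rewrite -zend_dend // /zend ny orbT.
have s4y : mate col y s4 = s4 by rewrite -bE mate_id.
have Ks : K =i [:: a; s1; s2; s3; s4].
  move=> v; apply/idP/idP.
    rewrite KE => /(dorb_orbit xK yK sa)[k]; rewrite -N5.
    case: k => [|[|[|[|[|]]]]] // _ ->; rewrite !inE /=.
    - by rewrite eqxx.
    - by rewrite -/s1 -/s2 eqxx ?orbT.
    - by rewrite -/s1 -/s2 -/s3 -/s4 eqxx ?orbT.
    - by rewrite -/s1 -/s2 -/s3 -/s4 s4y {1}/s4 xK eqxx ?orbT.
    - by rewrite -/s1 -/s2 -/s3 -/s4 s4y {1 2 3 4 5}/s4 xK {1}/s3 yK {1}/s2 xK eqxx ?orbT.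
  have k1 : s1 \in K by rewrite KE; apply: dorb_t; rewrite -KE.
  have k2 : s2 \in K by rewrite KE; apply: dorb_s; rewrite -KE.
  have k3 : s3 \in K by rewrite KE; apply: dorb_t; rewrite -KE.
  have k4 : s4 \in K by rewrite KE; apply: dorb_s; rewrite -KE.
  by move=> vs; rewrite !inE in vs; case/or4P: vs => [|||/orP[]] /eqP->.
have us : uniq [:: a; s1; s2; s3; s4] by apply/card_uniqP; rewrite -(eq_card Ks) K5.
exists a, s1, s2, s3, s4; split=> //; last by exists x, y.
have adj c v : c != z -> v \in K -> mate col c v != v -> cadj e v (mate col c v).
  move=> cz vK mv; have [g [vg _ gc gE _]] := mate_edge pc (erefl _) mv; exists g.
  by rewrite (insideP _ vg) gE vK gc (inj_eq (@Some_inj _)) cz kempe_mate.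
have inK v : v \in [:: a; s1; s2; s3; s4] -> v \in K by rewrite Ks.
move: (us); rewrite /= !inE !negb_or -!andbA => /and5P[n01 n02 n03 n04].
case/and5P=> n12 n13 n14 n23 /and3P[n24 n34 _].
split.
- by apply: adj; rewrite // -/s1 eq_sym.
- by apply: adj => //; rewrite ?inK ?inE ?eqxx ?orbT // -/s2 eq_sym.
- by apply: adj => //; rewrite ?inK ?inE ?eqxx ?orbT // -/s3 eq_sym.
- by apply: adj => //; rewrite ?inK ?inE ?eqxx ?orbT // -/s4 eq_sym.
exists e; rewrite -bE inc_oth othK // (insideP _ ae) aK bK ec; split=> //.
Qed.

Lemma shared_le3 : #|K| = 5 -> (forall v, v \in K -> mate col z v \notin K) ->
  #|[set v in K | shared e v]| <= 3.
Proof.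
move=> K5 exits; have [s0 [s1 [s2 [s3 [s4 [Ks us [a0 a1 a2 a3 a4] [x [y t]]]]]]]] := pentagon K5.
have t' := triC t.
have shE v : shared e v = kind e x v || kind e y v.
  have [xy xz yz] := tri_neq t.
  apply/idP/idP => [/existsP[c /andP[cz]]|/orP[]k].
  - by case: (triP c t) cz => ->; rewrite ?eqxx // => _ ->; rewrite ?orbT.
  - by apply/existsP; exists x; rewrite xz.
  - by apply/existsP; exists y; rewrite yz.
have -> : #|[set v in K | shared e v]| = count (shared e) [:: s0; s1; s2; s3; s4].
  rewrite -size_filter -(card_uniqP (filter_uniq _ us)); apply: eq_card => v.
  by rewrite in_set mem_filter Ks andbC.
rewrite /= !shE.
have [b0 b1 b2 b3 b4] := And5 (cadj_sym a0) (cadj_sym a1) (cadj_sym a2) (cadj_sym a3) (cadj_sym a4).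
have ka c c' v v' : tri c c' z -> cadj e v v' -> kind e c v ==> ~~ kind e c' v'.
  by move=> tt vv; apply/implyP; apply: kind_adj.
have np c c' : tri c c' z ->
  ~~ [&& kind e c s4 || kind e c s1, kind e c s0 || kind e c s2, kind e c s1 || kind e c s3,
       kind e c s2 || kind e c s4 & kind e c s3 || kind e c s0].
  move=> tt; apply/negP => /and5P[k0 k1 k2 k3 k4]; apply: (@no_partners c') => v.
  have kp v1 v2 v0 : cadj e v1 v0 -> cadj e v2 v0 -> kind e c v1 || kind e c v2 -> has_partner c' v0.
    by move=> h1 h2 /orP[]; [apply: (kind_partner exits tt h1)|apply: (kind_partner exits tt h2)].
  rewrite Ks => vs; rewrite !inE in vs; case/or4P: vs => [|||/orP[]] /eqP->.
  - exact: kp k0.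
  - exact: kp k1.
  - exact: kp k2.
  - exact: kp k3.
  - exact: kp k4.
apply: pentagon_bits.
- by apply/and5P; split; apply: ka.
- by apply/and5P; split; apply: ka.
- exact: np t.
- exact: np t'.
Qed.

End Shared.

(** * Extremal colourings *)

Lemma leq_card_rel (S T : finType) (A : {set S}) (B : {set T}) (R : S -> T -> bool) :
  (forall s, s \in A -> exists2 t, t \in B & R s t) ->
  (forall s s' t, s \in A -> s' \in A -> R s t -> R s' t -> s = s') -> #|A| <= #|B|.
Proof.
move=> ex inj; pose F s := [pick t | (t \in B) && R s t].
have FP s : s \in A -> exists t, [/\ F s = Some t, t \in B & R s t].
  move=> /ex[t tB st]; rewrite /F; case: pickP => [t' /andP[]|/(_ t)]; last by rewrite tB st.
  by exists t'.
rewrite -(card_in_imset (f := F) (D := A)); last first.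
  move=> s s' sA s'A; have [t [-> _ st]] := FP s sA; have [t' [-> _ st']] := FP s' s'A.
  by case=> tt; apply: (inj s s' t) => //; rewrite tt.
have Si : injective (@Some T) by move=> ? ? [].
rewrite -(card_imset B Si); apply/subset_leq_card/subsetP => _ /imsetP[s sA ->].
by have [t [-> tB _]] := FP s sA; apply: imset_f.
Qed.

Section Extremal.
Variables (V E : finType) (ends : E -> V * V).
Local Notation inc := (incident ends).
Hypotheses (ll : loopless ends) (cub : cubic ends).
Local Notation coloring := {ffun E -> option 'I_3}.
Implicit Types (col : coloring) (A B C c x y z : 'I_3) (u v w a b s : V) (e f g h : E).
Local Notation oth := (oth ends).
Local Notation sees := (sees ends).
Local Notation mate := (mate ends).
Local Notation pcol := (pcol ends).
Local Notation opt := (opt ends).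
Local Notation kempe := (kempe ends).
Local Notation inside := (inside ends).
Local Notation defect := (defect ends).
Local Notation hole := (hole ends).
Local Notation third := (third ends).

Definition cnt col c := #|[set e | (col e == None) && (third col e == c)]|.

(** The vertices missing [c] correspond to the uncoloured edges of another third colour, each of
    which has exactly one such end. For fixed [unc], minimising a class size is therefore minimising
    [cnt]. *)
Lemma size_cnt col c : opt col -> (size_of col c).*2 + unc col = cnt col c + #|V|.
Proof.
move=> oc; have [pc _] := oc.
pose M := [set v | ~~ sees col c v].
pose U := [set e | (col e == None) && (third col e != c)].
pose g e := if ~~ sees col c (ends e).1 then (ends e).1 else (ends e).2.
have ginc e : inc (g e) e by rewrite /g; case: ifP => _; rewrite ?inc1 ?inc2.
have gI : {in U &, injective g}.
  move=> e f; rewrite !inE => /andP[/eqP ec _] /andP[/eqP fc _] ef.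
  by apply: (opt_unc_uniq ll cub oc (ginc e)) => //; rewrite ef ginc.
have gU : g @: U = M.
  apply/setP => v; rewrite [RHS]inE; apply/imsetP/idP => [[e]|nv].
    rewrite inE => /andP[/eqP ec tc] ->.
    have [a [x [y [[t ae _ nx ny] _ aE]]]] := hole_defect ll cub oc ec.
    rewrite aE oth1 in nx ny; rewrite /g; case: ifP => // /negbFE s1.
    by case: (triP c t) tc s1 => ->; rewrite ?eqxx // (negPf nx).
  have [e [ve ec]] := miss_exunc cub pc nv; exists e.
    rewrite inE ec eqxx /=; apply: contraNneq nv => <-.
    by apply: (hole_sees ll cub oc ec); apply: hole_inside.
  rewrite /g; case/orP: (ve) => /eqP vE; rewrite -vE; first by rewrite nv.
  have := opt_nocommon oc ve ec nv.
  have -> : oth v e = (ends e).1 by rewrite /oth vE; case: eqP => // <-.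
  by move=> ->.
have cM : #|M| = #|U| by rewrite -gU card_in_imset.
have c1 : (size_of col c).*2 + #|M| = #|V|.
  rewrite -(card_sees ll c pc); apply: etrans (cardsC [set v | sees col c v]); congr (_ + _).
  by apply: eq_card => v; rewrite !inE.
have c2 : cnt col c + #|U| = unc col.
  rewrite /unc -[RHS](cardsID [set e | third col e == c]); congr (_ + _); apply: eq_card => e;
    by rewrite !inE // andbC.
by rewrite -c2 -c1 cM addnCA addnA.
Qed.

(** A chain of colours [x], [z] whose two ends both miss [x] has one more edge of colour [z] than of
    colour [x]; switching it moves the surplus to [x]. *)
Lemma flip col x y z u u' : opt col -> tri x y z -> u' != u -> ~~ sees col x u ->
  ~~ sees col x u' -> u' \in kempe col y u ->
  exists col', [/\ opt col', (size_of col' z).+1 = size_of col z & size_of col' y = size_of col y].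
Proof.
move=> oc t uu nu nu' uK; have [pc _] := oc; have [xy xz yz] := tri_neq t.
pose K := kempe col y u.
have t' : tri x z y by apply: triC; apply: triR; apply: triR.
have cl : closedxy ends col z x K by apply: kempe_closedxy; apply: triC.
exists (swapc ends col z x K); split; first exact: opt_swapc.
  have mz : missK ends col K z = 0.
    apply: eq_card0 => v; rewrite in_set; apply/negP => /andP[vK nv].
    have vu : v != u by apply: contraNneq nv => ->; apply: (sees_other ll cub oc nu); rewrite eq_sym.
    have vu' : v = u'.
      apply: (@ends_uniq _ _ ends ll col x z y u) => //; rewrite /zend ?nu ?nu' ?nv ?orbT //.
    by case/negP: nv; rewrite vu'; apply: (sees_other ll cub oc nu'); rewrite eq_sym.
  have mx : missK ends col K x = 2.
    rewrite /missK; apply: etrans (_ : #|[set u; u']| = 2); last by rewrite cards2 eq_sym uu.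
    apply: eq_card => v; rewrite in_set in_set2; apply/idP/idP => [/andP[vK nv]|].
      case: (eqVneq v u) => //= vu; apply/eqP.
      apply: (@ends_uniq _ _ ends ll col x z y u) => //; rewrite /zend ?nu ?nu' ?nv ?orbT //.
    by case/orP => /eqP->; rewrite ?nu ?nu' ?uK ?kempe_refl.
  have zx : z != x by rewrite eq_sym.
  have := size_swap ll pc cl zx; rewrite mx mz addn0 => /eqP.
  by rewrite -(eqn_add2r 0) addn0 addn2 -doubleS => /eqP; rewrite addn0 => /double_inj.
by apply: size_swap_other; rewrite // eq_sym.
Qed.

(* Ends of one-edge Kempe chains joining two odd cycles of third colour [C]. *)
Definition linked_ends B C col : {set V} :=
  [set u | [&& ~~ sees col B u, mate col C u != u & ~~ sees col B (mate col C u)]].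

(** Competitors may also rename the colours; in particular class [A] is smallest and class [B] at
    most as large as class [C]. *)
Definition extremal A B C col : Prop :=
  [/\ opt col,
      forall col' c, opt col' -> size_of col A <= size_of col' c,
      forall col' A' B', opt col' -> A' != B' -> size_of col' A' = size_of col A ->
        size_of col B <= size_of col' B' &
      forall col', opt col' -> (forall c, size_of col' c = size_of col c) ->
        #|linked_ends B C col'| <= #|linked_ends B C col|].

Lemma extremal_ex : exists A B C col, tri A B C /\ extremal A B C col.
Proof.
pose c0 : coloring := [ffun => None].
have pc0 : pcol c0 by apply/pcolP => v e f c _ _; rewrite ffunE.
have [col pcl mcl] := arg_minnP (@unc E 'I_3) pc0.
pose ob (q : coloring) := pcol q && [forall col' : coloring, pcol col' ==> (unc q <= unc col')].
have obP col1 : reflect (opt col1) (ob col1).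
  apply: (iffP andP) => -[p1 m1]; split=> //.
    by move=> col' p'; move/forallP: m1 => /(_ col')/implyP/(_ p').
  by apply/forallP => col'; apply/implyP => p'; apply: m1.
have oc : ob col by apply/obP; split=> // col' p'; apply: mcl.
pose P1 (q : coloring * 'I_3 * 'I_3) := ob q.1.1 && (q.1.2 != q.2).
have p0 : P1 (col, ord0, ord_max) by rewrite /P1 /= oc.
have [q1 Pq1 m1] := arg_minnP (fun q => size_of q.1.1 q.1.2) p0.
pose P2 q := P1 q && (size_of q.1.1 q.1.2 == size_of q1.1.1 q1.1.2).
have p1 : P2 q1 by rewrite /P2 Pq1 /=.
have [[[col2 A] B] /andP[/andP[/= /obP o2 AB]] /eqP s2 m2] := arg_minnP (fun q => size_of q.1.1 q.2) p1.
have [C t] := tri_ex AB.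
pose P3 col := ob col && [forall c, size_of col c == size_of col2 c].
have p2 : P3 col2 by apply/andP; split; [apply/obP|apply/forallP].
have [col3 /andP[/obP o3 /forallP s3] m3] := arg_maxnP (fun col => #|linked_ends B C col|) p2.
have s3' c : size_of col3 c = size_of col2 c by apply/eqP.
exists A, B, C, col3; split=> //; split=> //.
- move=> col' c /obP o'; rewrite s3' s2.
  have [d cd] : exists d, c != d.
    by exists (if c == ord0 then ord_max else ord0); case: (c =P ord0) => [->|/eqP].
  by apply: (m1 (col', c, d)); rewrite /P1 /= o'.
- move=> col' A' B' /obP o' AB' s'; rewrite s3'.
  by apply: (m2 (col', A', B')); rewrite /P2 /P1 /= o' AB' s' s3' s2 eqxx.
- move=> col' /obP o' s'; apply: m3; rewrite /P3 o' /=.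
  by apply/forallP => c; rewrite s' s3'.
Qed.

(** * Non-adjacent cycles in an extremal colouring *)

Section Fixed.
Variables (A B C : 'I_3) (col : coloring).
Hypotheses (t : tri A B C) (ex : extremal A B C col).
Let oc : opt col. Proof. by case: ex. Qed.
Let pc : pcol col. Proof. by case: oc. Qed.
Local Notation dlc := (linked_ends B C col).

Lemma noflipA col1 x y u u' : opt col1 -> (forall c, size_of col1 c = size_of col c) ->
  tri x y A -> u' != u -> ~~ sees col1 x u -> ~~ sees col1 x u' -> u' \in kempe col1 y u -> False.
Proof.
move=> o1 s1 t1 uu nu nu' uK; have [col' [o' sA _]] := flip o1 t1 uu nu nu' uK.
by have [_ /(_ _ A o') + _ _] := ex; rewrite -s1 -sA ltnn.
Qed.

Lemma noflipB col1 u u' : opt col1 -> (forall c, size_of col1 c = size_of col c) ->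
  u' != u -> ~~ sees col1 C u -> ~~ sees col1 C u' -> u' \in kempe col1 A u -> False.
Proof.
move=> o1 s1 uu nu nu' uK.
have t1 : tri C A B by apply: triR; apply: triR.
have [col' [o' sB sA]] := flip o1 t1 uu nu nu' uK.
have [AB _ _] := tri_neq t.
by have [_ _ /(_ _ A B o' AB) + _] := ex; rewrite sA s1 => /(_ erefl); rewrite -s1 -sB ltnn.
Qed.

Definition linked e := [exists u, inc u e && (u \in dlc)].
(** The uncoloured edges whose cycles are charged 8; those left out are charged one linked end. *)
Definition Omega := [set e | (col e == None) && ~~ ((third col e == C) && linked e)].

Lemma linked_ends_sym u : u \in dlc -> mate col C u \in dlc.
Proof. by rewrite !inE mateK // => /and3P[n1 m n2]; rewrite n1 n2 eq_sym m. Qed.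

(** With third colour [A] the [C]-mate of [u] would be an end of the chain of [g], so both ends of
    [g] would miss [B]; third colour [B] would be seen at [u]. *)
Lemma linked_ends_third u g : u \in dlc -> inc u g -> col g = None -> third col g = C.
Proof.
rewrite inE => /and3P[nu mu nm] ug gc; have [AB AC BC] := tri_neq t.
have [x [y cf]] := cfgP ll cub oc ug gc.
have uh : u \in hole col g by apply: hole_inside.
case: (triP (third col g) t) => tg //.
  rewrite tg in cf; have [tt _ _ nx ny] := cf.
  have xB : x = B by apply: (opt_miss_uniq ll cub oc nx).
  have mh : mate col C u \in kempe col A u by apply: kempe_mate; rewrite ?kempe_refl // eq_sym.
  have zm : zend ends col x y (mate col C u) by rewrite /zend xB nm.
  case: (defect_end ll oc cf mh zm) => mE; first by rewrite mE eqxx in mu.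
  by case/negP: nm; rewrite mE; apply: (opt_nocommon oc).
by case/negP: nu; rewrite -tg; apply: (hole_sees ll cub oc gc).
Qed.

Lemma unc_at_linked_ends u : u \in dlc -> exists g, [/\ inc u g, col g = None, third col g = C & g \notin Omega].
Proof.
move=> ud; have nu : ~~ sees col B u by move: ud; rewrite inE => /and3P[].
have [g [ug gc]] := miss_exunc cub pc nu; exists g; rewrite (linked_ends_third ud ug gc); split=> //.
rewrite inE gc (linked_ends_third ud ug gc) !eqxx /= negbK; apply/existsP; exists u; by rewrite ug ud.
Qed.

(** An edge between the two cycles has their common third colour [z]. Moving both uncoloured edges
    until [v] and [w] miss the same colour turns it into a one-edge chain. For [z = A] or [z = B] a
    flip contradicts minimality; for [z = C] it is a new pair of linked ends, while the old ones lie
    on neither cycle and survive. *)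
Lemma Omega_nonadj e f v : e \in Omega -> f \in Omega -> v \in hole col e ->
  mate col (third col e) v \notin hole col e -> mate col (third col e) v \notin hole col f.
Proof.
move=> eO fO vK; set z := third col e; set w := mate col z v => wK; apply/negP => wf.
have ef : e != f by apply: contraNneq wK => ->.
move: (eO) (fO); rewrite !inE => /andP[/eqP ec nle] /andP[/eqP fc nlf].
have vf : v \notin hole col f by apply: (hole_disj ll cub oc ec).
have wv : w != v by apply: contraNneq vf => <-.
have tf : third col f = z.
  have [k [vk wk kc _ kE]] := mate_edge pc (erefl w) wv.
  by apply/esym/Some_inj; rewrite -kc; apply: (hole_leave ll cub oc fc wf wk); rewrite kE.
have dis s : s \in hole col f -> s \notin hole col e.
  by apply: (hole_disj ll cub oc fc); rewrite // eq_sym.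
have key x y : tri x y z -> exists col2,
    [/\ opt col2, forall c, size_of col2 c = size_of col c, ~~ sees col2 x v /\ ~~ sees col2 x w,
        (forall s, s \notin hole col e -> s \notin hole col f -> forall p, sees col2 p s = sees col p s) &
        forall s, mate col2 z s = mate col z s].
  move=> txy; have [h [hK vh hz]] := hole_cedge ll cub oc ec vK.
  have [col1 R1 cf1] := hole_shift ll cub oc ec txy hK hz vh.
  have [o1 i1 _ s1] := R1.
  have f1 : col1 f = None.
    rewrite i1 // (insideP _ (inc1 ends f)) negb_and dis //.
    by apply: hole_inside; rewrite ?inc1.
  have [tf1 hf1] : third col1 f = third col f /\ hole col1 f = hole col f.
    by apply: hole_agree => // s p sf; rewrite (shiftR_out _ R1 (dis _ sf)).
  have wf1 : w \in hole col1 f by rewrite hf1.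
  have [h2 [h2K wh2 h2z]] := hole_cedge ll cub o1 f1 wf1.
  have txy2 : tri x y (third col1 f) by rewrite tf1 tf.
  have [col2 R2 cf2] := hole_shift ll cub o1 f1 txy2 h2K h2z wh2.
  rewrite tf1 tf hf1 in R2 cf2; have [o2 _ _ s2] := R2.
  exists col2; split=> //.
  - by move=> c; rewrite s2 s1.
  - rewrite (shiftR_out _ R2 vf); split; first by case: cf1.
    by case: cf2.
  - by move=> s se sf p; rewrite (shiftR_out _ R2 sf) (shiftR_out _ R1 se).
  - by move=> s; rewrite (shiftR_z _ R2) (shiftR_z _ R1).
have wK2 y col2 : y != z -> mate col2 z v = w -> w \in kempe col2 y v.
  by move=> yz <-; apply: kempe_mate; rewrite ?kempe_refl // eq_sym.
have [AB AC BC] := tri_neq t.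
case: (triP z t) => zE.
- have txy : tri B C z by rewrite zE; apply: triR.
  have [col2 [o2 s2 [nv nw] _ mz]] := key _ _ txy.
  rewrite zE in txy; apply: (noflipA o2 s2 txy wv nv nw).
  by apply: wK2; rewrite ?mz // zE eq_sym.
- have txy : tri C A z by rewrite zE; apply: triR; apply: triR.
  have [col2 [o2 s2 [nv nw] _ mz]] := key _ _ txy.
  apply: (noflipB o2 s2 wv nv nw).
  by apply: wK2; rewrite ?mz // zE.
have txy : tri B A z by rewrite zE; apply: triC.
have [col2 [o2 s2 [nv nw] out mz]] := key _ _ txy.
rewrite zE in mz nle; rewrite tf zE in nlf.
rewrite -/z zE eqxx /= in nle; rewrite eqxx /= in nlf.
have nole u : u \in dlc -> u \notin hole col e.
  move=> ud; have [g [ug gc tg gO]] := unc_at_linked_ends ud; apply: contra gO => ue.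
  by rewrite (hole_unc ll cub oc ec ue ug gc).
have nolf u : u \in dlc -> u \notin hole col f.
  move=> ud; have [g [ug gc tg gO]] := unc_at_linked_ends ud; apply: contra gO => uf.
  by rewrite (hole_unc ll cub oc fc uf ug gc).
have sub : dlc \subset linked_ends B C col2.
  apply/subsetP => u ud; have ud' := linked_ends_sym ud.
  by move: (ud); rewrite !inE mz !out ?nole ?nolf.
have v2 : v \in linked_ends B C col2.
  by rewrite inE mz -zE -/w nv wv nw.
have vn : v \notin dlc by apply: contraL vK; apply: nole.
have [_ _ _ /(_ _ o2 s2)] := ex; rewrite leqNgt => /negP; apply.
by apply: proper_card; apply/properP; split=> //; exists v.
Qed.

(** A cycle with third colour [B] has an end [a] missing [C]. The chain of colours [B], [C] from [a]
    cannot end at another vertex missing [C], by a flip, so it ends at some [a'] missing [B]. The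
    uncoloured edge there has third colour [C], and it is not linked, since a link at [a'] would
    give the chain a third end. The chain is recovered from [a'], which makes the assignment
    injective. *)
Lemma cnt_Omega : cnt col B <= #|[set e in Omega | third col e == C]|.
Proof.
have [AB AC BC] := tri_neq t.
have tt : tri C B A by apply: triC; apply: triR.
pose R f g := [exists a, exists a', [&& inc a f, ~~ sees col C a, inc a' g, ~~ sees col B a' &
  (col g == None) && (a' \in kempe col A a)]].
apply: (leq_card_rel (R := R)).
  move=> f; rewrite inE => /andP[/eqP fc /eqP tf].
  have [a [af na]] : exists a, inc a f /\ ~~ sees col C a.
    have [x [y cf]] := cfgP ll cub oc (inc1 ends f) fc; rewrite tf in cf.
    have [t' af _ nx ny] := cf; have [xy xz yz] := tri_neq t'.
    have [xC|yC] : x = C \/ y = C.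
      case: (triP C t') => CE; [by left|by right|]; by rewrite CE eqxx in BC.
      by exists (ends f).1; rewrite -xC.
    by exists (oth (ends f).1 f); rewrite inc_oth -yC.
  have sB : sees col B a by apply: (sees_other ll cub oc na).
  have [a' [a'K a'a]] := ends_other ll pc tt na sB.
  rewrite /zend; case: (boolP (sees col C a')) => /= [sC na'|nC _]; last first.
    by case: (noflipB oc (fun=> erefl) a'a na nC a'K).
  have [g [a'g gc]] := miss_exunc cub pc na'.
  exists g; last first.
    by apply/existsP; exists a; apply/existsP; exists a'; rewrite af na a'g na' gc a'K.
  have zea : zend ends col C B a by rewrite /zend na.
  have zea' : zend ends col C B a' by rewrite /zend na' orbT.
  have aK' : a \in kempe col A a' by apply: kempe_sym.
  have [x [y cf]] := cfgP ll cub oc a'g gc.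
  have tg : third col g = C.
    case: (triP (third col g) t) => tg //.
      rewrite tg in cf; have [t' _ _ nx ny] := cf; have [xy xz yz] := tri_neq t'.
      have za : zend ends col x y a.
        rewrite /zend; case: (triP C t') => CE; rewrite -?CE ?na ?orbT //.
        by rewrite CE eqxx in AC.
      have ag : inc a g by case: (defect_end ll oc cf aK' za) => ->; rewrite ?inc_oth.
      have fg := opt_unc_uniq ll cub oc af ag fc gc.
      by rewrite -fg tf in tg; rewrite tg eqxx in AB.
    by case/negP: na'; rewrite -tg; apply: (hole_sees ll cub oc gc); apply: hole_inside.
  rewrite !inE gc tg !eqxx /= andbT; apply/existsP => -[u /andP[ug ud]].
  have nu : ~~ sees col B u by move: ud; rewrite inE => /and3P[].
  have ua' : u = a'.
    apply/eqP/negPn/negP => ua; case/negP: nu; rewrite (inc_eq a'g ug ua).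
    exact: (opt_nocommon oc).
  move: ud; rewrite ua' inE => /and3P[_ mu nm].
  have mK : mate col C a' \in kempe col A a by apply: kempe_mate; rewrite // eq_sym.
  have mna : mate col C a' != a by apply: contraNneq nm => ->.
  have := ends_uniq ll pc tt zea mK a'K _ zea' mna a'a.
  by rewrite {1}/zend nm orbT => /(_ isT) mE; rewrite mE eqxx in mu.
move=> f f' g; rewrite !inE => /andP[/eqP fc _] /andP[/eqP fc' _].
case/existsP => a /existsP[a' /and5P[af na a'g na' /andP[/eqP gc a'K]]].
case/existsP => b /existsP[b' /and5P[bf nb b'g nb' /andP[_ b'K]]].
have ab' : b' = a'.
  apply/eqP/negPn/negP => ba; case/negP: nb'; rewrite (inc_eq a'g b'g ba).
  exact: (opt_nocommon oc).
rewrite ab' in b'K.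
have aE s : ~~ sees col C s -> s != a' /\ zend ends col C B s.
  move=> ns; rewrite /zend ns; split=> //; apply: contraNneq BC => sa'.
  by rewrite sa' in ns; rewrite (opt_miss_uniq ll cub oc na' ns).
have [naa' za] := aE a na; have [nba' zb] := aE b nb.
have za' : zend ends col C B a' by rewrite /zend na' orbT.
have ab := ends_uniq ll pc tt za' (kempe_sym pc a'K) (kempe_sym pc b'K) za zb naa' nba'.
by apply: (opt_unc_uniq ll cub oc af) => //; rewrite ab.
Qed.

End Fixed.
End Extremal.

(** * The counting argument *)

Section Main.
Variables (V E : finType) (ends : E -> V * V).
Local Notation inc := (incident ends).
Hypotheses (ll : loopless ends) (cub : cubic ends).
Local Notation coloring := {ffun E -> option 'I_3}.
Implicit Types (A B C c x y z : 'I_3) (u v w a b s : V) (e f g h : E) (X Z : {set V}).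
Local Notation oth := (oth ends).
Local Notation sees := (sees ends).
Local Notation mate := (mate ends).
Local Notation pcol := (pcol ends).
Local Notation opt := (opt ends).
Local Notation kempe := (kempe ends).
Local Notation inside := (inside ends).
Local Notation cut := (cut ends).
Local Notation defect := (defect ends).
Local Notation hole := (hole ends).
Local Notation third := (third ends).

Lemma cut_cardF (F : {set E}) X : \sum_(v in X) #|[set e in F | inc v e]| =
  2 * #|inside X :&: F| + #|cut X :&: F|.
Proof.
rewrite (eq_bigr (fun v => \sum_(e in F) (inc v e : nat))); last first.
  move=> v _; rewrite -sum1_card big_mkcond [RHS]big_mkcond; apply: eq_bigr => e _.
  by rewrite in_set; case: (e \in F); case: (inc v e).
rewrite exchange_big /= -!sum1_card big_distrr /= !(big_mkcond (fun e => e \in _ :&: _)).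
rewrite [LHS]big_mkcond -big_split /=; apply: eq_bigr => e _; rewrite !in_setI !in_set.
case: (e \in F); rewrite ?andbT ?andbF //.
have ne : (ends e).1 != (ends e).2 := ll e.
have s1 a : \sum_(v in X) (v == a : nat) = (a \in X).
  rewrite big_mkcond (bigD1 a) //= eqxx big1 ?addn0; first by case: (a \in X).
  by move=> v /negPf->; case: ifP.
rewrite (eq_bigr (fun v => (v == (ends e).1) + (v == (ends e).2))); last first.
  move=> v _; rewrite /incident; case: (v =P (ends e).1) => [->|] //.
  by rewrite (negPf ne).
rewrite big_split /= !s1.
by case: (_ \in X); case: (_ \in X).
Qed.

Lemma cut_card X : 3 * #|X| = 2 * #|inside X| + #|cut X|.
Proof.
have := cut_cardF setT X; rewrite !setIT => <-.
rewrite mulnC -sum_nat_const; apply: eq_bigr => v _.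
by rewrite -[LHS](cub v); apply: eq_card => e; rewrite !inE.
Qed.

Definition nbr u v := [exists e, inc u e && (oth u e == v)].
Definition nedges u v := #|[set e | inc u e && (oth u e == v)]|.

Lemma nbrP u v : reflect (exists2 e, inc u e & oth u e = v) (nbr u v).
Proof.
by apply: (iffP existsP) => [[e /andP[ue /eqP ev]]|[e ue ev]]; exists e; rewrite // ue ev eqxx.
Qed.

Lemma nbrC u v : nbr u v = nbr v u.
Proof.
by apply/nbrP/nbrP => -[e ue <-]; exists e; rewrite ?inc_oth ?othK.
Qed.

Lemma deg3 v : #|[set e | inc v e]| = 3. Proof. exact: cub. Qed.

Lemma pair_nbr v w : (forall e, inc v e -> oth v e = w) -> forall e, inc w e -> oth w e = v.
Proof.
move=> H e we.
have sub : [set e | inc v e] \subset [set e | inc w e].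
  by apply/subsetP => g; rewrite !inE => vg; rewrite -(H g vg) inc_oth.
have eqs : [set e | inc v e] = [set e | inc w e] by apply/eqP; rewrite eqEcard sub !deg3.
have ve : inc v e by have := in_set (inc v) e; rewrite eqs inE we.
by rewrite -(H e ve) othK.
Qed.

(** * Odd cycles in a graph without triangles and digons; triple edges may remain *)

Section Girth.
Hypotheses (notri : forall u v w, nbr u v -> nbr v w -> nbr w u -> False)
           (nodig : forall u v, nedges u v != 2).
Variable col : coloring.
Hypothesis oc : opt col.
Let pc : pcol col. Proof. by case: oc. Qed.
Local Notation cadj := (cadj ends col).

Lemma cadj_nbr e v v' : cadj e v v' -> nbr v v'.
Proof. by case=> h [_ _ vh hE]; apply/nbrP; exists h. Qed.

Lemma mate_nbr c v : mate col c v != v -> nbr v (mate col c v).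
Proof.
move=> mv; have [g [vg _ _ gE _]] := mate_edge pc (erefl _) mv.
by apply/nbrP; exists g.
Qed.

Lemma hole_ge5 e : col e = None -> 5 <= #|hole col e|.
Proof.
move=> ec; have od := hole_odd ll cub oc ec.
have [a [x [y [cf hE _]]]] := hole_defect ll cub oc ec.
have [t ae _ nx ny] := cf; have [xy xz yz] := tri_neq t.
set b := oth a e in ny.
have aK : a \in hole col e by apply: hole_inside.
have bK : b \in hole col e by apply: hole_inside; rewrite ?inc_oth.
have ba : b != a by apply: oth_neq.
have sya : sees col y a by apply: (sees_other ll cub oc nx); rewrite eq_sym.
have sxb : sees col x b by apply: (sees_other ll cub oc ny).
set m := mate col y a; set m' := mate col x b.
have mK : m \in hole col e by apply: hole_closed.
have m'K : m' \in hole col e by apply: hole_closed.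
have ma : m != a by rewrite mate_eq // sya.
have m'b : m' != b by rewrite mate_eq // sxb.
have mb : m != b by apply: contraNneq ma => mb; rewrite -(mateK y pc a) -/m mb (mate_id ny).
have m'a : m' != a by apply: contraNneq m'b => ma'; rewrite -(mateK x pc b) -/m' ma' (mate_id nx).
rewrite ltnNge; apply/negP => le4.
have c3 : #|hole col e| = 3.
  have : 0 < #|hole col e| by apply/card_gt0P; exists a.
  have : #|hole col e| != 1.
    apply/negP => /eqP c1; have /card_gt1P : exists q r, [/\ q \in hole col e, r \in hole col e & q != r].
      by exists b, a.
    by rewrite c1.
  by move: od le4; case: #|_| => [|[|[|[|[|]]]]].
have mm : m = m'.
  have : #|hole col e :\ a :\ b| = 1.
    have := c3; rewrite (cardsD1 a) aK (cardsD1 b (_ :\ a)) in_setD1 ba bK.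
    by rewrite !add1n => -[].
  move/eqP/cards1P => [q qE].
  have qP r : r \in hole col e -> r != a -> r != b -> r = q.
    by move=> rK ra rb; apply/set1P; rewrite -qE !in_setD1 ra rb.
  by rewrite (qP m) // (qP m').
apply: (@notri a m b).
- by apply: mate_nbr; rewrite -/m.
- by rewrite nbrC mm; apply: mate_nbr; rewrite -/m'.
- by rewrite nbrC; apply/nbrP; exists e.
Qed.

(** A second edge to [v1] would make a digon of multiplicity exactly two, as the remaining edge at
    [v] goes to [v2]; an edge to [v3] would close a triangle. On a pentagon the listed vertices are
    all of them. *)
Lemma star_nochord e v v1 v2 v3 v4 : cadj e v v1 -> cadj e v v2 -> cadj e v1 v3 -> cadj e v2 v4 ->
  v1 != v2 -> v \in hole col e -> col e = None ->
  mate col (third col e) v \notin [:: v; v1; v2; v3; v4].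
Proof.
move=> a1 a2 a3 a4 n12 vK ec; set z := third col e; set w := mate col z v.
have sz := hole_sees ll cub oc ec vK.
have wv : w != v by rewrite mate_eq // sz.
have nw := mate_nbr wv; rewrite -/w in nw.
have nd p q : cadj e v p -> cadj e v q -> p != q -> w != p.
  move=> [h [hK hz vh hp]] [k [kK kz vk kq]] pq; apply/negP => /eqP wp.
  have [g [vg _ gz gE _]] := mate_edge pc (erefl w) wv.
  have hg : h != g by apply: contraNneq hz => ->; rewrite gz.
  have /negP := nodig v p; case; rewrite eqn_leq; apply/andP; split; last first.
    by apply/card_gt1P; exists h, g; rewrite !inE vh vg hp gE wp eqxx hg.
  rewrite -ltnS -[in X in _ < X](deg3 v); apply: proper_card; apply/properP; split.
    by apply/subsetP => i; rewrite !inE => /andP[].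
  by exists k; rewrite !inE vk ?kq //= eq_sym.
have n21 : v2 != v1 by rewrite eq_sym.
rewrite !inE !negb_or wv (nd _ _ a1 a2 n12) (nd _ _ a2 a1 n21) /=.
apply/andP; split; apply/negP => /eqP wE.
  by apply: (notri (cadj_nbr a1) (cadj_nbr a3)); rewrite -wE nbrC.
by apply: (notri (cadj_nbr a2) (cadj_nbr a4)); rewrite -wE nbrC.
Qed.

Lemma pentagon_exits e : col e = None -> #|hole col e| = 5 ->
  forall v, v \in hole col e -> mate col (third col e) v \notin hole col e.
Proof.
move=> ec K5; have [s0 [s1 [s2 [s3 [s4 [Ks us [a0 a1 a2 a3 a4] _]]]]]] := pentagon ll cub oc ec K5.
have sy := @cadj_sym _ _ ends col e.
move: (us); rewrite /= !inE !negb_or -!andbA => /and5P[n01 n02 n03 n04].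
case/and5P=> n12 n13 n14 n23 /and3P[n24 n34 _].
have key v v1 v2 v3 v4 : cadj e v v1 -> cadj e v v2 -> cadj e v1 v3 -> cadj e v2 v4 ->
    v1 != v2 -> v \in hole col e ->
    {subset [:: s0; s1; s2; s3; s4] <= [:: v; v1; v2; v3; v4]} ->
    mate col (third col e) v \notin hole col e.
  move=> h1 h2 h3 h4 h12 vK sub; rewrite Ks; apply: contra (star_nochord h1 h2 h3 h4 h12 vK ec).
  exact: sub.
have sb (l l' : seq V) : all (mem l') l -> {subset l <= l'} by move/allP.
move=> v vK; have vs := vK; rewrite Ks !inE in vs.
case/or4P: vs vK => [|||/orP[]] /eqP-> vK.
- by apply: (key _ s1 s4 s2 s3); try (apply: sb; rewrite /= !inE !eqxx ?orbT); first [by [] | by apply: sy | by rewrite eq_sym].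
- by apply: (key _ s2 s0 s3 s4); try (apply: sb; rewrite /= !inE !eqxx ?orbT); first [by [] | by apply: sy | by rewrite eq_sym].
- by apply: (key _ s3 s1 s4 s0); try (apply: sb; rewrite /= !inE !eqxx ?orbT); first [by [] | by apply: sy | by rewrite eq_sym].
- by apply: (key _ s4 s2 s0 s1); try (apply: sb; rewrite /= !inE !eqxx ?orbT); first [by [] | by apply: sy | by rewrite eq_sym].
- by apply: (key _ s0 s3 s1 s2); try (apply: sb; rewrite /= !inE !eqxx ?orbT); first [by [] | by apply: sy | by rewrite eq_sym].
Qed.

Section Weights.
Variable Z : {set V}.
(** A vertex outside [Z] lies on a triple edge. *)
Hypothesis Zc : forall v, v \notin Z -> exists w, forall e, inc v e -> oth v e = w.

(** The component of a triple edge has two vertices, too few for a cycle of length at least 5. *)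
Lemma hole_Z e v w : col e = None -> v \in hole col e -> w = v \/ nbr v w -> w \in Z.
Proof.
move=> ec vK vw; apply/negPn/negP => /Zc[u wu].
have uw := pair_nbr wu.
have vA : v \in [set w; u].
  case: vw => [->|]; first by rewrite !inE eqxx.
  by rewrite nbrC => /nbrP[k wk <-]; rewrite (wu _ wk) !inE eqxx orbT.
have clA q c : q \in [set w; u] -> c != third col e -> mate col c q \in [set w; u].
  move=> qA _; case sq: (sees col c q); last by rewrite mate_id ?sq.
  have [k [qk _ ->]] := mateP sq; move: qA qk; rewrite !inE => /orP[]/eqP-> qk.
    by rewrite (wu _ qk) eqxx orbT.
  by rewrite (uw _ qk) eqxx.
have [a [x [y [_ hE _]]]] := hole_defect ll cub oc ec.
have sub : hole col e \subset [set w; u].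
  by rewrite hE; rewrite hE in vK; rewrite -(kempe_eq pc vK); apply: kempe_min.
have := subset_leq_card sub; have := hole_ge5 ec; rewrite cards2.
by case: (w != u) => h1 h2; have := leq_trans h1 h2.
Qed.

(** * Sharing out the vertices among the cycles *)

Section Count.
Variables A B C : 'I_3.
Hypotheses (t : tri A B C) (ex : extremal ends A B C col).
Local Notation Om := (Omega ends B C col).
Local Notation dlc := (linked_ends ends B C col).
Local Notation phi := (fun p : E * V => mate col (third col p.1) p.2).

Let OmN e : e \in Om -> col e = None.
Proof. by rewrite inE => /andP[/eqP]. Qed.

Definition exit_pairs :=
  [set p : E * V | [&& p.1 \in Om, p.2 \in hole col p.1 & phi p \notin hole col p.1]].
Lemma exit_pairsP e v : reflect [/\ e \in Om, v \in hole col e &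
  mate col (third col e) v \notin hole col e] ((e, v) \in exit_pairs).
Proof. by rewrite [(e, v) \in _]in_set; apply: and3P. Qed.

(* Each outside vertex has total worth at most 3, shared by the cycles it is adjacent to. *)
Definition load w := #|[set p in exit_pairs | phi p == w]|.
Definition worth w := if load w == 1 then 3 else 1.

Lemma load_inj p q : p \in exit_pairs -> q \in exit_pairs -> phi p = phi q ->
  third col p.1 = third col q.1 -> p = q.
Proof.
case: p q => [e v] [f w] /exit_pairsP[eO vK _] /exit_pairsP[fO wK _] /= eqm eqt.
have vw : v = w by apply: (inv_inj (mateK (third col e) pc)); rewrite eqm eqt.
case: (eqVneq e f) => [->|ef]; first by rewrite vw.
by have := hole_disj ll cub oc (OmN eO) (OmN fO) ef vK; rewrite vw wK.
Qed.

(** Cycles with a common exit reach it by edges of different third colours. *)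
Lemma load_le3 w : load w <= 3.
Proof.
rewrite /load -(card_in_imset (f := fun p => third col p.1)); last first.
  move=> p q /setIdP[pP /eqP pw] /setIdP[qP /eqP qw] eqt.
  by apply: load_inj => //; rewrite pw qw.
by apply: leq_trans (max_card _) _; rewrite card_ord.
Qed.

Lemma worth_pos w : 0 < worth w. Proof. by rewrite /worth; case: ifP. Qed.

Lemma sum_worth : \sum_(p in exit_pairs) worth (phi p) <= 3 * #|phi @: exit_pairs|.
Proof.
rewrite (partition_big_imset phi) /= mulnC -sum_nat_const.
apply: leq_sum => w _; rewrite (eq_bigr (fun _ => worth w)); last by move=> p /andP[_ /eqP->].
rewrite sum_nat_const; have -> : #|[pred p | (p \in exit_pairs) && (phi p == w)]| = load w.
  by apply: eq_card => p; rewrite in_set.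
by have := load_le3 w; rewrite /worth; case: eqP => [->|_] //; rewrite muln1.
Qed.

(** Any other cycle with this exit reaches it by a different third colour, and that is a sharing of
    [v] of the corresponding kind. *)
Lemma unshared_load e v : e \in Om -> v \in hole col e -> mate col (third col e) v \notin hole col e ->
  ~~ shared ends col e v -> load (mate col (third col e) v) = 1.
Proof.
move=> eO vK wK nsh; set w := mate col (third col e) v in wK *.
apply: etrans (cards1 (e, v)); apply: eq_card => -[f u]; rewrite in_set in_set1.
have evP : (e, v) \in exit_pairs by apply/exit_pairsP.
apply/idP/eqP => [/andP[fuP /eqP /= uw]|[-> ->]]; last by rewrite evP /= eqxx.
apply/esym/load_inj => //=; apply/eqP/negPn/negP => tt.
case/negP: nsh; apply/existsP; exists (third col f); rewrite eq_sym tt /=.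
move/exit_pairsP: fuP; rewrite uw => -[fO uK wf].
apply/existsP; exists f; rewrite (OmN fO) eqxx wf -/w -uw mateK // uK /= andbT.
by apply: contraNneq tt => ->.
Qed.

(** In a cubic graph the cut of an odd set is odd, and it is not 1; its edges all have the third
    colour and so start at distinct vertices of the cycle. *)
Lemma exits_ge3 e : bridgefree ends -> e \in Om ->
  3 <= #|[set v in hole col e | mate col (third col e) v \notin hole col e]|.
Proof.
move=> bf eO; have ec := OmN eO; have od := hole_odd ll cub oc ec.
have c3 : 3 <= #|cut (hole col e)|.
  have := cut_card (hole col e); have := bf (hole col e).
  case: #|cut _| => [|[|[|n]]] // _ /(congr1 odd); rewrite oddD !oddM od //=.
apply: leq_trans c3 _.
have leave g v : g \in cut (hole col e) -> inc v g -> v \in hole col e ->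
    oth v g \notin hole col e /\ col g = Some (third col e).
  move=> gc vg vK; have oK : oth v g \notin hole col e.
    by move: gc; rewrite (cutP _ vg) vK; case: (_ \in _).
  by split=> //; apply: (hole_leave ll cub oc ec vK).
apply: (leq_card_rel (R := fun g v => inc v g && (v \in hole col e))) => [g|g g' v] gc; last first.
  move=> gc' /andP[vg vK] /andP[vg' _]; have [_ c1] := leave g v gc vg vK.
  by have [_ c2] := leave g' v gc' vg' vK; apply: (pcolP _ _ pc v g g' _ vg vg' c1 c2).
have [v vg vK] : exists2 v, inc v g & v \in hole col e.
  move: (gc); rewrite (cutP _ (inc1 ends g)); case: (boolP ((ends g).1 \in _)) => [vK _|_].
    by exists (ends g).1; rewrite ?inc1.
  by case: (boolP (oth _ _ \in _)) => // vK _; exists (oth (ends g).1 g); rewrite ?inc_oth.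
have [oK gz] := leave g v gc vg vK.
by exists v; rewrite ?vg // in_set vK (mateE pc vg gz).
Qed.

Lemma hole_weight e : bridgefree ends -> e \in Om -> 24 <= 3 * #|hole col e| +
  \sum_(v | (v \in hole col e) && (mate col (third col e) v \notin hole col e))
     worth (mate col (third col e) v).
Proof.
move=> bf eO; have ec := OmN eO; have od := hole_odd ll cub oc ec; have g5 := hole_ge5 ec.
case: (eqVneq #|hole col e| 5) => [K5|n5].
  have exits := pentagon_exits ec K5.
  have sh := shared_le3 ll cub oc ec K5 exits.
  have -> : \sum_(v | (v \in hole col e) && (mate col (third col e) v \notin hole col e))
     worth (mate col (third col e) v) = \sum_(v in hole col e) worth (mate col (third col e) v).
    by apply: eq_bigl => v; case: (boolP (v \in hole col e)) => //= /exits.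
  (* At most three exits are shared, so the exits contribute at least 15 - 6 = 9, on top of 3*5 for
     the pentagon itself. *)
  have : \sum_(v in hole col e) (3 - 2 * shared ends col e v) <=
      \sum_(v in hole col e) worth (mate col (third col e) v).
    apply: leq_sum => v vK; case: (boolP (shared ends col e v)) => [_|ns]; first exact: worth_pos.
    by rewrite /worth (unshared_load eO vK (exits _ vK) ns).
  have -> : \sum_(v in hole col e) (3 - 2 * shared ends col e v) =
      15 - 2 * #|[set v in hole col e | shared ends col e v]|.
    rewrite sumnB; last by move=> v _; case: shared.
    rewrite sum_nat_const K5 -big_distrr /=; congr (_ - 2 * _).
    rewrite -sum1_card big_mkcond [RHS]big_mkcond; apply: eq_bigr => v _.
    by rewrite in_set; case: (v \in hole col e); case: shared.
  rewrite K5; move: #|[set v in _ | _]| sh => k; move: (\sum_(v in _) _) => S; lia.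
have ex3 := exits_ge3 bf eO.
have : \sum_(v | (v \in hole col e) && (mate col (third col e) v \notin hole col e)) 1 <=
  \sum_(v | (v \in hole col e) && (mate col (third col e) v \notin hole col e))
     worth (mate col (third col e) v) by apply: leq_sum => v _; apply: worth_pos.
rewrite sum1dep_card.
move: #|[set v in _ | _]| ex3 => k; move: (\sum_(v | _) _) => S.
by move: #|hole col e| g5 n5 od => q; lia.
Qed.

Lemma card_holes : \sum_(e in Om) #|hole col e| = #|\bigcup_(e in Om) hole col e|.
Proof.
pose F e := if e \in Om then hole col e else set0.
have -> : \bigcup_(e in Om) hole col e = \bigcup_e F e.
  by rewrite big_mkcond; apply: eq_bigr => e _; rewrite /F; case: ifP.
rewrite -sum1_card partition_disjoint_bigcup => [|e f ef].
  rewrite big_mkcond; apply: eq_bigr => e _; rewrite /F.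
  by case: ifP => _; rewrite sum1_card ?cards0.
rewrite /F; case: ifP => eO; last by rewrite -setI_eq0 set0I.
case: ifP => fO; last by rewrite -setI_eq0 setI0.
rewrite disjoint_subset; apply/subsetP => v vK.
exact: (hole_disj ll cub oc (OmN eO) (OmN fO) ef vK).
Qed.

(** The uncoloured edge at a linked end is outside [Om]. If [v] were an exit of a cycle in [Om], the
    connecting edge would have colour [C], so its other end would be linked as well and put that
    cycle outside [Om]. *)
Lemma linked_ends_far v : v \in dlc ->
  (forall e, e \in Om -> v \notin hole col e) /\ v \notin phi @: exit_pairs.
Proof.
move=> vd; have [g [vg gc tg gO]] := unc_at_linked_ends ll cub t ex vd; split=> [e eO|].
  apply: contra gO => vK.
  by rewrite (hole_unc ll cub oc (OmN eO) vK vg gc).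
apply/imsetP => -[[e u] /exit_pairsP[eO uK wK] /= vE].
have vK : v \in hole col g by apply: hole_inside.
have ug : u \notin hole col g.
  apply: (hole_disj ll cub oc (OmN eO) gc) => //; by apply: contraNneq gO => <-.
have uv : v != u by apply: contraNneq ug => <-.
have [k [uk vk kc _ kE]] := mate_edge pc (esym vE) uv.
have tE : third col e = C.
  by rewrite -tg; apply: Some_inj; rewrite -kc; apply: (hole_leave ll cub oc gc vK vk); rewrite kE.
have ud : u \in dlc by rewrite -(mateK C pc u) -tE -vE tE (linked_ends_sym ex).
have [h [uh hc th hO]] := unc_at_linked_ends ll cub t ex ud.
by case/negP: hO; rewrite (hole_unc ll cub oc (OmN eO) uK uh hc).
Qed.

Lemma cnt_sum : unc col = cnt ends col A + (cnt ends col B + cnt ends col C).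
Proof.
have [nAB nAC nBC] := tri_neq t.
rewrite /unc -[LHS](cardsID [set e | third col e == A]); congr (_ + _).
  by apply: eq_card => e; rewrite !inE.
rewrite -[LHS](cardsID [set e | third col e == B]); congr (_ + _); apply: eq_card => e;
  rewrite !inE; case: (col e == None); rewrite ?andbF //= ?andbT;
  case: (triP (third col e) t) => ->; rewrite ?eqxx ?(eq_sym B A) ?(eq_sym C);
  by rewrite ?(negPf nAB) ?(negPf nAC) ?(negPf nBC).
Qed.

Theorem main_bound : bridgefree ends ->
  141 * #|V| <= 3 * #|Z| + 70 * unc col + 141 * (size_of col B + size_of col C).
Proof.
move=> bf; set X := \bigcup_(e in Om) hole col e; set W := phi @: exit_pairs.
have XP v : v \in X -> exists2 e, e \in Om & v \in hole col e by move/bigcupP => [e]; exists e.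
have WP w : w \in W -> exists e v, [/\ e \in Om, v \in hole col e, w = mate col (third col e) v &
    w \notin hole col e].
  by case/imsetP => -[e v] /exit_pairsP[eO vK wK] ->; exists e, v.
have dXW : [disjoint X & W].
  rewrite -setI_eq0; apply/eqP/setP => w; rewrite in_setI in_set0; apply/negP => /andP[/XP[f fO wf]].
  case/WP => e [v [eO vK wE wK]]; rewrite wE in wf wK.
  by case/negP: (Omega_nonadj ll cub t ex eO fO vK wK).
have dXWd : [disjoint X :|: W & linked_ends ends B C col].
  rewrite -setI_eq0; apply/eqP/setP => w; rewrite in_setI in_set0; apply/negP => /andP[+ wd].
  have [far1 far2] := linked_ends_far wd; rewrite in_setU (negPf far2) orbF => /XP[e eO].
  by apply/negP; apply: far1.
have sZ : (X :|: W) :|: (linked_ends ends B C col) \subset Z.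
  apply/subsetP => w; rewrite !in_setU => /orP[/orP[/XP[e eO wK]|/WP[e [v [eO vK wE wK]]]]|wd].
  - by apply: (hole_Z (OmN eO) wK); left.
  - apply: (hole_Z (OmN eO) vK); right; rewrite wE mate_nbr //.
    by apply: contraNneq wK => eqm; rewrite wE eqm.
  - have [g [wg gc _ _]] := unc_at_linked_ends ll cub t ex wd.
    by apply: (hole_Z gc (hole_inside ll cub oc gc wg)); left.
have cZ : #|X| + #|W| + #|dlc| <= #|Z|.
  apply: leq_trans (subset_leq_card sZ); rewrite cardsU (disjoint_setI0 dXWd) cards0 subn0.
  by rewrite cardsU (disjoint_setI0 dXW) cards0 subn0.
have c24 : 24 * #|Om| <= 3 * #|X| + 3 * #|W|.
  apply: leq_trans (leq_add (leqnn _) sum_worth).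
  rewrite -card_holes big_distrr /= mulnC -sum_nat_const.
  have -> : \sum_(p in exit_pairs) worth (phi p) = \sum_(e in Om)
      \sum_(v | (v \in hole col e) && (mate col (third col e) v \notin hole col e))
         worth (mate col (third col e) v).
    rewrite pair_big_dep; apply: eq_bigl => -[e v] /=.
    by apply/exit_pairsP/and3P => -[].
  by rewrite -big_split; apply: leq_sum => e eO; apply: hole_weight.
pose D := [set e | (col e == None) && ((third col e == C) && linked ends B C col e)].
have cD : #|D| <= #|dlc|.
  apply: (leq_card_rel (R := fun e u => inc u e && (u \in dlc))) => [e|e e' u].
    by rewrite inE => /and3P[_ _ /existsP[u /andP[ue ud]]]; exists u; rewrite ?ue.
  rewrite !inE => /andP[/eqP ec _] /andP[/eqP ec' _] /andP[ue _] /andP[ue' _].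
  exact: (opt_unc_uniq ll cub oc ue).
have cOD : #|Om| + #|D| = unc col.
  rewrite /unc -[RHS](cardsID D) addnC; congr (_ + _); apply: eq_card => e; rewrite !inE.
    by case: (col e == None).
  by case: (col e == None); rewrite ?andbT ?andbF.
have cCD : #|[set e in Om | third col e == C]| + #|D| = cnt ends col C.
  rewrite /cnt -[RHS](cardsID D) addnC; congr (_ + _); apply: eq_card => e; rewrite !inE;
    by case: (col e == None); case: (third col e == C); rewrite ?andbT ?andbF.
have cB := cnt_Omega ll cub t ex.
have zA := size_cnt ll cub A oc; have zB := size_cnt ll cub B oc; have zC := size_cnt ll cub C oc.
have sAB : size_of col A <= size_of col B by have [_ m _ _] := ex; apply: m.
have cs := cnt_sum.
move: (cnt ends col A) (cnt ends col B) (cnt ends col C) (unc col) (size_of col A) (size_of col B)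
  (size_of col C) #|Om| #|D| #|dlc| #|X| #|W| #|Z| #|V| #|[set e in Om | third col e == C]|
  zA zB zC sAB cs cB cOD cCD cD c24 cZ => *.
(* With [k] the number of cycles in [Om] of third colour [C], the facts collected give #|Z| >= 8(a +
   b + k) + (c - k) >= 8a + 15b + c. By [size_cnt] the claim is 6 #|Z| >= 142a + b + c, which
   follows from a <= b <= c as 89b + 5c >= 94a. *)
lia.
Qed.

End Count.

End Weights.
End Girth.
End Main.

(** * Contracting three vertices *)

Section Contract.
Variables (V E : finType) (ends : E -> V * V) (S : {set V}).
Local Notation inc := (incident ends).
Hypotheses (ll : loopless ends) (cub : cubic ends) (bf : bridgefree ends).
Hypotheses (S3 : #|S| = 3) (iS : #|inside ends S| = 3).
Local Notation bd := (cut ends).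
Local Notation inside := (inside ends).

(** [None] is the vertex to which [S] is contracted. *)
Definition quotV : finType := option {x : V | x \notin S}.
Definition quotE : finType := {e : E | e \notin inside S}.
Definition contract (x : V) : quotV := insub x.
Definition quot_ends (e : quotE) : quotV * quotV := (contract (ends (val e)).1, contract (ends (val e)).2).
Local Notation inc' := (incident quot_ends).

Lemma contract_in x : x \in S -> contract x = None.
Proof. by move=> xS; rewrite /contract insubN // xS. Qed.

Lemma contract_eq x y : x \notin S -> (contract x == contract y) = (x == y).
Proof.
move=> xS; rewrite /contract (insubT (fun x => x \notin S) xS).
case: insubP => [u uS <-|]; first by rewrite (inj_eq (@Some_inj _)) -val_eqE.
by rewrite negbK => yS; apply/esym/negbTE; apply: contraNneq xS => ->.
Qed.

Lemma contract_None x : (None == contract x) = (x \in S).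
Proof. by rewrite /contract; case: insubP => [u /negPf-> _|] //; rewrite negbK => ->. Qed.

Lemma contract_val (u : {x : V | x \notin S}) : contract (val u) = Some u.
Proof. by rewrite /contract valK. Qed.

Lemma inc_Some (u : {x : V | x \notin S}) e : inc' (Some u) e = inc (val u) (val e).
Proof. by rewrite /incident /= -!contract_val !contract_eq // (valP u). Qed.

Lemma quotE_cut (e : quotE) : (val e \in bd S) = touches ends S (val e).
Proof.
have := valP e; rewrite /touches !in_set /=.
by case: (_ \in S); case: (_ \in S).
Qed.

Lemma inc_None e : inc' None e = (val e \in bd S).
Proof. by rewrite quotE_cut /incident /= !contract_None. Qed.

Lemma out_cE x e : x \notin S -> inc x e -> e \notin inside S.
Proof. by move=> xS xe; rewrite (insideP _ xe) (negPf xS). Qed.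

Lemma cut_cE e : e \in bd S -> e \notin inside S.
Proof. by rewrite !in_set; case: (_ \in S); case: (_ \in S). Qed.

Lemma card_cE (Q : pred E) : #|[set e : quotE | Q (val e)]| = #|[set e | (e \notin inside S) && Q e]|.
Proof.
rewrite -(card_imset _ val_inj); apply: eq_card => e; rewrite in_set.
apply/imsetP/andP => [[e' + ->]|[eS Qe]]; first by rewrite in_set (valP e').
by exists (Sub e eS); rewrite ?in_set SubK.
Qed.

(** From 9 = 2*3 + 3; this keeps the contracted graph cubic. *)
Lemma cut3 : #|bd S| = 3.
Proof. by have := cut_card ll cub S; rewrite S3 iS; move: #|_| => n; lia. Qed.

Lemma cloopless : loopless quot_ends.
Proof.
move=> e; rewrite /= ; have := valP e; rewrite in_set negb_and => /orP[] nS.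
  by rewrite contract_eq //; apply: ll.
by rewrite eq_sym contract_eq // eq_sym; apply: ll.
Qed.

Lemma ccubic : cubic quot_ends.
Proof.
move=> [u|]; rewrite /degree.
  rewrite -[RHS](cub (val u)) /degree.
  rewrite (eq_card (B := [set e : quotE | inc (val u) (val e)])).
    rewrite card_cE; apply: eq_card => e; rewrite [LHS]in_set [RHS]in_set.
    by case ue: (inc (val u) e); rewrite ?andbF // (out_cE (valP u) ue).
  by move=> e; rewrite [LHS]in_set inc_Some [RHS]in_set.
rewrite -cut3 (eq_card (B := [set e : quotE | val e \in bd S])).
  rewrite card_cE; apply: eq_card => e; rewrite [LHS]in_set.
  by rewrite andb_idl // => /cut_cE.
by move=> e; rewrite [LHS]in_set inc_None [RHS]in_set.
Qed.

Lemma cbridgefree : bridgefree quot_ends.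
Proof.
move=> X; pose Y := [set x | contract x \in X].
have -> : cut quot_ends X = [set e : quotE | val e \in bd Y].
  by apply/setP => e; rewrite !inE.
rewrite card_cE.
suff -> : [set e | (e \notin inside S) && (e \in bd Y)] = bd Y by apply: bf.
apply/setP => e; rewrite [LHS]in_set andb_idl // => eY; apply: contraL eY.
by rewrite in_set => /andP[e1 e2]; rewrite /Y !in_set !contract_in ?eqxx.
Qed.

Lemma card_cV : #|quotV|.+2 = #|V|.
Proof.
rewrite card_option card_sig -(cardsC S) S3 -add3n; congr (3 + _).
by apply: eq_card => x; rewrite !inE.
Qed.

Lemma card_cEE : #|E| = #|quotE| + 3.
Proof.
rewrite -iS -(cardsC (inside S)) addnC; congr (_ + _).
by rewrite card_sig; apply: eq_card => x; rewrite !inE.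
Qed.

Definition restr (C : finType) (col : {ffun E -> option C}) : {ffun quotE -> option C} :=
  [ffun e => col (val e)].

Lemma unc_restr (C : finType) (col : {ffun E -> option C}) :
  unc col = unc (restr col) + #|[set e in inside S | col e == None]|.
Proof.
rewrite /unc -(cardsID (inside S)) addnC; congr (_ + _).
  rewrite -[RHS](_ : #|[set e : quotE | col (val e) == None]| = _); last first.
    by apply: eq_card => e; rewrite [LHS]in_set [RHS]in_set ffunE.
  by rewrite (card_cE (fun e => col e == None)); apply: eq_card => e; rewrite in_setD !in_set.
by apply: eq_card => e; rewrite in_setI !in_set andbC.
Qed.

Lemma pcol_restr (C : finType) (col : {ffun E -> option C}) u :
  pcol ends col -> pcol_at quot_ends (restr col) (Some u).
Proof.
move=> pc; apply/pcol_atP => e f c; rewrite !inc_Some !ffunE => ue uf ec fc.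
by apply: val_inj; apply: (pcolP _ _ pc _ _ _ c ue uf).
Qed.

(** * Colourings with three colours under contraction *)

Section Restrict.
Variable col : {ffun E -> option 'I_3}.
Hypothesis pc : pcol ends col.

Lemma bd_third e f : e \in bd S -> f \in bd S -> e != f ->
  exists g, [/\ g \in bd S, g != e, g != f & bd S = [set e; f; g]].
Proof.
move=> eb fb ef; have : #|bd S :\ e :\ f| = 1.
  have := cut3; rewrite (cardsD1 e) eb (cardsD1 f (_ :\ e)) in_setD1 fb eq_sym ef.
  by rewrite !add1n => -[].
move/eqP/cards1P => [g gE]; have := set11 g; rewrite -gE !in_setD1 => /and3P[gf ge gb].
exists g; split=> //; apply/setP => h; rewrite !in_setU !in_set1.
apply/idP/idP => [hb|]; last by case/orP => [/orP[]|] /eqP->.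
case: (eqVneq h e) => //= he; case: (eqVneq h f) => //= hf.
by rewrite -in_set1 -gE !in_setD1 he hf.
Qed.

(** Suppose all inside edges are coloured. A colour other than [x] that is not on the third boundary
    edge [g] has an even number of ends in [S], so some vertex of the three misses it and has an
    uncoloured edge, which must be [g]. Then this applies to both colours other than [x], at the
    single end of [g] in [S], which would need two uncoloured edges. *)
Lemma inside_unc e f x : e \in bd S -> f \in bd S -> e != f -> col e = Some x -> col f = Some x ->
  exists2 g, g \in inside S & col g = None.
Proof.
move=> eb fb ef ec fc; have [g [gb ge gf bE]] := bd_third eb fb ef.
case: (boolP [exists h, (h \in inside S) && (col h == None)]) => [/existsP[h /andP[hi /eqP hc]]|N].
  by exists h.
exfalso; have {}N h : h \in inside S -> col h <> None.
  by move=> hi hc; case/negP: N; apply/existsP; exists h; rewrite hi hc eqxx.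
have atg h p : p \in S -> inc p h -> col h = None -> h = g.
  move=> pS ph hc; have hb : h \in bd S.
    rewrite (cutP _ ph) pS; case: (boolP (oth ends p h \in S)) => // oS.
    by case: (N h) => //; rewrite (insideP _ ph) pS.
  by move: hb; rewrite bE !inE; case/orP => [/orP[]|] /eqP hE //; rewrite -hE hc in ec fc.
have key z : z != x -> col g <> Some z -> exists p, [/\ p \in S, ~~ sees ends col z p, inc p g & col g = None].
  move=> zx gz; case: (boolP [exists p in S, ~~ sees ends col z p]) => [/exists_inP[p pS nz]|all].
    have [h [ph hc]] := miss_exunc cub pc nz; exists p; have hg := atg h p pS ph hc.
    by rewrite -hg.
  exfalso; pose F := [set h | col h == Some z].
  have := cut_cardF ll F S; have -> : bd S :&: F = set0.
    apply/setP => h; rewrite in_setI in_set0 bE !inE; apply/negP => /andP[+ /eqP hz].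
    case/orP => [/orP[]|]/eqP hE; rewrite hE in hz => //.
      by move: hz; rewrite ec => -[xz]; rewrite xz eqxx in zx.
    by move: hz; rewrite fc => -[xz]; rewrite xz eqxx in zx.
  rewrite cards0 addn0 (eq_bigr (fun _ => 1)).
    by rewrite sum1_card S3 => /(congr1 odd); rewrite oddM.
  move=> p pS; have /seesP[h ph hz] : sees ends col z p.
    case: (boolP (sees ends col z p)) => // nz.
    by case/exists_inP: all; exists p.
  apply: etrans (cards1 h); apply: eq_card => h'; rewrite !inE.
  apply/idP/eqP => [/andP[/eqP h'z ph']|->]; last by rewrite hz eqxx ph.
  exact: (pcolP _ _ pc p h' h z).
have [z [zx gz]] : exists z, z != x /\ col g <> Some z.
  have : 0 < #|~: [set x; odflt x (col g)]|.
    by rewrite cardsCs setCK card_ord cards2; case: (_ != _).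
  case/card_gt0P => z; rewrite !inE negb_or => /andP[zx zg]; exists z; split=> //.
  by move=> gz; rewrite gz eqxx in zg.
have [p [pS nz pg gN]] := key z zx gz.
have [z2 t] := tri_ex zx; have [_ zz2 xz2] := tri_neq t.
have z2x : z2 != x by rewrite eq_sym.
have [|p2 [p2S nz2 p2g _]] := key z2 z2x; first by rewrite gN.
have pp : p2 = p.
  apply/eqP/negPn/negP => pp; have := gb; rewrite (cutP _ pg) pS -(inc_eq pg p2g pp) p2S.
  by rewrite eqxx.
rewrite pp in nz2.
have : 1 < #|[set h | inc p h && (col h == None)]|.
  by rewrite -miss_unc //; apply/card_gt1P; exists z, z2; rewrite !inE nz nz2 zz2.
case/card_gt1P => h [h' []]; rewrite !inE => /andP[ph /eqP hc] /andP[ph' /eqP h'c].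
by rewrite (atg h p) // (atg h' p) // eqxx.
Qed.

Lemma uncolour_boundary (c2 : {ffun quotE -> option 'I_3}) (b : quotE) :
  (forall u, pcol_at quot_ends c2 (Some u)) ->
  (forall (e f : quotE) c, val e \in bd S -> val f \in bd S -> e != b -> f != b ->
     c2 e = Some c -> c2 f = Some c -> e = f) ->
  exists2 col' : {ffun quotE -> option 'I_3}, pcol quot_ends col' & unc col' <= (unc c2).+1.
Proof.
move=> pS pN; pose col' : {ffun quotE -> option 'I_3} := [ffun e => if e == b then None else c2 e].
have c'E e c : col' e = Some c -> e != b /\ c2 e = Some c by rewrite ffunE; case: eqP.
exists col'.
  apply/forallP => -[u|]; apply/pcol_atP => e f c ue uf /c'E[eb ec] /c'E[fb fc].
    exact: (pcol_atP _ _ _ (pS u) e f c).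
  by rewrite !inc_None in ue uf; apply: (pN e f c).
rewrite /unc (cardsD1 b) -[leqRHS]add1n; apply: leq_add; first by case: (_ \in _).
apply/subset_leq_card/subsetP => e; rewrite !inE ffunE => /andP[/negPf->] //.
Qed.

(** The chains of colours [x], [y] outside [S] join the outer ends of the three boundary edges in
    pairs; three being odd, one chain [Q] meets only one of them. Switching [Q] then changes the
    colour of exactly one boundary edge. *)
Lemma exit_alone x y : (forall e, e \in bd S -> col e = Some x) -> x != y ->
  exists Q : {set V}, [/\ (forall v, v \in Q -> v \notin S),
    (forall v, v \in Q -> mate ends col y v \in Q),
    (forall v, v \in Q -> mate ends col x v \in S \/ mate ends col x v \in Q) &
    exists2 e, e \in bd S & forall f, f \in bd S -> touches ends Q f = (f == e)].
Proof.
move=> mono xy; set s := cutmate ends col x S; set t := mate ends col y.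
have sK : involutive s by apply: cutmateK.
have tK : involutive t by apply: mateK.
pose W := [set v | (v \notin S) && (mate ends col x v \in S)].
have bdP e : e \in bd S -> exists p, [/\ inc p e, p \in S, oth ends p e \in W & oth ends p e \notin S].
  move=> eb; have [p pe pS] : exists2 p, inc p e & p \in S.
    move: (eb); rewrite (cutP _ (inc1 ends e)); case: (boolP ((ends e).1 \in S)) => [pS _|_].
      by exists (ends e).1; rewrite ?inc1.
    by case: (boolP (_ \in S)) => // pS _; exists (oth ends (ends e).1 e); rewrite ?inc_oth.
  have nS : oth ends p e \notin S by move: (eb); rewrite (cutP _ pe) pS; case: (_ \in S).
  exists p; split=> //; rewrite in_set nS.
  by rewrite (mateE pc (inc_oth ends p e) (mono e eb)) othK.
have WP v : v \in W -> exists e, [/\ e \in bd S, inc v e, oth ends v e \in S & v \notin S].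
  rewrite in_set => /andP[vS mS].
  have mv : mate ends col x v != v by apply: contraNneq vS => <-.
  have [g [vg _ _ gE _]] := mate_edge pc (erefl _) mv; exists g; split=> //; last by rewrite gE.
  by rewrite (cutP _ vg) (negPf vS) gE mS.
have W3 : #|W| = 3.
  rewrite -cut3; apply/eqP; rewrite eqn_leq; apply/andP; split.
    apply: (leq_card_rel (R := fun v e => inc v e && (e \in bd S))) => [v|v v' e] vW; last first.
      have [_ [_ _ _ vS]] := WP v vW => /WP[_ [_ _ _ v'S]] /andP[ve eb] /andP[v'e _].
      apply/esym/eqP/negPn/negP => vv; have v'E := inc_eq ve v'e vv.
      by move: eb; rewrite (cutP _ ve) (negPf vS) -v'E (negPf v'S).
    by have [e [eb ve _ _]] := WP v vW; exists e; rewrite ?ve.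
  apply: (leq_card_rel (R := fun e v => inc v e && (v \in W))) => [e|e e' v] eb.
    by have [p [pe pS oW _]] := bdP e eb; exists (oth ends p e); rewrite ?inc_oth.
  move=> e'b /andP[ve _] /andP[ve' _].
  exact: (pcolP _ _ pc v e e' x ve ve' (mono e eb) (mono e' e'b)).
have [v vW alone] : exists2 v, v \in W & forall w, w \in W -> w \in dorb s t v -> w = v.
  case: (boolP [exists v in W, [forall w in W, (w \in dorb s t v) ==> (w == v)]]).
    case/exists_inP => v vW /forall_inP al; exists v => // w wW wv.
    by apply/eqP; move/implyP: (al w wW); apply.
  move=> nal; exfalso; suff : ~~ odd #|W| by rewrite W3.
  have sW v : v \in W -> s v = v by rewrite in_set /s /cutmate => /andP[_ ->]; rewrite orbT.
  apply: (@even_invol _ _ (dother s t)) => v vW.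
  have [w wW [wv nwv]] : exists2 w, w \in W & w \in dorb s t v /\ w != v.
    move/exists_inPn: nal => /(_ v vW) /forall_inPn[w wW]; rewrite negb_imply => /andP[h1 h2].
    by exists w.
  have wE : w = dother s t v.
    by apply: (dend_other sK tK (sW v vW)) => //; rewrite /dend (sW w wW) eqxx.
  rewrite -wE; split=> //; apply/esym/(dend_other sK tK (sW w wW)).
  - by rewrite (dorb_eq sK tK wv) dorb_refl.
  - by rewrite /dend (sW v vW) eqxx.
  - by rewrite eq_sym.
have QS : dorb s t v \subset ~: S.
  apply: dorb_min => [|w]; rewrite !in_setC.
    by move: vW; rewrite in_set => /andP[].
  move=> wS; split; first by rewrite /s /cutmate; case: ifPn => //; rewrite negb_or => /andP[].
  apply/negP => tS; have tw : t w != w by apply: contraNneq wS => <-.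
  have [g [wg _ gy gE _]] := mate_edge pc (erefl _) tw.
  have gb : g \in bd S by rewrite (cutP _ wg) gE tS (negPf wS).
  by have := mono g gb; rewrite gy => -[yx]; rewrite yx eqxx in xy.
have QS' w : w \in dorb s t v -> w \notin S by move/(subsetP QS); rewrite in_setC.
exists (dorb s t v); split=> //.
- by move=> w; apply: dorb_t.
- move=> w wQ; have := dorb_s wQ; rewrite /s /cutmate (negPf (QS' w wQ)) /=.
  by case: ifP => [mS _|_ h]; [left|right].
have [e [eb ve _ _]] := WP v vW; exists e => // f fb.
have [p [pf pS oW oS]] := bdP f fb.
rewrite (touchesP _ pf) (_ : p \in dorb s t v = false); last first.
  by apply/negbTE/negP => /QS'; rewrite pS.
apply/idP/eqP => [oQ|fe]; last first.
  have vp : v != p by apply: contraTneq vW => ->; rewrite in_set pS.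
  by rewrite fe in pf *; rewrite -(inc_eq pf ve vp) dorb_refl.
have vE := alone _ oW oQ.
by apply: (pcolP _ _ pc v f e x _ ve (mono f fb) (mono e eb)); rewrite -vE inc_oth.
Qed.

(** The restriction fails only if two boundary edges have equal colours. In that case an inside edge
    is uncoloured and is lost by contraction, which pays for uncolouring one boundary edge. If all
    three boundary edges agree, a switch from [exit_alone] first makes one of them different. *)
Lemma contract_unc : exists2 col' : {ffun quotE -> option 'I_3}, pcol quot_ends col' & unc col' <= unc col.
Proof.
have le1 := unc_restr col.
case: (boolP [exists e in bd S, exists f in bd S, [&& e != f, col e == col f & col e != None]]); last first.
  move=> N; exists (restr col); last by rewrite le1 leq_addr.
  apply/forallP => -[u|]; first exact: pcol_restr.
  apply/pcol_atP => e f c; rewrite !inc_None !ffunE => eb fb ec fc.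
  apply: val_inj; apply/eqP/negPn/negP => ef; case/exists_inP: N; exists (val e) => //.
  by apply/exists_inP; exists (val f); rewrite // ef ec fc eqxx.
case/exists_inP => e eb /exists_inP[f fb /and3P[ef /eqP efc]].
case ec: (col e) => [x|] // _; rewrite ec in efc.
have [h hi hc] := inside_unc eb fb ef ec (esym efc).
have ltk : (unc (restr col)).+1 <= unc col.
  rewrite le1 -addn1 leq_add2l; apply/card_gt0P; exists h; by rewrite in_set hi hc eqxx.
have [g [gb ge gf bE]] := bd_third eb fb ef.
have cb k (kb : k \in bd S) : k \notin inside S := cut_cE kb.
pose b e' (k : e' \in bd S) : quotE := Sub e' (cb e' k).
suff [c2 [p2 u2 [b0 b2]]] : exists c2 : {ffun quotE -> option 'I_3},
    [/\ forall u, pcol_at quot_ends c2 (Some u), unc c2 = unc (restr col) &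
      exists b0 : quotE, forall (e f : quotE) c, val e \in bd S -> val f \in bd S -> e != b0 -> f != b0 ->
     c2 e = Some c -> c2 f = Some c -> e = f].
  have [col' pc' uc'] := uncolour_boundary p2 b2; exists col' => //.
  by apply: leq_trans uc' _; rewrite u2.
have two (b0 k1 k2 : E) (c2 : quotE -> option 'I_3) (bb0 : b0 \in bd S) (bk1 : k1 \in bd S) (bk2 : k2 \in bd S) :
    bd S = [set b0; k1; k2] -> (c2 (b k1 bk1) != c2 (b k2 bk2)) ->
    forall (e f : quotE) c, val e \in bd S -> val f \in bd S -> e != b b0 bb0 -> f != b b0 bb0 ->
     c2 e = Some c -> c2 f = Some c -> e = f.
  move=> b3 nc p q c pb qb pn qn pcc qcc.
  have cs r : val r \in bd S -> r != b b0 bb0 -> r = b k1 bk1 \/ r = b k2 bk2.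
    rewrite {1}b3 !inE -(inj_eq val_inj) SubK => rb /negPf rn; move: rb; rewrite rn /=.
    by case/orP => /eqP rE; [left|right]; apply: val_inj; rewrite SubK.
  case: (cs p pb pn) (cs q qb qn) => pE [] qE; rewrite pE qE // in pcc qcc *;
    by rewrite pcc qcc eqxx in nc.
case: (boolP (col g == Some x)) => [/eqP gx|gx]; last first.
  exists (restr col); split=> //; first by move=> u; apply: pcol_restr.
  exists (b e eb); apply: (two e f g _ eb fb gb) => //.
  by rewrite !ffunE !SubK -efc eq_sym.
have mono k : k \in bd S -> col k = Some x.
  by rewrite bE !inE; case/orP => [/orP[]|] /eqP->.
have [y xy] : exists y, x != y.
  by exists (if x == ord0 then ord_max else ord0); case: (x =P ord0) => [->|/eqP].
have [Q [QS Qy Qx [e1 e1b tE]]] := exit_alone mono xy.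
pose c2 : {ffun quotE -> option 'I_3} :=
  [ffun k => if touches ends Q (val k) then swapo x y (col (val k)) else col (val k)].
exists c2; split.
- move=> u; apply/pcol_atP => k k' c; rewrite !inc_Some => uk uk'.
  have uS := valP u; case: (boolP (val u \in Q)) => uQ.
    rewrite !ffunE (touchesP _ uk) (touchesP _ uk') uQ /= => kc k'c.
    have := swapoK x y (col (val k)); have := swapoK x y (col (val k')); rewrite kc k'c.
    case cc: (swapo x y (Some c)) => [c'|]; last by move/eqP: cc; rewrite swapo_None.
    move=> k1c k2c; apply: val_inj.
    exact: (pcolP _ _ pc (val u) _ _ c' uk uk' (esym k2c) (esym k1c)).
  have same r : inc (val u) (val r) -> c2 r = col (val r).
    move=> ur; rewrite ffunE (touchesP _ ur) (negPf uQ) /=; case: ifP => // oQ.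
    rewrite /swapo; case: (col (val r) =P Some x) => [rx|_].
      have mu := mateE pc (inc_oth ends (val u) (val r)) rx; rewrite othK // in mu.
      by case: (Qx _ oQ); rewrite mu ?(negPf uS) ?(negPf uQ).
    case: (col (val r) =P Some y) => [ry|//].
    have mu := mateE pc (inc_oth ends (val u) (val r)) ry; rewrite othK // in mu.
    by have := Qy _ oQ; rewrite mu (negPf uQ).
  rewrite !same // => kc k'c; apply: val_inj.
  exact: (pcolP _ _ pc (val u) _ _ c uk uk').
- by apply: eq_card => k; rewrite [LHS]in_set [RHS]in_set !ffunE; case: ifP => // _; rewrite swapo_None.
have c2E k (kb : k \in bd S) : c2 (b k kb) = Some (if k == e1 then y else x).
  by rewrite ffunE SubK tE // mono //; case: eqP => // _; rewrite swapox.
case: (eqVneq e1 e) => [e1e|e1e].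
  exists (b f fb); apply: (two f e g _ fb eb gb); first by rewrite bE [[set f; e]]setUC.
  by rewrite !c2E e1e eqxx (negPf ge) (inj_eq (@Some_inj _)) eq_sym.
case: (eqVneq e1 f) => [e1f|e1f].
  exists (b e eb); apply: (two e f g _ eb fb gb) => //.
  by rewrite !c2E e1f eqxx (negPf gf) (inj_eq (@Some_inj _)) eq_sym.
have e1g : e1 = g.
  by move: e1b; rewrite bE !inE (negPf e1e) (negPf e1f) => /eqP.
exists (b e eb); apply: (two e f g _ eb fb gb) => //.
have fg : (f == g) = false by rewrite eq_sym (negPf gf).
by rewrite !c2E e1g eqxx fg (inj_eq (@Some_inj _)).
Qed.

End Restrict.
End Contract.

(** * Colourable subgraphs under contraction *)

Section Nu.
Variables (V E : finType) (ends : E -> V * V) (k : nat).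
Local Notation inc := (incident ends).

Lemma unc_colored (C : finType) (col : {ffun E -> option C}) :
  #|[set e | col e != None]| + unc col = #|E|.
Proof.
by rewrite addnC -(cardsC [set e | col e == None]); congr (_ + _); apply: eq_card => e; rewrite !inE.
Qed.

(** With [nu_ex] this identifies [#|E| - nu] with the least number of uncoloured edges. The
    successor provides a default colour for the edges outside the subgraph. *)
Lemma nu_ge (col : {ffun E -> option 'I_k.+1}) : pcol ends col -> #|E| <= nu ends k.+1 + unc col.
Proof.
move=> pc; rewrite -(unc_colored col) leq_add2r; apply: leq_bigmax_cond.
apply/existsP; exists [ffun e => odflt ord0 (col e)].
apply/forall_inP => e; rewrite inE => ec; apply/forall_inP => f; rewrite inE => fc.
apply/implyP => /andP[ef /existsP[v /andP[ve vf]]]; apply: contraNneq ef.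
rewrite !ffunE; case ee: (col e) ec => [c|] // _; case ff: (col f) fc => [d|] // _ /= cd.
by apply/eqP; apply: (pcolP _ _ pc v e f c); rewrite // ff cd.
Qed.

Lemma nu_ex : exists2 col : {ffun E -> option 'I_k.+1}, pcol ends col & nu ends k.+1 + unc col = #|E|.
Proof.
have c0 : k_edge_colorable ends k.+1 set0.
  by apply/existsP; exists [ffun => ord0]; apply/forall_inP => e; rewrite inE.
have ne : 0 < #|[pred F : {set E} | k_edge_colorable ends k.+1 F]|.
  by apply/card_gt0P; exists set0; rewrite inE.
have [F /= /existsP[c /forall_inP cF] nuE] := eq_bigmax_cond (fun F : {set E} => #|F|) ne.
pose col : {ffun E -> option 'I_k.+1} := [ffun e => if e \in F then Some (c e) else None].
exists col.
  apply/pcolP => v e f b ve vf; rewrite !ffunE; case: ifP => // eF [ec]; case: ifP => // fF [fc].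
  apply/eqP/negPn/negP => ef; move/forall_inP: (cF e eF) => /(_ f fF)/implyP.
  rewrite ef ec fc eqxx; case/(_ _)/negP => //=; apply/existsP; exists v; by rewrite ve vf.
rewrite -(unc_colored col); congr (_ + _); apply: etrans nuE _.
by apply: eq_card => e; rewrite inE ffunE; case: ifP.
Qed.

End Nu.

(** Read backwards, [c] is a partial injection from the two colours to the three classes, and it is
    extended to a total one. *)
Lemma complete_colors (c : 'I_3 -> option 'I_2) :
  (forall i j b, c i = Some b -> c j = Some b -> i = j) ->
  exists2 f : 'I_2 -> 'I_3, injective f & forall i b, c i = Some b -> f b = i.
Proof.
move=> cI; pose b0 : 'I_2 := ord0; pose b1 : 'I_2 := ord_max.
have bP (b : 'I_2) : b = b0 \/ b = b1.
  by case: b => -[|[|//]] ?; [left|right]; apply: val_inj.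
suff [p0 [p1 [p01 h0 h1]]] : exists p0 p1 : 'I_3, [/\ p0 != p1, forall i, c i = Some b0 -> i = p0 &
    forall i, c i = Some b1 -> i = p1].
  exists (fun b => if b == b0 then p0 else p1).
    by move=> b b'; case: (bP b) => ->; case: (bP b') => -> //= /eqP; rewrite ?(negPf p01) // eq_sym (negPf p01).
  by move=> i b; case: (bP b) => -> /= ci; [rewrite (h0 i)|rewrite (h1 i)].
have other (p : 'I_3) : exists q : 'I_3, p != q.
  by exists (if p == ord0 then ord_max else ord0); case: (p =P ord0) => [->|/eqP].
case: (pickP (fun i => c i == Some b0)) => [p0 /eqP c0|N0];
  case: (pickP (fun i => c i == Some b1)) => [p1 /eqP c1|N1].
- exists p0, p1; split; [|by move=> i /cI; apply|by move=> i /cI; apply].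
  by apply: contraTneq isT => eqp; move: c1; rewrite -eqp c0.
- have [q pq] := other p0; exists p0, q; split=> // i; first by move/cI; apply.
  by move/eqP; rewrite N1.
- have [q pq] := other p1; exists q, p1; split; rewrite 1?eq_sym // => i; last by move/cI; apply.
  by move/eqP; rewrite N0.
- have [q pq] := other ord0; exists ord0, q; split=> // i /eqP; by rewrite ?N0 ?N1.
Qed.

Section ContractTwo.
Variables (V E : finType) (ends : E -> V * V) (S : {set V}).
Local Notation inc := (incident ends).
Hypotheses (ll : loopless ends) (cub : cubic ends).
Hypotheses (S3 : #|S| = 3) (iS : #|inside ends S| = 3).
Local Notation bd := (cut ends).
Local Notation inside := (inside ends).
Local Notation quotE := (quotE ends S).
Local Notation quot_ends := (quot_ends (ends := ends) (S := S)).

(* The two shapes of [S] that get contracted, a triangle and a digon with a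
   pendant vertex, only enter through this 3-edge-colouring of the edges at [S]. *)
Variable lam : E -> 'I_3.
Hypotheses (lamS : forall p e f, p \in S -> inc p e -> inc p f -> lam e = lam f -> e = f)
  (lamB : {in bd S &, injective lam}) (lamI : {in inside S &, injective lam}).

(** The coloured boundary edges lie in distinct classes of [lam], so the two colours can be
    identified with two of the classes without changing the boundary. There is one inside edge in
    each class, and two of the three receive a colour. *)
Lemma contract_two (col' : {ffun quotE -> option 'I_2}) : pcol quot_ends col' ->
  exists2 col : {ffun E -> option 'I_2}, pcol ends col & unc col <= (unc col').+1.
Proof.
move=> pc'; pose c i := if [pick e : quotE | (val e \in bd S) && (lam (val e) == i)] is Some e
  then col' e else None.
have cB (e : quotE) : val e \in bd S -> c (lam (val e)) = col' e.
  move=> eb; rewrite /c; case: pickP => [f /andP[fb /eqP ff]|/(_ e)]; last by rewrite eb eqxx.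
  by congr (col' _); apply: val_inj; apply: lamB.
have cI i j b : c i = Some b -> c j = Some b -> i = j.
  rewrite /c; case: pickP => // e /andP[eb /eqP <-] ec; case: pickP => // f /andP[fb /eqP <-] fc.
  congr (lam (val _)); apply: (pcolP _ _ pc' None e f b); rewrite ?inc_None //.
have [f fI fc] := complete_colors cI.
pose d i := [pick b | f b == i].
have dP i b : d i = Some b -> f b = i.
  by rewrite /d; case: pickP => // b' /eqP <- [->].
have dE i b : f b = i -> d i = Some b.
  move=> <-; rewrite /d; case: pickP => [b' /eqP/fI->|/(_ b)] //; by rewrite eqxx.
pose col : {ffun E -> option 'I_2} :=
  [ffun e => if insub e is Some e' then col' e' else d (lam e)].
have colO (e : quotE) : col (val e) = col' e by rewrite ffunE valK.
have colI e : e \in inside S -> col e = d (lam e).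
  by move=> ei; rewrite ffunE insubN // negbK.
have colS p e b : p \in S -> inc p e -> col e = Some b -> d (lam e) = Some b.
  move=> pS pe; case: (boolP (e \in inside S)) => ei; first by rewrite colI.
  have eb : e \in bd S.
    by rewrite (cutP _ pe) pS; move: ei; rewrite (insideP _ pe) pS; case: (_ \in S).
  have [e' eE] : exists e' : quotE, val e' = e by exists (Sub e ei).
  by rewrite -eE colO in eb * => ec; apply: dE; apply: fc; rewrite cB.
exists col.
  apply/pcolP => v e g b ve vg ec gc; case: (boolP (v \in S)) => vS.
    apply: (lamS vS ve vg).
    by rewrite -(dP _ _ (colS v e b vS ve ec)) -(dP _ _ (colS v g b vS vg gc)).
  have eO := out_cE vS ve; have gO := out_cE vS vg.
  have [e' eE] : exists e' : quotE, val e' = e by exists (Sub e eO).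
  have [g' gE] : exists g' : quotE, val g' = g by exists (Sub g gO).
  rewrite -eE -gE !colO in ec gc ve vg *.
  by congr (val _); apply: (pcolP _ _ pc' (Some (Sub v vS)) _ _ b); rewrite ?inc_Some ?SubK.
rewrite (unc_restr ends S) (_ : restr ends S col = col'); last first.
  by apply/ffunP => e; rewrite ffunE colO.
rewrite -[leqRHS]addn1 leq_add2l.
pose A := [set e in inside S | col e != None].
suff A2 : 2 <= #|A|.
  have : #|A| + #|[set e in inside S | col e == None]| = 3.
    apply: etrans iS; rewrite -[RHS](cardsID [set e | col e != None]); congr (_ + _);
      apply: eq_card => e; rewrite in_set ?in_setI ?in_setD in_set ?negbK //; by rewrite andbC.
  by move: #|A| #|[set e in _ | _]| A2 => x y; lia.
have lamA i : exists2 e, e \in inside S & lam e = i.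
  have : lam @: inside S = setT.
    by apply/eqP; rewrite eqEcard subsetT cardsT card_ord card_in_imset ?iS.
  by move/setP => /(_ i); rewrite in_setT => /imsetP[e ei ->]; exists e.
have [e0 i0 l0] := lamA (f ord0); have [e1 i1 l1] := lamA (f ord_max).
apply/card_gt1P; exists e0, e1; split.
- by apply/setIdP; rewrite colI // (dE _ ord0).
- by apply/setIdP; rewrite colI // (dE _ ord_max).
- by apply/eqP => e01; move: l1; rewrite -e01 l0 => /fI.
Qed.

End ContractTwo.

(** * Triangles and digons *)

Section Reduce.
Variables (V E : finType) (ends : E -> V * V).
Local Notation inc := (incident ends).
Hypotheses (ll : loopless ends) (cub : cubic ends) (bf : bridgefree ends).
Local Notation bd := (cut ends).
Local Notation inside := (inside ends).
Local Notation oth := (oth ends).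
Local Notation nbr := (nbr ends).
Local Notation nedges := (nedges ends).
Implicit Types (S : {set V}) (e f g : E) (u v w p q r a b : V).

(** From 9 = 2i + c: a fourth inside edge would leave a bridge as the cut, and a fifth is
    impossible. *)
Lemma inside_eq3 S : #|S| = 3 -> 3 <= #|inside S| -> #|inside S| = 3.
Proof.
move=> S3 i3; have := cut_card ll cub S; have := bf S; rewrite S3.
by move: #|inside S| #|bd S| i3 => i [|[|c]]; lia.
Qed.

Lemma third_edge p e f : inc p e -> inc p f -> e != f ->
  exists g, [/\ inc p g, g != e, g != f & forall h, inc p h -> h \in [:: e; f; g]].
Proof.
move=> pe pf ef; have : #|[set h | inc p h] :\ e :\ f| = 1.
  have := deg3 cub p; rewrite (cardsD1 e) inE pe (cardsD1 f (_ :\ e)) !inE pf eq_sym ef.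
  by rewrite !add1n => -[].
move/eqP/cards1P => [g gE]; have := set11 g; rewrite -gE !inE => /and3P[gf ge pg].
exists g; split=> // h ph; rewrite !inE.
case: (eqVneq h e) => //= he; case: (eqVneq h f) => //= hf.
by rewrite -in_set1 -gE !inE he hf.
Qed.

Lemma eq_list (X : {set E}) (l : seq E) :
  {subset l <= X} -> uniq l -> #|X| = size l -> X =i l.
Proof.
move=> lX ul Xl; apply/fsym/subset_cardP; last exact/subsetP.
by rewrite Xl; apply/card_uniqP.
Qed.

Lemma inside_list S (i0 i1 i2 : E) : #|S| = 3 -> {subset [:: i0; i1; i2] <= inside S} ->
  uniq [:: i0; i1; i2] -> #|inside S| = 3 /\ inside S =i [:: i0; i1; i2].
Proof.
move=> S3 iI ui; have iS : #|inside S| = 3.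
  apply: inside_eq3 => //; rewrite -[3]/(size [:: i0; i1; i2]) -(card_uniqP ui).
  exact/subset_leq_card/subsetP.
by split=> //; apply: eq_list.
Qed.

Lemma out_cut S p e : p \in S -> inc p e -> e \notin inside S -> e \in bd S.
Proof. by move=> pS pe; rewrite (insideP _ pe) (cutP _ pe) pS; case: (_ \in S). Qed.

Lemma in_inside S p q e : p \in S -> q \in S -> p != q -> inc p e -> inc q e -> e \in inside S.
Proof.
move=> pS qS pq pe qe; rewrite (insideP _ pe) pS -(inc_eq pe qe) //; by rewrite eq_sym.
Qed.

Lemma card_set3 p q r : p != q -> p != r -> q != r -> #|[set p; q; r]| = 3.
Proof. by move=> pq pr qr; rewrite -setUA cardsU1 cards2 !inE negb_or pq pr qr. Qed.

Definition reducible S := exists lam : E -> 'I_3,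
  [/\ #|S| = 3, #|inside S| = 3,
      forall p e f, p \in S -> inc p e -> inc p f -> lam e = lam f -> e = f,
      {in bd S &, injective lam} & {in inside S &, injective lam}].

(** Each inside edge shares its colour with one boundary edge; the condition on [p] says that [p]
    meets every colour through one edge only. *)
Lemma six_edges S (i0 i1 i2 o0 o1 o2 : E) : #|S| = 3 ->
  all (mem (inside S)) [:: i0; i1; i2] -> all (mem (bd S)) [:: o0; o1; o2] ->
  uniq [:: i0; i1; i2] -> uniq [:: o0; o1; o2] ->
  (forall p, p \in S -> exists t0 t1 t2, [/\ t0 \in [:: i0; o0], t1 \in [:: i1; o1],
     t2 \in [:: i2; o2] & forall e, inc p e -> e \in [:: t0; t1; t2]]) -> reducible S.
Proof.
move=> S3 /allP iI /allP oB ui uo H.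
have [iS iE] := inside_list S3 iI ui.
have oE := eq_list oB uo (cut3 ll cub S3 iS).
have io e g : e \in [:: i0; i1; i2] -> g \in [:: o0; o1; o2] -> e != g.
  by move=> /iI ei /oB gb; apply: contraTneq ei => ->; apply: cut_cE.
pose c0 : 'I_3 := @Ordinal 3 0 isT; pose c1 : 'I_3 := @Ordinal 3 1 isT; pose c2 : 'I_3 := @Ordinal 3 2 isT.
pose lam e := if e \in [:: i0; o0] then c0 else if e \in [:: i1; o1] then c1 else c2.
move: (ui) (uo); rewrite /= !inE !negb_or -!andbA => /and4P[n01 n02 n12 _] /and4P[m01 m02 m12 _].
have x01 := io i0 o1; have x02 := io i0 o2; have x10 := io i1 o0; have x12 := io i1 o2.
have x20 := io i2 o0; have x21 := io i2 o1.
rewrite !inE !eqxx !orbT in x01 x02 x10 x12 x20 x21.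
have {}x01 := x01 isT isT; have {}x02 := x02 isT isT; have {}x10 := x10 isT isT.
have {}x12 := x12 isT isT; have {}x20 := x20 isT isT; have {}x21 := x21 isT isT.
have l0 e : e \in [:: i0; o0] -> lam e = c0 by rewrite /lam => ->.
have l1 e : e \in [:: i1; o1] -> lam e = c1.
  rewrite /lam => e1; rewrite e1 ifN // !inE negb_or; move: e1; rewrite !inE => /orP[]/eqP->.
    by rewrite eq_sym n01 x10.
  by rewrite eq_sym x01 eq_sym m01.
have l2 e : e \in [:: i2; o2] -> lam e = c2.
  rewrite /lam => e2; rewrite !ifN // !inE negb_or; move: e2; rewrite !inE => /orP[]/eqP->.
  - by rewrite eq_sym n12 x21.
  - by rewrite eq_sym x12 eq_sym m12.
  - by rewrite eq_sym n02 x20.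
  - by rewrite eq_sym x02 eq_sym m02.
have inj t0 t1 t2 : t0 \in [:: i0; o0] -> t1 \in [:: i1; o1] -> t2 \in [:: i2; o2] ->
    {in [:: t0; t1; t2] &, injective lam}.
  move=> h0 h1 h2 e f; rewrite !inE.
  by case/or3P => /eqP->; case/or3P => /eqP->; rewrite ?(l0 t0) ?(l1 t1) ?(l2 t2).
have hI : {in inside S &, injective lam}.
  by move=> e f; rewrite !iE; apply: inj; rewrite !inE eqxx.
have hB : {in bd S &, injective lam}.
  by move=> e f; rewrite !oE; apply: inj; rewrite !inE eqxx orbT.
exists lam; split=> // p e f pS pe pf.
have [t0 [t1 [t2 [h0 h1 h2 ht]]]] := H p pS.
by apply: (inj t0 t1 t2) => //; apply: ht.
Qed.

(** The boundary edge at a vertex gets the colour of the opposite side. *)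
Lemma triangle_reducible p q r : nbr p q -> nbr q r -> nbr r p -> reducible [set p; q; r].
Proof.
case/nbrP => e2 pe2 e2q /nbrP[e0 qe0 e0r] /nbrP[e1 re1 e1p].
have qe2 : inc q e2 by rewrite -e2q inc_oth.
have re0 : inc r e0 by rewrite -e0r inc_oth.
have pe1 : inc p e1 by rewrite -e1p inc_oth.
have pq : p != q by rewrite -e2q eq_sym oth_neq.
have qr : q != r by rewrite -e0r eq_sym oth_neq.
have rp : r != p by rewrite -e1p eq_sym oth_neq.
have not3 x y w e : inc x e -> inc y e -> x != y -> w != x -> w != y -> inc w e = false.
  move=> xe ye xy wx wy; apply/negP => we.
  by have := wy; rewrite (inc_eq xe we wx) (inc_eq xe ye) ?eqxx // eq_sym.
have re2 : inc r e2 = false by apply: (not3 p q); rewrite // eq_sym.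
have pe0 : inc p e0 = false by apply: (not3 q r); rewrite // eq_sym.
have qe1 : inc q e1 = false by apply: (not3 r p); rewrite // eq_sym.
have e01 : e0 != e1 by apply: contraTneq qe0 => ->; rewrite qe1.
have e02 : e0 != e2 by apply: contraTneq re0 => ->; rewrite re2.
have e12 : e1 != e2 by apply: contraTneq re1 => ->; rewrite re2.
have pr : p != r by rewrite eq_sym.
have S3 : #|[set p; q; r]| = 3 by apply: card_set3.
set S := [set p; q; r] in S3 *.
have [pS qS rS] : [/\ p \in S, q \in S & r \in S] by rewrite !inE !eqxx ?orbT.
have ui : uniq [:: e0; e1; e2] by rewrite /= !inE negb_or e01 e02 e12.
have iI : {subset [:: e0; e1; e2] <= inside S}.
  apply/allP; rewrite /= andbT; apply/and3P; split.
  - exact: (in_inside qS rS qr).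
  - exact: (in_inside rS pS rp).
  - exact: (in_inside pS qS pq).
have [iS iE] := inside_list S3 iI ui.
have [g0 [pg0 g01 g02 P0]] := third_edge pe1 pe2 e12.
have [g1 [qg1 g10 g12 P1]] := third_edge qe0 qe2 e02.
have [g2 [rg2 g20 g21 P2]] := third_edge re0 re1 e01.
have n0 : g0 \notin inside S.
  by rewrite iE !inE (negPf g01) (negPf g02) !orbF; apply: contraTneq pg0 => ->; rewrite pe0.
have n1 : g1 \notin inside S.
  by rewrite iE !inE (negPf g10) (negPf g12) orbF /=; apply: contraTneq qg1 => ->; rewrite qe1.
have n2 : g2 \notin inside S.
  by rewrite iE !inE (negPf g20) (negPf g21) /=; apply: contraTneq rg2 => ->; rewrite re2.
apply: (six_edges (i0 := e0) (i1 := e1) (i2 := e2) (o0 := g0) (o1 := g1) (o2 := g2)) => //.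
- exact/allP.
- by rewrite /= (out_cut pS pg0 n0) (out_cut qS qg1 n1) (out_cut rS rg2 n2).
- rewrite /= !inE negb_or andbT; apply/andP; split; first (apply/andP; split).
  + by apply: contraNneq n0 => gg; apply: (in_inside pS qS pq); rewrite // gg.
  + by apply: contraNneq n0 => gg; apply: (in_inside pS rS pr); rewrite // gg.
  + by apply: contraNneq n1 => gg; apply: (in_inside qS rS qr); rewrite // gg.
move=> x xS; rewrite !inE in xS; case/orP: xS => [/orP[]|] /eqP->.
- exists g0, e1, e2; rewrite !inE !eqxx ?orbT; split=> // e /P0.
  by rewrite !inE => /or3P[]->; rewrite ?orbT.
- exists e0, g1, e2; rewrite !inE !eqxx ?orbT; split=> // e /P1.
  by rewrite !inE => /or3P[]->; rewrite ?orbT.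
- by exists e0, e1, g2; rewrite !inE !eqxx ?orbT; split.
Qed.

(** [b] is the remaining neighbour of [v]. The edge from [v] to [b] shares its colour with the outer
    edge of [u], the two parallel edges share theirs with the outer edges of [b]. The outer edge of
    [u] cannot end in [b]: there would be four inside edges. *)
Lemma digon_reducible u v : nedges u v = 2 -> exists b, reducible [set u; v; b].
Proof.
move=> m2; have /card_gt1P[f1 [f2 []]] : 1 < nedges u v by rewrite m2.
rewrite !inE => /andP[uf1 /eqP f1v] /andP[uf2 /eqP f2v] f12.
have vu : v != u by rewrite -f1v oth_neq.
have uv : u != v by rewrite eq_sym.
have vf1 : inc v f1 by rewrite -f1v inc_oth.
have vf2 : inc v f2 by rewrite -f2v inc_oth.
have only f : inc u f -> inc v f -> f = f1 \/ f = f2.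
  move=> uf vf; case: (eqVneq f f1) => [|n1]; first by left.
  case: (eqVneq f f2) => [|n2]; first by right.
  have : #|[set f; f1; f2]| <= nedges u v.
    apply/subset_leq_card/subsetP => h; rewrite !inE => /orP[/orP[]|]/eqP->.
    - by rewrite uf -(inc_eq uf vf vu) eqxx.
    - by rewrite uf1 f1v eqxx.
    - by rewrite uf2 f2v eqxx.
  by rewrite m2 -setUA cardsU1 cards2 !inE negb_or n1 n2 f12.
have [g [vg g1 g2 Pv]] := third_edge vf1 vf2 f12.
have [gu [ugu gu1 gu2 Pu]] := third_edge uf1 uf2 f12.
pose b := oth v g; have bg : inc b g by apply: inc_oth.
have vb : v != b by rewrite eq_sym oth_neq.
have ub : u != b.
  by apply/eqP => ub; rewrite -ub in bg; case: (only g bg vg) => /eqP; apply/negP.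
exists b; set S := [set u; v; b].
have S3 : #|S| = 3 by apply: card_set3.
have [uS vS bS] : [/\ u \in S, v \in S & b \in S] by rewrite !inE !eqxx ?orbT.
have ui : uniq [:: g; f1; f2] by rewrite /= !inE negb_or g1 g2 f12.
have iI : {subset [:: g; f1; f2] <= inside S}.
  apply/allP; rewrite /= andbT; apply/and3P; split.
  - exact: (in_inside vS bS vb).
  - exact: (in_inside uS vS uv).
  - exact: (in_inside uS vS uv).
have [iS iE] := inside_list S3 iI ui.
have notb x : inc b x -> x = f1 \/ x = f2 -> False.
  have nb h : inc u h -> inc v h -> inc b h -> False.
    move=> uh vh bh; move: vb; rewrite eq_sym => vb'.
    by rewrite (inc_eq uh bh) 1?eq_sym // (inc_eq uh vh vu) eqxx in vb'.
  by move=> bx [] xE; rewrite xE in bx; [apply: (nb f1)|apply: (nb f2)].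
have [h1 [bh1 hg1 P]] : exists h1, [/\ inc b h1, h1 != g & True].
  have /card_gt0P[h] : 0 < #|[set h | inc b h] :\ g|.
    by have := deg3 cub b; rewrite (cardsD1 g) inE bg; case: #|_|.
  by rewrite !inE => /andP[hg bh]; exists h.
have gh1 : g != h1 by rewrite eq_sym.
have [h2 [bh2 h2g h21 Pb]] := third_edge bg bh1 gh1.
have nh h : inc b h -> h != g -> h \notin inside S.
  move=> bh hg; rewrite iE !inE (negPf hg) /=; apply/negP => /orP[]/eqP hE.
    by apply: (notb h bh); left.
  by apply: (notb h bh); right.
have ngu : gu \notin inside S.
  rewrite iE !inE (negPf gu1) (negPf gu2) !orbF; apply/negP => /eqP gug.
  by rewrite gug in ugu; case: (only g ugu vg) => /eqP; apply/negP.
apply: (six_edges (i0 := g) (i1 := f1) (i2 := f2) (o0 := gu) (o1 := h1) (o2 := h2)) => //.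
- exact/allP.
- by rewrite /= (out_cut uS ugu ngu) (out_cut bS bh1 (nh _ bh1 hg1)) (out_cut bS bh2 (nh _ bh2 h2g)).
- rewrite /= !inE negb_or andbT; apply/andP; split; first (apply/andP; split).
  + by apply: contraNneq ngu => gg; apply: (in_inside uS bS ub); rewrite // gg.
  + by apply: contraNneq ngu => gg; apply: (in_inside uS bS ub); rewrite // gg.
  + by rewrite eq_sym.
move=> x xS; rewrite !inE in xS; case/orP: xS => [/orP[]|] /eqP->.
- exists gu, f1, f2; rewrite !inE !eqxx ?orbT; split=> // e /Pu.
  by rewrite !inE => /or3P[]->; rewrite ?orbT.
- exists g, f1, f2; rewrite !inE !eqxx ?orbT; split=> // e /Pv.
  by rewrite !inE => /or3P[]->; rewrite ?orbT.
- by exists g, h1, h2; rewrite !inE !eqxx ?orbT; split.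
Qed.

End Reduce.

(** * Induction *)

(** The substitute for claw-freeness in the induction, since contraction need not keep a graph
    claw-free: only the vertices of weight 1 have to lie in a triangle or on a multiple edge. *)
Definition tight (V E : finType) (ends : E -> V * V) (Z : {set V}) : Prop :=
  forall v, v \notin Z -> (exists a b, [/\ nbr ends v a, nbr ends a b & nbr ends b v]) \/
    exists w, 2 <= nedges ends v w.

Section Step.
Variables (V E : finType) (ends : E -> V * V) (S : {set V}).
Local Notation inc := (incident ends).
Hypotheses (ll : loopless ends) (cub : cubic ends) (bf : bridgefree ends).
Hypothesis red : reducible ends S.
Local Notation inside := (inside ends).
Local Notation quotE := (quotE ends S).
Local Notation quotV := (quotV S).
Local Notation contract := (contract S).
Local Notation quot_ends := (@quot_ends V E ends S).

(** Three edges are lost; going back to the original graph costs at most one uncoloured edge with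
    two colours, and contracting costs none with three. *)
Lemma contract_nu : nu quot_ends 2 + 2 <= nu ends 2 /\ nu ends 3 <= nu quot_ends 3 + 3.
Proof.
have [lam [S3 iS lS lB lI]] := red; have cEE := card_cEE iS; split.
  have [col' pc' u'] := @nu_ex _ _ quot_ends 1.
  have [col pc u] := contract_two S3 iS lS lB lI pc'.
  have := nu_ge pc; rewrite cEE -u'.
  by move: (nu _ _) (nu _ _) (unc col) (unc col') u => x y z w; lia.
have [col pc u] := @nu_ex _ _ ends 2.
have [col' pc' u'] := contract_unc ll cub S3 iS pc.
have := nu_ge pc'; rewrite cEE in u.
by move: (nu _ _) (nu _ _) (unc col) (unc col') u u' => x y z w; lia.
Qed.

Lemma inc_phi x (e : quotE) : inc x (val e) -> incident quot_ends (contract x) e.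
Proof. by rewrite /incident => /orP[]/eqP->; rewrite eqxx ?orbT. Qed.

Lemma oth_phi x (e : quotE) : inc x (val e) -> oth quot_ends (contract x) e = contract (oth ends x (val e)).
Proof.
rewrite /incident /oth => /orP[]/eqP->; first by rewrite !eqxx.
have l1 := ll (val e); have l2 := @cloopless _ _ ends S ll e.
by rewrite /= eq_sym (negPf l2) eq_sym (negPf l1).
Qed.

Lemma nbr_phi x y : nbr ends x y -> ~~ ((x \in S) && (y \in S)) -> nbr quot_ends (contract x) (contract y).
Proof.
case/nbrP => e xe <-; rewrite -(insideP _ xe) => ei; apply/nbrP; exists (Sub e ei).
  exact: inc_phi.
by rewrite oth_phi.
Qed.

Lemma nedges_phi x y : x \notin S -> nedges ends x y <= nedges quot_ends (contract x) (contract y).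
Proof.
move=> xS; apply: (leq_card_rel (R := fun e (e' : quotE) => val e' == e)).
  move=> e; rewrite inE => /andP[xe /eqP ye]; exists (Sub e (out_cE xS xe)); last by rewrite SubK.
  by rewrite inE inc_phi //= oth_phi //= ye.
by move=> e f g _ _ /eqP <- /eqP <-.
Qed.

(** The contracted vertex always joins the set, so nothing is asked of it. *)
Definition quotZ (Z : {set V}) : {set quotV} := [set y | if y is Some x then val x \in Z else true].

Lemma card_cZ Z : #|quotZ Z| <= #|Z|.+1.
Proof.
rewrite (cardsD1 None) inE add1n ltnS; apply: (leq_card_rel (R := fun y v => y == contract v)).
  by move=> [x|]; rewrite !inE // => xZ; exists (val x); rewrite ?contract_val.
by move=> y y' v _ _ /eqP-> /eqP->.
Qed.

(** Multiple edges at a vertex outside [S] survive. A triangle through it with two vertices in [S]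
    becomes a multiple edge to the contracted vertex. One with a single vertex in [S] cannot occur:
    that vertex has two edges inside [S] and would have degree four. *)
Lemma tight_step Z : tight ends Z ->
  (forall u v w, nbr ends u v -> nbr ends v w -> nbr ends w u -> False) \/
  (forall p, p \in S -> exists e f, [/\ e != f, inc p e, inc p f, e \in inside S & f \in inside S]) ->
  tight quot_ends (quotZ Z).
Proof.
move=> tZ shape [x|]; rewrite inE // => xZ; have xS := valP x.
case: (tZ _ xZ) => [[a [b [n1 n2 n3]]]|[w m2]]; last first.
  by right; exists (contract w); apply: leq_trans m2 _; rewrite -contract_val; apply: nedges_phi.
case: shape => [notri|two]; first by case: (notri _ _ _ n1 n2 n3).
have no p v1 v2 : p \in S -> v1 \notin S -> v2 \notin S -> v1 != v2 -> nbr ends p v1 -> nbr ends p v2 -> False.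
  move=> pS v1S v2S v12 /nbrP[g1 pg1 g1E] /nbrP[g2 pg2 g2E].
  have [e [f [ef pe pf ei fi]]] := two p pS.
  have o1 : g1 \notin inside S by rewrite (insideP _ pg1) pS g1E.
  have o2 : g2 \notin inside S by rewrite (insideP _ pg2) pS g2E.
  have : #|[:: e; f; g1; g2]| <= #|[set h | inc p h]|.
    apply/subset_leq_card/subsetP => h; rewrite !inE.
    by case/or4P => /eqP->.
  rewrite deg3 // (card_uniqP _) //= !inE !negb_or ef /=.
  have ne h g : h \in inside S -> g \notin inside S -> h != g by move=> hi; apply: contraNneq => <-.
  rewrite (ne e g1) // (ne e g2) // (ne f g1) // (ne f g2) //= andbT.
  by apply: contraNneq v12 => gg; rewrite -g1E -g2E gg.
have xa : val x != a by case/nbrP: n1 => e _ <-; rewrite eq_sym oth_neq.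
have ab : a != b by case/nbrP: n2 => e _ <-; rewrite eq_sym oth_neq.
have bx : b != val x by case/nbrP: n3 => e _ <-; rewrite eq_sym oth_neq.
case: (boolP (a \in S)) => aS; case: (boolP (b \in S)) => bS.
- right; exists None; rewrite nbrC in n3.
  case/nbrP: n1 => e1 xe1 e1a; case/nbrP: n3 => e2 xe2 e2b.
  apply/card_gt1P; exists (Sub e1 (out_cE xS xe1)), (Sub e2 (out_cE xS xe2)).
  rewrite !inE -!contract_val !inc_phi // !oth_phi //= e1a e2b !contract_in // !eqxx; split=> //.
  by rewrite -(inj_eq val_inj) /=; apply: contraNneq ab => ee; rewrite -e1a -e2b ee.
- by rewrite nbrC in n1; case: (no a (val x) b); rewrite // eq_sym.
- by rewrite nbrC in n2; case: (no b a (val x)); rewrite // eq_sym.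
- left; exists (contract a), (contract b); rewrite -contract_val.
  by split; apply: nbr_phi; rewrite // negb_and ?xS ?aS ?bS ?orbT.
Qed.

End Step.

Lemma base_case (V E : finType) (ends : E -> V * V) (Z : {set V}) :
  loopless ends -> cubic ends -> bridgefree ends -> tight ends Z ->
  (forall u v w, nbr ends u v -> nbr ends v w -> nbr ends w u -> False) ->
  (forall u v, nedges ends u v != 2) ->
  141 * #|V| + 70 * nu ends 3 <= #|V| + 2 * #|Z| + 70 * #|E| + 141 * nu ends 2.
Proof.
move=> ll cub bf tZ notri nodig.
have [A [B [C [col [t ex]]]]] := extremal_ex ends.
have oc : opt ends col by case: ex.
have Zc v : v \notin Z -> exists w, forall e, incident ends v e -> oth ends v e = w.
  move=> /tZ[[a [b [n1 n2 n3]]]|[w m2]]; first by case: (notri _ _ _ n1 n2 n3).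
  (* At least two edges lead to [w] but not exactly two, so all three at [v] do. *)
  exists w => e ve; have : [set e | incident ends v e && (oth ends v e == w)] = [set e | incident ends v e].
    apply/eqP; rewrite eqEcard deg3 //; apply/andP; split.
      by apply/subsetP => h; rewrite !inE => /andP[].
    by rewrite ltn_neqAle eq_sym nodig.
  by move/setP => /(_ e); rewrite !inE ve /= => /eqP.
have mb := main_bound ll cub notri nodig oc Zc t ex bf.
have ZV : #|Z| <= #|V| by apply: max_card.
have u3 : unc col + nu ends 3 <= #|E|.
  have [c3 pc3 <-] := @nu_ex _ _ ends 2; rewrite addnC leq_add2l.
  by case: oc => _; apply.
have s2 : size_of col B + size_of col C <= nu ends 2.
  pose c2 : {ffun E -> option 'I_2} := [ffun e => if col e == Some B then Some ord0
    else if col e == Some C then Some ord_max else None].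
  have [_ _ BC] := tri_neq t; have [pc _] := oc.
  have pc2 : pcol ends c2.
    have c2E e b : c2 e = Some b -> col e = Some (if b == ord0 then B else C).
      by rewrite ffunE; case: eqP => [-> [<-]|_] //; case: eqP => [-> [<-]|].
    by apply/pcolP => v e f b ve vf /c2E ec /c2E fc; apply: (pcolP _ _ pc v e f _ ve vf ec fc).
  have := nu_ge pc2; rewrite -(unc_colored c2) leq_add2r; apply: leq_trans.
  rewrite /size_of -cardsUI (_ : _ :&: _ = set0) ?cards0 ?addn0.
    apply/subset_leq_card/subsetP => e; rewrite !inE ffunE.
    by case: eqP => // _; case: eqP.
  apply/setP => e; rewrite !inE; apply/negP => /andP[/eqP-> /eqP[bc]].
  by rewrite bc eqxx in BC.
move: #|V| #|Z| #|E| (nu ends 2) (nu ends 3) (unc col) (size_of col B) (size_of col C) mb ZV u3 s2.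
by move=> *; lia.
Qed.

(* Vertices of [Z], in particular those created by a contraction, have weight 3, the others
   weight 1; the total weight is [#|V| + 2 * #|Z|]. *)
Lemma weighted_bound (V E : finType) (ends : E -> V * V) (Z : {set V}) :
  loopless ends -> cubic ends -> bridgefree ends -> tight ends Z ->
  141 * #|V| + 70 * nu ends 3 <= #|V| + 2 * #|Z| + 70 * #|E| + 141 * nu ends 2.
Proof.
have [n] := ubnP #|V|; elim: n V E ends Z => // n IH V E ends Z ltn ll cub bf tZ.
have step S : reducible ends S ->
    (forall u v w, nbr ends u v -> nbr ends v w -> nbr ends w u -> False) \/
    (forall p, p \in S -> exists e f, [/\ e != f, incident ends p e, incident ends p f,
       e \in inside ends S & f \in inside ends S]) ->
    141 * #|V| + 70 * nu ends 3 <= #|V| + 2 * #|Z| + 70 * #|E| + 141 * nu ends 2.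
  move=> red shape; have [lam [S3 iS _ _ _]] := red.
  have cVV := card_cV S3; have cEE := card_cEE iS.
  have [n2 n3] := contract_nu ll cub red; have cz := card_cZ S Z.
  have := IH _ _ (@quot_ends _ _ ends S) (quotZ S Z) _ (cloopless ll) (ccubic ll cub S3 iS) (cbridgefree bf)
    (tight_step ll cub tZ shape).
  rewrite -cVV in ltn *; rewrite cEE.
  move: #|quotV S| #|quotZ S Z| #|Z| #|quotE ends S| (nu ends 2) (nu ends 3)
    (nu (@quot_ends _ _ ends S) 2) (nu (@quot_ends _ _ ends S) 3) ltn n2 n3 cz.
  by move=> v z z' e a b c d ltn n2 n3 cz H; have := H (ltnW ltn); lia.
case: (boolP [exists p, exists q, exists r, [&& nbr ends p q, nbr ends q r & nbr ends r p]]) => [|notri].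
  case/existsP => p /existsP[q /existsP[r /and3P[pq qr rp]]].
  apply: (step [set p; q; r]); first exact: triangle_reducible.
  right; move=> x; rewrite !inE.
  have two a b c : nbr ends a b -> nbr ends c a -> b != c -> a \in [set p; q; r] -> b \in [set p; q; r] ->
      c \in [set p; q; r] -> exists e f, [/\ e != f, incident ends a e, incident ends a f,
       e \in inside ends [set p; q; r] & f \in inside ends [set p; q; r]].
    move=> /nbrP[e ae eb]; rewrite nbrC => /nbrP[f af fc] bc aS bS cS; exists e, f; split=> //.
    - by apply: contraNneq bc => ef; rewrite -eb -fc ef.
    - by rewrite (insideP _ ae) aS eb bS.
    - by rewrite (insideP _ af) aS fc cS.
  have ne a b : nbr ends a b -> b != a by case/nbrP => e _ <-; apply: oth_neq.
  case/orP => [/orP[]|] /eqP->.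
  - by apply: (two p q r); rewrite ?inE ?eqxx ?orbT // eq_sym ne.
  - by apply: (two q r p); rewrite ?inE ?eqxx ?orbT // eq_sym ne.
  - by apply: (two r p q); rewrite ?inE ?eqxx ?orbT // eq_sym ne.
have {}notri u v w : nbr ends u v -> nbr ends v w -> nbr ends w u -> False.
  move=> uv vw wu; case/negP: notri; apply/existsP; exists u; apply/existsP; exists v.
  by apply/existsP; exists w; rewrite uv vw wu.
case: (boolP [exists u, exists v, nedges ends u v == 2]) => [|nodig].
  case/existsP => u /existsP[v /eqP m2].
  have [b red] := digon_reducible ll cub bf m2.
  by apply: step red _; left.
apply: base_case => // u v; apply: contraNneq nodig => m2.
by apply/existsP; exists u; apply/existsP; exists v; rewrite m2.
Qed.

(** * The theorem *)

Section ClawFreeBridgeless.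
Variables (V E : finType) (ends : E -> V * V).
Local Notation inc := (incident ends).

(** The components without [e] map onto those of the whole graph. Were their number not larger, this
    map would be injective and the ends of [e] connected without [e], although [X] separates
    them. *)
Lemma bridgeless_bridgefree : loopless ends -> bridgeless ends -> bridgefree ends.
Proof.
move=> ll bl X; apply/negP => /cards1P[e cE].
apply: (negP (bl e)); rewrite /bridge /ncomp.
pose cl F x := [set y | connect (adjF ends F) x y].
have sym F : connect_sym (adjF ends F).
  apply: sym_connect_sym => x y; apply: eq_existsb => f.
  by rewrite /joins orbC.
have clE F x y : connect (adjF ends F) x y -> cl F x = cl F y.
  by move=> xy; apply/setP => w; rewrite !inE; apply: same_connect xy w.
have sub F x y : connect (adjF ends F) x y -> connect (adjF ends setT) x y.
  apply: connect_sub => a b /exists_inP[f _ fj]; apply: connect1.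
  by apply/exists_inP; exists f.
pose up (B : {set V}) : {set V} := \bigcup_(x in B) cl setT x.
have upE x : up (cl (~: [set e]) x) = cl setT x.
  apply/setP => w; apply/bigcupP/idP => [[y]|xw]; last by exists x; rewrite // inE.
  by rewrite inE => /sub /clE ->.
set A' := [set cl (~: [set e]) x | x : V].
have -> : [set cl setT x | x : V] = up @: A'.
  by rewrite /A' -imset_comp; apply: eq_imset => x; rewrite /= upE.
rewrite ltn_neqAle leq_imset_card andbT; apply/negP => /imset_injP inj.
pose u := (ends e).1; pose w := (ends e).2.
have euw : joins ends u w e by rewrite /joins /u /w -surjective_pairing eqxx.
have cuw : connect (adjF ends setT) u w.
  by apply/connect1/exists_inP; exists e.
have : cl (~: [set e]) u = cl (~: [set e]) w.
  by apply: inj; rewrite ?imset_f // !upE; apply: clE.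
move/setP => /(_ w); rewrite !inE connect0 => uw.
have stay x y : connect (adjF ends (~: [set e])) x y -> (x \in X) = (y \in X).
  move=> xy; apply/esym; apply: (closed_connect (e := adjF ends (~: [set e])) (a := mem X)) => //.
    move=> a b /exists_inP[f]; rewrite !inE => fe fab.
    have : f \notin cut ends X by rewrite cE inE.
    by rewrite inE negbK; case/orP: fab => /eqP-> /= /eqP.
  by rewrite sym.
have : e \in cut ends X by rewrite cE inE.
by rewrite inE -/u -/w (stay u w uw) eqxx.
Qed.

Lemma claw_free_tight : loopless ends -> cubic ends -> claw_free ends -> tight ends set0.
Proof.
move=> ll cub cf v _; have d3 := deg3 cub v.
have /card_gt2P[e1 [e2 [e3 [[]]]]] : 2 < #|[set e | inc v e]| by rewrite d3.
rewrite !inE => v1 v2 v3 [n12 n23 n31].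
have dup e f : inc v e -> inc v f -> e != f -> oth ends v e = oth ends v f ->
    exists w, 2 <= nedges ends v w.
  move=> ve vf ef eqo; exists (oth ends v e); apply/card_gt1P; exists e, f.
  by rewrite !inE ve vf eqo eqxx.
case: (eqVneq (oth ends v e1) (oth ends v e2)) => [eqo|o12]; first by right; apply: dup eqo.
case: (eqVneq (oth ends v e2) (oth ends v e3)) => [eqo|o23]; first by right; apply: dup eqo.
case: (eqVneq (oth ends v e3) (oth ends v e1)) => [eqo|o31]; first by right; apply: dup eqo.
have multE a : v != a -> mult ends v a = nedges ends v a.
  move=> va; apply: eq_card => e; rewrite !inE joinsE //; case ve: (inc v e) => //=.
  apply/idP/eqP => [ae|<-]; last exact: inc_oth.
  by rewrite (inc_eq ve ae) // eq_sym.
have vo e : v != oth ends v e by rewrite eq_sym oth_neq.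
case: (boolP [exists w, 2 <= nedges ends v w]) => [/existsP[w m2]|N2]; first by right; exists w.
have m1 e : inc v e -> mult ends v (oth ends v e) == 1.
  move=> ve; rewrite multE // eqn_leq; apply/andP; split.
    by rewrite leqNgt; apply: contra N2 => m2; apply/existsP; exists (oth ends v e).
  by apply/card_gt0P; exists e; rewrite inE ve eqxx.
have tri a b : a != b -> mult ends a b != 0 -> nbr ends a b.
  move=> ab; rewrite -lt0n => /card_gt0P[f]; rewrite inE joinsE // => /andP[af bf].
  by apply/nbrP; exists f; rewrite // -(inc_eq af bf) // eq_sym.
have no e : inc v e -> nbr ends v (oth ends v e) by move=> ve; apply/nbrP; exists e.
have o13 : oth ends v e1 != oth ends v e3 by rewrite eq_sym.
have := cf v (oth ends v e1) (oth ends v e2) (oth ends v e3).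
rewrite /induced_claw !m1 //= !inE !negb_or !vo o12 o23 o13 /= !negb_and => /or3P[] /tri nb; left.
- by exists (oth ends v e1), (oth ends v e2); split; rewrite ?no ?nb // nbrC no.
- by exists (oth ends v e1), (oth ends v e3); split; rewrite ?no ?nb // nbrC no.
- by exists (oth ends v e2), (oth ends v e3); split; rewrite ?no ?nb // nbrC no.
Qed.

End ClawFreeBridgeless.

Local Open Scope ring_scope.

Theorem theorem12 (V E : finType) (ends : E -> V * V) :
  loopless ends -> cubic ends -> bridgeless ends -> claw_free ends ->
  (48 <= #|V|)%N ->
  (140%:R / 141%:R) * (((#|V| + 2 * nu ends 3)%N)%:R / 4%:R)
    <= (nu ends 2)%:R :> rat.
Proof.
move=> ll cub bl cf _.
have wb := weighted_bound ll cub (bridgeless_bridgefree ll bl) (claw_free_tight ll cub cf).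
have VE : (3 * #|V| = 2 * #|E|)%N.
  have := cut_card ll cub [set: V]; rewrite cardsT => ->.
  have -> : cut ends [set: V] = set0 by apply/setP => e; rewrite !inE.
  have -> : inside ends [set: V] = [set: E] by apply/setP => e; rewrite !inE.
  by rewrite cards0 addn0 cardsT.
rewrite cards0 muln0 addn0 in wb.
(* With 2 #|E| = 3 #|V| the bound reads 35 #|V| + 70 nu_3 <= 141 nu_2; here it is multiplied by
   4. *)
have key : (140 * (#|V| + 2 * nu ends 3) <= 564 * nu ends 2)%N.
  by move: #|V| #|E| (nu ends 2) (nu ends 3) wb VE => n m a b; lia.
have : (140 * (#|V| + 2 * nu ends 3)%N%:R <= 564 * (nu ends 2)%:R :> rat).
  by rewrite -!natrM ler_nat.
by move: (_%:R : rat) (_%:R : rat) => x y; lra.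
Qed.
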